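(* Let $\Omega$ be a regular cell complex whose geometric realization is a compact $n$-dimensional manifold $M$, let $\chi(M)$ be the Euler characteristic of $M$, and let $P$ be the face poset of $\Omega$. (i) If $n$ is odd, then $P$ is Eulerian, and hence $\Psi(P)$ can be written as a polynomial in $\mathbf{c}$ and $\mathbf{d}$. (ii) If $n$ is even, then $$\Psi(P)=\Bigl(1-\frac{\chi(M)}{2}\Bigr)(\mathbf{a}-\mathbf{b})^{n+1}+\frac{\chi(M)}{2}\,\mathbf{c}^{n+1}+\Phi,$$ where $\Phi$ is a homogeneous $\mathbf{cd}$-polynomial of degree $n+1$ that does not contain the term $\mathbf{c}^{n+1}$.
   Context: The face poset of a cell complex $\Omega$ consists of the cells of $\Omega$ together with an adjoined minimum $\hat0$ and maximum $\hat1$, with $\tau<\sigma$ iff $\tau$ is contained in the closure of $\sigma$; a cell of dimension $i$ has rank $i+1$, $\hat0$ has rank $0$, and $\hat1$ has rank $n+2$ when $\Omega$ is $n$-dimensional. A regular cell complex is one with finitely many cells, where each closed cell $\bar\sigma$ with boundary $\bar\sigma-\sigma$ is homeomorphic to a pair $(B^k,S^{k-1})$, and each boundary is a disjoint union of smaller cells. For a poset $P$ with minimum $\hat0$, maximum $\hat1$ and rank function $\rho$ with $\rho(\hat0)=0$, $\rho(\hat1)=N+1$: for $S=\{s_1<\dots<s_{k-1}\}\subseteq\{1,\dots,N\}$, $f_S$ is the number of chains $\hat0<x_1<\dots<x_{k-1}<\hat1$ with $\rho(x_j)=s_j$; $h_S=\sum_{T\subseteq S}(-1)^{|S-T|}f_T$;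 and the $\mathbf{ab}$-index is $\Psi(P)=\sum_{S\subseteq\{1,\dots,N\}}h_S u_S$ in the ring $\mathbb{Z}\langle\mathbf a,\mathbf b\rangle$ of noncommutative polynomials, where $u_S=u_1\cdots u_N$ with $u_i=\mathbf b$ if $i\in S$ and $u_i=\mathbf a$ otherwise. Set $\mathbf c=\mathbf a+\mathbf b$ and $\mathbf d=\mathbf{ab}+\mathbf{ba}$; a $\mathbf{cd}$-polynomial is a noncommutative polynomial in $\mathbf c,\mathbf d$ (with $\mathbf c$ of degree 1 and $\mathbf d$ of degree 2). $P$ is Eulerian if $\mu(x,y)=(-1)^{\rho(y)-\rho(x)}$ for all $x\le y$ in $P$, where $\mu$ is the Möbius function. *)

(* Defs.v *)
From HB Require Import structures.
From mathcomp Require Import all_boot all_order all_algebra finmap.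
From mathcomp Require Import all_classical all_reals topology normedtype.
(* The notations of monalg are incompatible with those of MathComp-Analysis. *)
From mathcomp Require Import -(notations) monalg.

Set Implicit Arguments.
Unset Strict Implicit.
Unset Printing Implicit Defensive.

Import Order.TTheory GRing.Theory Num.Theory numFieldNormedType.Exports.

Local Open Scope classical_set_scope.
Local Open Scope ring_scope.

Definition homeomorphic (T U : topologicalType) : Prop :=
  exists (f : T -> U) (g : U -> T),
    [/\ continuous f, continuous g, cancel f g & cancel g f].

(* The pairs (A, A') and (B, B'), with A' `<=` A and B' `<=` B, are
   homeomorphic; [set_type] carries the subspace topology. *)
Definition homeomorphic_pairs (T U : topologicalType)
    (A A' : set T) (B B' : set U) : Prop :=
  exists (f : set_type A -> set_type B) (g : set_type B -> set_type A),
    [/\ continuous f, continuous g, cancel f g, cancel g f &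
        forall x : set_type A, A' (set_val x) <-> B' (set_val (f x))].

(* Manifolds are without boundary, need not be connected, and are nonempty (so
   that "n-dimensional" is meaningful). *)
Definition is_manifold (R : realType) (n : nat) (M : topologicalType) : Prop :=
  [/\ [set: M] !=set0,
      hausdorff_space M,
      @second_countable M &
      forall x : M, exists U : set M,
        [/\ open U, U x & homeomorphic (set_type U) 'rV[R]_n]].

Definition unit_ball (R : realType) (k : nat) : set 'rV[R]_k :=
  [set x | \sum_(i < k) x 0 i ^+ 2 <= 1].

(* The sphere of dimension k - 1; it is empty for k = 0. *)
Definition unit_sphere (R : realType) (k : nat) : set 'rV[R]_k :=
  [set x | \sum_(i < k) x 0 i ^+ 2 = 1].
Arguments unit_ball : clear implicits.
Arguments unit_sphere : clear implicits.

Section SingularHomology.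
Variables (R : realType) (X : topologicalType).

Definition std_simplex (k : nat) : set 'rV[R]_k.+1 :=
  [set x | (forall j, 0 <= x 0 j) /\ \sum_j x 0 j = 1].
Arguments std_simplex : clear implicits.

Definition sing_simplex (k : nat) : Type :=
  continuousType (set_type (std_simplex k)) X.
HB.instance Definition _ k := Choice.on (sing_simplex k).

Definition insert0 (k : nat) (i : 'I_k.+2) (x : 'rV[R]_k.+1) : 'rV[R]_k.+2 :=
  \row_j (if unlift i j is Some j' then x 0 j' else 0).

Lemma insert0_simplex k (i : 'I_k.+2) x :
  std_simplex k x -> std_simplex k.+1 (insert0 i x).
Proof.
move=> [x0 x1]; split=> [j|]; first by rewrite mxE; case: unliftP.
rewrite (bigD1_ord i) //= mxE unlift_none add0r -x1.
by apply: eq_bigr => j _; rewrite mxE liftK.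
Qed.

Definition face_map (k : nat) (i : 'I_k.+2) (x : set_type (std_simplex k)) :
    set_type (std_simplex k.+1) :=
  exist _ (insert0 i (set_val x))
    (mem_set (insert0_simplex i (set_mem (svalP x)))).

Lemma insert0_continuous k (i : 'I_k.+2) : continuous (@insert0 k i).
Proof.
move=> x U [P Px PU]; exists (fun a j => if unlift i (lift i j) is Some _
  then P a (lift i j) else setT) => [a j|y yP].
  by rewrite liftK ord1; have := Px 0 (lift i j); rewrite mxE liftK.
apply: PU => a j; rewrite ord1 mxE; case: unliftP => [j' ->|ji].
  by have := yP 0 j'; rewrite liftK.
by have := Px 0 j; rewrite mxE {1}ji unlift_none => /nbhs_singleton.
Qed.

Lemma face_map_continuous k (i : 'I_k.+2) : continuous (@face_map k i).
Proof.
apply: continuous_comp_initial.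
rewrite (_ : set_val \o _ = @insert0 k i \o set_val)//.
move=> x; apply: continuous_comp; last exact: insert0_continuous.
exact: initial_continuous.
Qed.

Definition sing_face (k : nat) (i : 'I_k.+2) (s : sing_simplex k.+1) :
    sing_simplex k :=
  mkcts (fun x => continuous_comp (@face_map_continuous k i x)
                    (@cts_fun _ _ s (face_map i x))).

Definition sing_chain (k : nat) : lmodType rat := malg (sing_simplex k) rat.

Definition sing_boundary (k : nat) (c : sing_chain k.+1) : sing_chain k :=
  \sum_(s <- msupp c) mcoeff s c *:
    \sum_(i < k.+2) (-1) ^+ i *: (mkmalgU (sing_face i s) 1 : sing_chain k).

Definition is_cycle (k : nat) : sing_chain k -> Prop :=
  match k return sing_chain k -> Prop with
  | 0 => fun _ => True
  | _.+1 => fun c => sing_boundary c = 0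
  end.

Definition is_boundary (k : nat) (c : sing_chain k) : Prop :=
  exists b : sing_chain k.+1, sing_boundary b = c.

(* The homology classes of z 0, ..., z (m - 1) form a basis of H_k(X; Q). *)
Definition is_homology_basis (k m : nat) (z : 'I_m -> sing_chain k) : Prop :=
  [/\ forall i, is_cycle (z i),
      forall a : 'I_m -> rat,
        is_boundary (\sum_i a i *: z i) -> forall i, a i = 0 &
      forall c, is_cycle c ->
        exists a : 'I_m -> rat, is_boundary (c - \sum_i a i *: z i)].

(* The dimension of H_k(X; Q), by convention 0 when it is infinite. *)
Definition betti (k : nat) : nat :=
  xget 0%N [set m | exists z : 'I_m -> sing_chain k, is_homology_basis z].

(* The sum has the junk value 0 when infinitely many terms are nonzero. *)
Definition euler_char : int :=
  \sum_(k \in [set: nat]) (-1) ^+ k * (betti k)%:Z.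

End SingularHomology.

(* The open cells are subsets of M, which is itself the geometric realization. *)
Record regular_cell_complex (R : realType) (M : topologicalType) :=
    RegularCellComplex {
  cell_index :> finType;
  cell : cell_index -> set M;
  cell_dim : cell_index -> nat;
  cell_disjoint : trivIset [set: cell_index] cell;
  cell_cover : \bigcup_s cell s = [set: M];
  cell_ball : forall s,
    homeomorphic_pairs (closure (cell s)) (closure (cell s) `\` cell s)
      (unit_ball R (cell_dim s)) (unit_sphere R (cell_dim s));
  cell_boundary : forall s, exists D : set cell_index,
    (forall t, D t -> (cell_dim t < cell_dim s)%N) /\
    closure (cell s) `\` cell s = \bigcup_(t in D) cell t
}.

Section FacePoset.
Variables (R : realType) (M : topologicalType) (Om : regular_cell_complex R M).

Definition complex_dim : nat := \max_(s : Om) cell_dim s.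

(* [inl false] is the adjoined minimum and [inl true] the adjoined maximum. *)
Definition face_poset : Type := (bool + Om)%type.
HB.instance Definition _ := Finite.copy face_poset (bool + Om)%type.

Definition face_le (x y : face_poset) : bool :=
  match x, y with
  | inl false, _ => true
  | _, inl true => true
  | inr t, inr s => `[< cell t `<=` closure (cell s) >]
  | _, _ => false
  end.

Definition face_rank (x : face_poset) : nat :=
  match x with
  | inl false => 0
  | inr s => (cell_dim s).+1
  | inl true => complex_dim.+2
  end.

Lemma cell_neq0 (s : Om) : cell s !=set0.
Proof.
have [f [g [_ _ _ gK fP]]] := cell_ball s.
have b0 : unit_ball R (cell_dim s) 0.
  by rewrite /unit_ball /= big1 ?ler01 // => i _; rewrite mxE expr0n.
pose o : set_type (unit_ball R (cell_dim s)) := exist _ 0 (mem_set b0).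
exists (set_val (g o)); apply: contrapT => ncell.
have : unit_sphere R (cell_dim s) (set_val o).
  rewrite -(gK o); apply/fP; split => //; exact: set_mem (svalP (g o)).
rewrite /unit_sphere /= big1 => [/esym/eqP|i _]; first by rewrite oner_eq0.
by rewrite set_valE /= mxE expr0n.
Qed.

Lemma cell_closure_dim (s t : Om) :
  cell t `<=` closure (cell s) -> t = s \/ (cell_dim t < cell_dim s)%N.
Proof.
move=> ts; have [x tx] := cell_neq0 t.
have [sx|nsx] := pselect (cell s x).
  by left; apply: (@cell_disjoint _ _ Om) => //; exists x.
have [D [Ddim Deq]] := cell_boundary s.
have : (closure (cell s) `\` cell s) x by split => //; exact: ts.
rewrite Deq => -[u Du ux]; right.
suff -> : t = u by exact: Ddim.
by apply: (@cell_disjoint _ _ Om) => //; exists x.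
Qed.

Lemma face_le_refl : reflexive face_le.
Proof. by case=> [[]|s] //=; apply/asboolP; exact: subset_closure. Qed.

Lemma face_le_anti : antisymmetric face_le.
Proof.
case=> [[]|s] [[]|t] //= /andP[/asboolP st /asboolP ts].
case: (cell_closure_dim st) => [->//|l1].
case: (cell_closure_dim ts) => [->//|l2].
by have := ltn_trans l1 l2; rewrite ltnn.
Qed.

Lemma face_le_trans : transitive face_le.
Proof.
case=> [[]|s] [[]|t] [[]|u] //= /asboolP ts /asboolP su; apply/asboolP.
apply: (subset_trans ts) => x sx.
rewrite ((closure_id (closure (cell u))).1 (@closed_closure _ _)).
exact: closure_subset sx.
Qed.

HB.instance Definition _ := Order.Le_isPOrder.Build (Order.Disp tt tt)
  face_poset face_le_refl face_le_anti face_le_trans.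

Lemma face_le0x (x : face_poset) : (inl false <= x :> face_poset)%O.
Proof. by []. Qed.

Lemma face_lex1 (x : face_poset) : (x <= inl true :> face_poset)%O.
Proof. by case: x => [[]|s]. Qed.

HB.instance Definition _ :=
  Order.hasBottom.Build (Order.Disp tt tt) face_poset face_le0x.
HB.instance Definition _ :=
  Order.hasTop.Build (Order.Disp tt tt) face_poset face_lex1.

End FacePoset.

Section Mobius.
Variables (disp : Order.disp_t) (P : finTBPOrderType disp).

(* The standard recursion mu(x, x) = 1 and
   mu(x, y) = - \sum_(x <= z < y) mu(x, z) for x < y, cut at depth [k]. *)
Fixpoint mobius_rec (k : nat) (x y : P) : int :=
  match k with
  | 0 => 0
  | k'.+1 => if x == y then 1 else
             if (x < y)%O then - \sum_(z : P | (x <= z < y)%O) mobius_rec k' x z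
             else 0
  end.

Definition mobius : P -> P -> int := mobius_rec #|P|.

Lemma mobius_recE k (x y : P) :
  (#|[pred z : P | z <= y]%O| <= k)%N -> mobius_rec k x y = mobius x y.
Proof.
have aux k1 k2 (y' : P) : (#|[pred z : P | z <= y']%O| <= k1 <= k2)%N ->
    mobius_rec k1 x y' = mobius_rec k2 x y'.
  elim: k1 k2 y' => [|k1 IH] k2 y' /andP[hk].
    by move: hk; rewrite leqn0 => /eqP/card0_eq/(_ y'); rewrite inE lexx.
  case: k2 => // k2; rewrite ltnS /= => k12; case: eqP => // _; case: ifP => // _.
  congr (- _); apply: eq_bigr => z /andP[_ zy]; apply: IH.
  rewrite k12 andbT -ltnS; apply: leq_trans hk; apply: proper_card.
  apply/properP; split; last first.
    by exists y'; rewrite !inE ?lexx // lt_geF.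
  by apply/fintype.subsetP => w; rewrite !inE => /le_trans; apply; exact: ltW.
move=> hk; rewrite /mobius; have hP := max_card [pred z : P | z <= y]%O.
have [h|/ltnW h] := leqP k #|P|; first by apply: aux; rewrite hk.
by apply/esym/aux; rewrite hP h.
Qed.

Lemma mobius_xx (x : P) : mobius x x = 1.
Proof.
rewrite /mobius; have : (0 < #|P|)%N by apply/card_gt0P; exists x.
by case: #|P| => //= k _; rewrite eqxx.
Qed.

Lemma mobius_lt (x y : P) : (x < y)%O ->
  mobius x y = - \sum_(z : P | (x <= z < y)%O) mobius x z.
Proof.
move=> xy; rewrite -(@mobius_recE #|P|.+1) ?leqW ?max_card //= xy lt_eqF //.
Qed.

Variable rho : P -> nat.

Definition is_eulerian : Prop :=
  forall x y : P, (x <= y)%O -> mobius x y = (-1) ^+ (rho y - rho x).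

End Mobius.

(* Noncommutative polynomials over A in two variables, the letters of the words
   being [false] and [true]. *)
Notation ncpoly A := (malg (fmonom bool) A).

Definition nc_a (A : nzRingType) : ncpoly A := mkmalgU (fmu false) 1.
Definition nc_b (A : nzRingType) : ncpoly A := mkmalgU (fmu true) 1.
Definition nc_c (A : nzRingType) : ncpoly A := nc_a A + nc_b A.
Definition nc_d (A : nzRingType) : ncpoly A :=
  nc_a A * nc_b A + nc_b A * nc_a A.

Section AbIndex.
Variables (disp : Order.disp_t) (P : finTBPOrderType disp) (rho : P -> nat).

(* The number N such that the maximum of P has rank N + 1; the element i of
   'I_poset_N stands for the rank i + 1. *)
Definition poset_N : nat := (rho \top%O).-1.

Definition rank_seq (S : {set 'I_poset_N}) : seq nat :=
  [seq (val i).+1 | i <- enum S].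

Definition flag_f (S : {set 'I_poset_N}) : nat :=
  #|[pred x : #|S|.-tuple P |
      sorted <%O (\bot%O :: rcons x \top%O) && (map rho x == rank_seq S)]|.

Definition flag_h (S : {set 'I_poset_N}) : int :=
  \sum_(T : {set 'I_poset_N} | T \subset S) (-1) ^+ #|S :\: T| * (flag_f T)%:Z.

Definition ab_word (A : nzRingType) (S : {set 'I_poset_N}) : ncpoly A :=
  \prod_(i < poset_N) (if i \in S then nc_b A else nc_a A).

(* The ab-index, viewed in A<a, b>; it is the ab-index itself for A = int. *)
Definition ab_index (A : nzRingType) : ncpoly A :=
  \sum_(S : {set 'I_poset_N}) (flag_h S)%:~R *: ab_word A S.

End AbIndex.

(* A cd-polynomial is represented by an integer polynomial F in two free
   variables, the letter [false] standing for c and [true] for d; [cd_eval A F]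
   is its expansion in A<a, b>. *)
Definition cd_eval (A : nzRingType) (F : ncpoly int) : ncpoly A :=
  mmap (fun z : int => z%:~R)
    (fun w : fmonom bool => \prod_(l <- w) (if l then nc_d A else nc_c A)) F.

Definition cd_degree (w : fmonom bool) : nat :=
  \sum_(l <- w) (if l then 2 else 1)%N.

Definition cd_homogeneous (k : nat) (F : ncpoly int) : Prop :=
  forall w : fmonom bool, mcoeff w F != 0 -> cd_degree w = k.

Definition c_power (k : nat) : fmonom bool := FMonom (nseq k false).

(* Main.v *)
Require Import Defs.
From HB Require Import structures.
From mathcomp Require Import all_boot all_order all_algebra.
From mathcomp Require Import all_classical all_reals topology normedtype.
From mathcomp Require Import -(notations) monalg.
From mathcomp Require Import finmap sequences realfun zify ring lra.

Set Implicit Arguments.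
Unset Strict Implicit.
Unset Printing Implicit Defensive.

Import Order.TTheory GRing.Theory Num.Theory numFieldNormedType.Exports.

Local Open Scope classical_set_scope.
Local Open Scope ring_scope.

(** Singular chains are treated in augmented form and indexed by the number of
    vertices, so that the homology of a pair of open sets obeys one uniform
    Mayer-Vietoris formula. Attaching a cell of dimension k changes the reduced
    Euler characteristic by the class of a punctured ball; after deleting the
    centre x of a cell t, a cell having t in its boundary contributes nothing
    instead, because a ball minus a ray is star-shaped. Hence the Euler
    characteristic of a subcomplex, or of a subcomplex minus x, is the
    alternating number of its cells (not above t). Comparing with the balls and
    with the charts of the manifold gives the Euler relation of every interval
    of the face poset except possibly the whole poset, where the defect is
    measured by the Euler characteristic of M.

    In the letters x = a - b and y = b the ab-index has the flag f-vector as
    coefficients, and c = x + 2y, d = xy + yx + 2yy. The Euler relations become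
    the generalized Dehn-Sommerville relations; these are stable under the
    division f = c f1 + d f2, which produces the cd-polynomial over the
    integers. For n even, subtracting half the Euler characteristic times c^(n+1)
    turns the flag vector into an integral solution of these relations. *)

(** * Dimensions of subquotients *)

(** All homology is handled as cycles modulo boundaries inside fixed spaces of chains, and
    isomorphisms are given by linear relations, so neither quotient spaces nor connecting maps have
    to be constructed. With augmented chains the empty set has one class, in index 0; it is the
    sphere bounding a point, so vertices need no separate treatment.

    Links of cells need not be spheres, so the Euler relation above a cell is not read off a link:
    it compares two computations of M with one point removed. The rank of the maximum involves the
    dimension of the complex, which therefore has to be identified with n; a class in a punctured
    neighbourhood does this. For odd n the Euler characteristic vanishes by counting incident pairs
    of cells in two ways, without duality.

    For even n, put N = n + 1 and let chi be the Euler characteristic. The vector of (1 - chi/2) x^N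
    + (chi/2) c^N takes the value 1 on the empty set and chi 2^(k-1) on a set of k > 0 ranks. It is
    integral for either parity of chi, and it agrees with the flag vector on the empty set, which is
    why the remainder has no term c^N. *)

Section Submodules.
Variable E : lmodType rat.

Definition submod (A : E -> Prop) : Prop :=
  A 0 /\ forall (a : rat) u v, A u -> A v -> A (a *: u + v).

Variables (A : E -> Prop) (A_mod : submod A).

Lemma submodD u v : A u -> A v -> A (u + v).
Proof. by move=> Au Av; rewrite -[u]scale1r; apply: A_mod.2. Qed.

Lemma submodZ a u : A u -> A (a *: u).
Proof. by move=> Au; rewrite -[_ *: _]addr0; apply: A_mod.2 => //; exact: A_mod.1. Qed.

Lemma submodN u : A u -> A (- u).
Proof. by rewrite -scaleN1r; exact: submodZ. Qed.

Lemma submodB u v : A u -> A v -> A (u - v).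
Proof. by move=> Au Av; apply: submodD => //; exact: submodN. Qed.

Lemma submod_sum (I : Type) (r : seq I) (P : pred I) (F : I -> E) :
  (forall i, P i -> A (F i)) -> A (\sum_(i <- r | P i) F i).
Proof.
by move=> AF; elim/big_ind: _ => // [|u v]; [exact: A_mod.1 | exact: submodD].
Qed.

Lemma submod_subr u v : A (u - v) -> A v -> A u.
Proof. by move=> h Av; rewrite -(subrK v u); exact: submodD. Qed.

End Submodules.

Lemma submodI (E : lmodType rat) (A B : E -> Prop) :
  submod A -> submod B -> submod (fun x => A x /\ B x).
Proof.
move=> hA hB; split; first by split; [exact: hA.1 | exact: hB.1].
by move=> a u v [Au Bu] [Av Bv]; split; [exact: hA.2 | exact: hB.2].
Qed.

Lemma submod_add (E : lmodType rat) (A B : E -> Prop) :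
  submod A -> submod B -> submod (fun x => exists u v, [/\ A u, B v & x = u + v]).
Proof.
move=> hA hB; split; first by exists 0, 0; rewrite addr0; split; [exact: hA.1|exact: hB.1|].
move=> a _ _ [u [v [Au Bv ->]]] [u' [v' [Au' Bv' ->]]].
exists (a *: u + u'), (a *: v + v'); split; [exact: hA.2|exact: hB.2|].
by rewrite scalerDr addrACA.
Qed.

Section Dimension.
Variable E : lmodType rat.
Implicit Types (Z B Y : E -> Prop).

(* The classes of z 0, ..., z (m - 1) form a basis of Z / B. *)
Definition sqbasis Z B m (z : 'I_m -> E) : Prop :=
  [/\ forall i, Z (z i),
      forall a : 'I_m -> rat, B (\sum_i a i *: z i) -> forall i, a i = 0 &
      forall c, Z c -> exists a : 'I_m -> rat, B (c - \sum_i a i *: z i)].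

(** A relation rather than a function: an infinite dimension is the absence of any [m], so
    finiteness never has to be assumed separately. Uniqueness is [sqdim_inj]. *)
Definition sqdim Z B m : Prop := exists z : 'I_m -> E, sqbasis Z B z.

Lemma eq_sqdim Z B Z' B' m :
  (forall c, Z c <-> Z' c) -> (forall c, B c <-> B' c) ->
  sqdim Z B m -> sqdim Z' B' m.
Proof.
move=> hZ hB [z [z1 z2 z3]]; exists z; split=> [i|a /hB|c /hZ /z3 [a /hB h]].
- exact/hZ.
- exact: z2.
- by exists a.
Qed.

Lemma sqdim0P Z B : submod B -> (forall c, Z c -> B c) <-> sqdim Z B 0.
Proof.
move=> hB; split=> [ZB|[z [_ _ h]] c /h [a]]; last by rewrite big_ord0 subr0.
exists (fun _ => 0); split=> [[]//|a _ []//|c /ZB Bc].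
by exists (fun _ => 0); rewrite big_ord0 subr0.
Qed.

Lemma sqdim_cat Z Y B p q : submod B -> submod Y -> submod Z ->
  (forall c, B c -> Y c) -> (forall c, Y c -> Z c) ->
  sqdim Y B p -> sqdim Z Y q -> sqdim Z B (p + q).
Proof.
move=> hB hY hZ BY YZ [y [y1 y2 y3]] [z [z1 z2 z3]].
pose g T (f1 : 'I_p -> T) (f2 : 'I_q -> T) i :=
  match fintype.split i with inl j => f1 j | inr j => f2 j end.
have gl T (f1 : 'I_p -> T) f2 j : g T f1 f2 (lshift q j) = f1 j.
  by rewrite /g (unsplitK (inl j)).
have gr T (f1 : 'I_p -> T) f2 j : g T f1 f2 (rshift p j) = f2 j.
  by rewrite /g (unsplitK (inr j)).
exists (g _ y z).
have splitE (a : 'I_(p + q) -> rat) : \sum_i a i *: g _ y z i =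
    \sum_j a (lshift q j) *: y j + \sum_j a (rshift p j) *: z j.
  by rewrite big_split_ord; congr (_ + _); apply: eq_bigr => j _; rewrite (gl, gr).
split=> [i|a|c Zc].
- by rewrite /g; case: fintype.split => j; [apply/YZ/y1 | exact: z1].
- rewrite splitE => Ba.
  have az j : a (rshift p j) = 0.
    apply: (z2 (fun j => a (rshift p j))).
    apply: (submod_subr hY (v := - \sum_j a (lshift q j) *: y j)).
      by rewrite opprK addrC; exact: BY.
    by apply: submodN => //; apply: submod_sum => // i _; exact: submodZ.
  move: Ba; rewrite [X in _ + X]big1 ?addr0 => [Ba i|j _]; last by rewrite az scale0r.
  rewrite -(fintype.splitK i); case: (fintype.split i) => j /=; last exact: az.
  exact: (y2 (fun j => a (lshift q j))).
- have [a ha] := z3 _ Zc; have [b hb] := y3 _ ha.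
  exists (g _ b a); rewrite splitE.
  rewrite (eq_bigr _ (fun j _ => congr1 (fun l => l *: y j) (gl _ b a j))).
  rewrite (eq_bigr _ (fun j _ => congr1 (fun l => l *: z j) (gr _ b a j))).
  by rewrite opprD addrA addrAC.
Qed.

End Dimension.

(* A linear relation between Z and Z' that is total on both sides and matches B
   with B' induces an isomorphism of the quotients. *)
Lemma sqdim_rel (E E' : lmodType rat) (Z B : E -> Prop) (Z' B' : E' -> Prop)
    (L : E -> E' -> Prop) m :
  submod Z -> submod Z' ->
  L 0 0 ->
  (forall (a : rat) u v u' v', L u u' -> L v v' -> L (a *: u + v) (a *: u' + v')) ->
  (forall z, Z z -> exists2 z', Z' z' & L z z') ->
  (forall z', Z' z' -> exists2 z, Z z & L z z') ->
  (forall z z', Z z -> Z' z' -> L z z' -> (B z <-> B' z')) ->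
  sqdim Z B m -> sqdim Z' B' m.
Proof.
move=> hZ hZ' L0 LD tot tot' LB [z [z1 z2 z3]].
have /choice[z' hz'] i : exists z', Z' z' /\ L (z i) z'.
  by have [w ? ?] := tot _ (z1 i); exists w.
have Lsum (a : 'I_m -> rat) : L (\sum_i a i *: z i) (\sum_i a i *: z' i).
  elim/big_ind2: _ => // [u u' v v' Lu Lv|i _].
    by have := LD 1 _ _ _ _ Lu Lv; rewrite !scale1r.
  by have := LD (a i) _ _ _ _ (hz' i).2 L0; rewrite !addr0.
have Zs a : Z (\sum_i a i *: z i) by apply: submod_sum => // i _; exact: submodZ.
have Zs' a : Z' (\sum_i a i *: z' i).
  by apply: submod_sum => // i _; apply: submodZ => //; case: (hz' i).
exists z'; split=> [i|a h|c' Zc'].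
- by case: (hz' i).
- by apply: z2; apply/(LB _ _ (Zs a) (Zs' a) (Lsum a)).
- have [c Zc Lc] := tot' _ Zc'; have [a ha] := z3 _ Zc; exists a.
  apply/(LB _ _ (submodB hZ Zc (Zs a)) (submodB hZ' Zc' (Zs' a))) => //.
  by have := LD (-1) _ _ _ _ (Lsum a) Lc; rewrite !scaleN1r addrC [X in L _ X]addrC.
Qed.

Section DimensionTheory.
Variable E : lmodType rat.
Implicit Types (Z B Y : E -> Prop).

(** Additivity of dimension together with the existence of both parts, hence the source of every
    finiteness claim in the Mayer-Vietoris argument. The induction removes the first basis vector:
    [Z1] is the span of the others modulo [B]. *)
Lemma sqdim_split Z Y B m : submod B -> submod Y -> submod Z ->
  (forall c, B c -> Y c) -> (forall c, Y c -> Z c) -> sqdim Z B m ->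
  exists p q, [/\ (p + q = m)%N, sqdim Y B p & sqdim Z Y q].
Proof.
move=> hB; elim: m Z Y => [|m IH] Z Y hY hZ BY YZ.
  move=> /(sqdim0P _ hB) ZB; exists 0%N, 0%N; split=> //; apply/sqdim0P => // c.
    by move/YZ/ZB.
  by move/ZB/BY.
move=> [z [z1 z2 z3]].
pose Z1 c := exists a : 'I_m -> rat, B (c - \sum_i a i *: z (lift ord0 i)).
have hZ1 : submod Z1.
  split; first by exists (fun=> 0); rewrite big1 ?subrr//; [exact: hB.1|move=> ? _; rewrite scale0r].
  move=> a u v [bu hu] [bv hv]; exists (fun i => a * bu i + bv i).
  suff -> : a *: u + v - \sum_i (a * bu i + bv i) *: z (lift ord0 i) =
    a *: (u - \sum_i bu i *: z (lift ord0 i)) + (v - \sum_i bv i *: z (lift ord0 i)).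
    exact: hB.2.
  rewrite scalerBr scaler_sumr addrACA -opprD -big_split /=.
  by congr (_ - _); apply: eq_bigr => i _; rewrite scalerDl scalerA.
have ZZ1 c : Z1 c -> Z c.
  move=> [a h]; apply: (submod_subr hZ (YZ _ (BY _ h))).
  by apply: submod_sum => // i _; exact: submodZ.
have BZ1 c : B c -> Z1 c.
  by move=> Bc; exists (fun=> 0); rewrite big1 ?subr0// => i _; rewrite scale0r.
have Z1z0 a : Z1 (a *: z ord0) -> a = 0.
  move=> [b hb].
  have := z2 (fun i => if unlift ord0 i is Some j then - b j else a).
  move=> /(_ _ ord0); rewrite unlift_none; apply.
  rewrite big_ord_recl unlift_none; move: hb; rewrite -sumrN.
  by congr (B (_ + _)); apply: eq_bigr => j _; rewrite liftK scaleNr.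
have Zdec c : Z c -> exists l, Z1 (c - l *: z ord0).
  move=> /z3 [a]; rewrite big_ord_recl opprD addrA => h.
  by exists (a ord0), (fun i => a (lift ord0 i)).
have dZ1 : sqdim Z1 B m.
  exists (fun i => z (lift ord0 i)); split=> // [i|a Ba i].
    exists (fun j => (j == i)%:R); rewrite (bigD1 i) //= eqxx scale1r big1.
      by rewrite addr0 subrr; exact: hB.1.
    by move=> j /negPf ->; rewrite scale0r.
  have := z2 (fun i => if unlift ord0 i is Some j then a j else 0).
  move=> /(_ _ (lift ord0 i)); rewrite liftK; apply.
  rewrite big_ord_recl unlift_none scale0r add0r.
  by move: Ba; congr B; apply: eq_bigr => j _; rewrite liftK.
have [p [q [pq dY1 dZ1Y1]]] := IH Z1 (fun c => Y c /\ Z1 c) (submodI hY hZ1) hZ1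
   (fun c Bc => conj (BY c Bc) (BZ1 c Bc)) (fun c => @proj2 _ _) dZ1.
(* If [Y] lies in the hyperplane [Z1], the vector [z ord0] adds one to the dimension of Z / Y.
   Otherwise some [y] of [Y] outside [Z1] can replace [z ord0], and it adds one to the dimension of
   Y / B. *)
have [YZ1|/existsNP[y /not_implyP[Yy nZ1y]]] := pselect (forall c, Y c -> Z1 c).
  exists p, (q + 1)%N; split; first by rewrite addnA pq addn1.
    by apply: eq_sqdim dY1 => // c; split=> [[]//|Yc]; split=> //; exact: YZ1.
  apply: (sqdim_cat (Y := Z1)) => //.
    by apply: eq_sqdim dZ1Y1 => // c; split=> [[]//|Yc]; split=> //; exact: YZ1.
  exists (fun=> z ord0); split=> // [a|c /Zdec[l hl]].
    by rewrite big_ord1 => /Z1z0 h i; rewrite ord1.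
  by exists (fun=> l); rewrite big_ord1.
have [mu hmu] := Zdec _ (YZ _ Yy).
have mu0 : mu != 0.
  by apply/eqP => mu0; apply: nZ1y; move: hmu; rewrite mu0 scale0r subr0.
have Ydec c : Z c -> exists l, Z1 (c - l *: y).
  move=> /Zdec [l hl]; exists (l / mu).
  suff -> : c - (l / mu) *: y = c - l *: z ord0 - (l / mu) *: (y - mu *: z ord0).
    by apply: submodB => //; exact: submodZ.
  by rewrite scalerBr scalerA divfK// opprB addrA subrK.
exists (p + 1)%N, q; split; first by rewrite addnAC pq addn1.
  apply: (sqdim_cat (Y := fun c => Y c /\ Z1 c)) => //.
  - exact: submodI.
  - by move=> c Bc; split; [exact: BY | exact: BZ1].
  - by move=> c [].
  exists (fun=> y); split=> // [a|c Yc].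
    rewrite big_ord1 => -[_ h] i; rewrite ord1; apply/eqP/negPn/negP => a0.
    by apply: nZ1y; rewrite -(scale1r y) -(mulVf a0) -scalerA; exact: submodZ.
  have [l hl] := Ydec _ (YZ _ Yc); exists (fun=> l); rewrite big_ord1; split=> //.
  by apply: submodB => //; exact: submodZ.
(* Second isomorphism theorem: Z = Z1 + Y, because [y] lies in [Y], so Z / Y is Z1 modulo its
   intersection with Y. *)
apply: (sqdim_rel (L := fun u u' => Y (u - u')) hZ1 hZ _ _ _ _ _ dZ1Y1).
- by rewrite subrr; exact: hY.1.
- by move=> a u v u' v' h h'; rewrite opprD addrACA -scalerBr; exact: hY.2.
- by move=> c hc; exists c; [exact: ZZ1 | rewrite subrr; exact: hY.1].
- move=> c /Ydec [l hl]; exists (c - l *: y) => //.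
  by rewrite addrAC subrr add0r; apply: submodN => //; exact: submodZ.
- move=> u u' Zu Zu' Yuu'; split=> [[Yu _]|Yu'].
    by rewrite -(subKr u u'); exact: submodB.
  by split=> //; exact: submod_subr Yuu' Yu'.
Qed.

(** Each basis expressed in the other gives two matrices whose product is the identity of size [m];
    it factors through size [m']. *)
Lemma sqdim_leq Z B m m' : submod B -> sqdim Z B m -> sqdim Z B m' -> (m <= m')%N.
Proof.
move=> hB [z [z1 z2 z3]] [z' [z1' z2' z3']].
have /choice[A hA] i := z3' _ (z1 i); have /choice[A' hA'] i := z3 _ (z1' i).
suff : (\matrix_(i, j) A i j) *m (\matrix_(i, j) A' i j) = 1%:M :> 'M_m.
  exact: mulmx1_min.
apply/matrixP => i k; rewrite !mxE; apply/eqP; rewrite -subr_eq0; apply/eqP.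
under eq_bigr do rewrite !mxE.
apply: (z2 (fun k => \sum_j A i j * A' j k - (i == k)%:R) _ k).
rewrite (_ : \sum_i0 _ = (\sum_j A i j *: \sum_k A' j k *: z k) - z i); last first.
  under [in RHS]eq_bigr do rewrite scaler_sumr.
  rewrite exchange_big /=; under eq_bigr do rewrite scalerBl.
  rewrite sumrB; congr (_ - _); last first.
    by rewrite (bigD1 i)//= eqxx scale1r big1 ?addr0// => j /negPf; rewrite eq_sym => ->; rewrite scale0r.
  by apply: eq_bigr => j _; rewrite scaler_suml; apply: eq_bigr => l _; rewrite scalerA.
rewrite -opprB; apply: submodN => //.
apply: (submod_subr hB (v := \sum_j A i j *: (z' j - \sum_k A' j k *: z k))); last first.
  by apply: submod_sum => // j _; exact: submodZ.
move: (hA i); congr B; rewrite -addrA -opprD -big_split /=; congr (_ - _).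
by apply: eq_bigr => j _; rewrite scalerBr addrC subrK.
Qed.

Lemma sqdim_inj Z B m m' : submod B -> sqdim Z B m -> sqdim Z B m' -> m = m'.
Proof.
by move=> hB d d'; apply/eqP; rewrite eqn_leq (sqdim_leq hB d d') (sqdim_leq hB d' d).
Qed.

End DimensionTheory.

(** * The Mayer-Vietoris sequence *)

Lemma lincombB (E : lmodType rat) (x : rat) (u v u' v' : E) :
  (x *: u + v) - (x *: u' + v') = x *: (u - u') + (v - v').
Proof. by rewrite opprD addrACA scalerBr. Qed.

Section Complexes.
Variables (E : nat -> lmodType rat) (bd : forall n, {linear E n.+1 -> E n}).
Hypothesis bdbd : forall n (c : E n.+2), bd n (bd n.+1 c) = 0.

Definition closed_chain n : E n -> Prop :=
  match n return E n -> Prop with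
  | 0 => fun _ => True
  | n'.+1 => fun c => bd n' c = 0
  end.

Definition subcomplex (C : forall n, E n -> Prop) : Prop :=
  (forall n, submod (C n)) /\ (forall n c, C n.+1 c -> C n (bd n c)).

Definition cyc (C : forall n, E n -> Prop) n (c : E n) : Prop := C n c /\ closed_chain c.

Definition bnd (C : forall n, E n -> Prop) n (c : E n) : Prop :=
  exists2 b, C n.+1 b & bd n b = c.

Definition hdim (C : forall n, E n -> Prop) n m : Prop := sqdim (cyc C (n:=n)) (bnd C (n:=n)) m.

(** For singular chains index [n] is geometric dimension n - 1. Hence [e] is minus the reduced Euler
    characteristic, and the usual one is 1 - e: a contractible set has e = 0, the empty set e =
    1. *)
Definition has_euler (C : forall n, E n -> Prop) (e : int) : Prop :=
  exists (beta : nat -> nat) (N : nat), [/\ forall n, hdim C n (beta n),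
    forall n, (N <= n)%N -> beta n = 0%N &
    \sum_(n < N) (-1) ^+ n * (beta n)%:Z = e].

Lemma closed_chain_mod n : submod (@closed_chain n).
Proof.
split; first by case: n => //= n; rewrite linear0.
by case: n => // n a u v /= hu hv; rewrite linearP hu hv scaler0 addr0.
Qed.

Lemma closed_bd n (c : E n.+1) : closed_chain (bd n c).
Proof. by case: n c => //= n c; exact: bdbd. Qed.

Section OneComplex.
Variables (C : forall n, E n -> Prop) (C_sub : subcomplex C).

Lemma cyc_mod n : submod (cyc C (n:=n)).
Proof. by apply: submodI; [exact: C_sub.1 | exact: closed_chain_mod]. Qed.

Lemma bnd_mod n : submod (bnd C (n:=n)).
Proof.
split; first by exists 0; [exact: (C_sub.1 _).1 | rewrite linear0].
move=> a _ _ [u Cu <-] [v Cv <-]; exists (a *: u + v); last by rewrite linearP.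
exact: (C_sub.1 _).2.
Qed.

Lemma bnd_cyc n (c : E n) : bnd C c -> cyc C c.
Proof. by case=> b Cb <-; split; [exact: C_sub.2 | exact: closed_bd]. Qed.

Lemma hdim_inj n m m' : hdim C n m -> hdim C n m' -> m = m'.
Proof. exact: sqdim_inj (@bnd_mod n). Qed.

Lemma hdim0P n : (forall c : E n, cyc C c -> bnd C c) <-> hdim C n 0.
Proof. exact: sqdim0P (@bnd_mod n). Qed.

Lemma euler_widen (beta : nat -> nat) N N' : (N <= N')%N ->
  (forall n, (N <= n)%N -> beta n = 0%N) ->
  \sum_(n < N') (-1) ^+ n * (beta n)%:Z = \sum_(n < N) (-1) ^+ n * (beta n)%:Z :> int.
Proof.
move=> NN' b0; rewrite -(subnKC NN') big_split_ord /= [X in _ + X]big1 ?addr0//.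
by move=> i _; rewrite b0 ?mulr0// leq_addr.
Qed.

Lemma has_euler_inj e e' : has_euler C e -> has_euler C e' -> e = e'.
Proof.
move=> [b [N [hb b0 <-]]] [b' [N' [hb' b0' <-]]].
rewrite -(euler_widen (leq_maxl N N') b0) -(euler_widen (leq_maxr N N') b0').
by apply: eq_bigr => n _; rewrite (hdim_inj (hb n) (hb' n)).
Qed.

End OneComplex.

Section MayerVietoris.
Variables (P Q : forall n, E n -> Prop) (P_sub : subcomplex P) (Q_sub : subcomplex Q).

Definition cpxI n (c : E n) : Prop := P c /\ Q c.
Definition cpxD n (c : E n) : Prop := exists u v, [/\ P u, Q v & c = u + v].

Lemma cpxI_sub : subcomplex cpxI.
Proof.
split=> [n|n c [Pc Qc]]; first by apply: submodI; [exact: P_sub.1 | exact: Q_sub.1].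
by split; [exact: P_sub.2 | exact: Q_sub.2].
Qed.

Lemma cpxD_sub : subcomplex cpxD.
Proof.
split=> [n|n _ [u [v [Pu Qv ->]]]].
  by apply: submod_add; [exact: P_sub.1 | exact: Q_sub.1].
by exists (bd n u), (bd n v); rewrite linearD; split=> //; [exact: P_sub.2 | exact: Q_sub.2].
Qed.

(** The long exact sequence is cut at two places. [K] modulo boundaries is the kernel of the map
    from the homology of the intersection to that of [P] and [Q]; [Y] modulo boundaries is the image
    of the latter in the homology of the sum. *)
Let K n (c : E n) := cyc cpxI c /\ (bnd P c /\ bnd Q c).
Let Y n (c : E n) := exists u v, [/\ cyc P u, cyc Q v & c = u + v].

Let K_mod n : submod (@K n).
Proof.
by apply: submodI; [exact/cyc_mod/cpxI_sub | apply: submodI; exact: bnd_mod].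
Qed.

Let Y_mod n : submod (@Y n).
Proof. by apply: submod_add; exact: cyc_mod. Qed.

Let bndI_K n (c : E n) : bnd cpxI c -> K c.
Proof.
move=> h; split; first exact: bnd_cyc cpxI_sub _ _ h.
by case: h => b [Pb Qb] <-; split; exists b.
Qed.

Let bndD_Y n (c : E n) : bnd cpxD c -> Y c.
Proof.
move=> [_ [u [v [Pu Qv ->]]] <-]; exists (bd n u), (bd n v).
by rewrite linearD; split=> //; apply: bnd_cyc => //; [exists u | exists v].
Qed.

Let Y_cyc n (c : E n) : Y c -> cyc cpxD c.
Proof.
move=> [u [v [[Pu zu] [Qv zv] ->]]]; split; first by exists u, v.
exact: submodD (@closed_chain_mod n) _ _ zu zv.
Qed.

(** The connecting homomorphism, as the relation between [u + v] and the boundary of [u]. Being a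
    relation, it needs no choice of the splitting. *)
Lemma sqdim_connecting n k : sqdim (@K n) (bnd cpxI (n:=n)) k ->
  sqdim (cyc cpxD (n:=n.+1)) (@Y n.+1) k.
Proof.
apply: (sqdim_rel (L := fun (z : E n) (c : E n.+1) =>
  exists u v, [/\ P u, Q v, c = u + v & bd n u = z])).
- exact: K_mod.
- exact: cyc_mod cpxD_sub _.
- exists 0, 0; rewrite addr0 linear0; split=> //.
    exact: (P_sub.1 _).1.
  exact: (Q_sub.1 _).1.
- move=> a _ v _ v' [s [t [Ps Qt -> <-]]] [s' [t' [Ps' Qt' -> <-]]].
  exists (a *: s + s'), (a *: t + t'); rewrite linearP scalerDr addrACA; split=> //.
    exact: (P_sub.1 _).2.
  exact: (Q_sub.1 _).2.
- move=> z [_ [[b1 Pb1 e1] [b2 Qb2 e2]]].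
  have Qb : Q (- b2) by apply: submodN => //; exact: Q_sub.1.
  exists (b1 - b2); last by exists b1, (- b2).
  by split; [exists b1, (- b2) | rewrite /= linearB e1 e2 subrr].
- move=> c [[u [v [Pu Qv ->]]] /= /eqP]; rewrite linearD addr_eq0 => /eqP e.
  exists (bd n u); last by exists u, v.
  have h : bnd Q (bd n u).
    by exists (- v); [apply: submodN => //; exact: Q_sub.1 | rewrite linearN e].
  split; last by split=> //; exists u.
  by split; [split; [exact: P_sub.2 | case: (bnd_cyc Q_sub h)] | exact: closed_bd].
- move=> z c [[[Pz Qz] cz] _] [_ zc] [u [v [Pu Qv ec ez]]]; split.
    move=> [w [Pw Qw] ew]; exists (u - w), (v + w); split.
    + split; first by apply: submodB => //; exact: P_sub.1.
      by rewrite /= linearB ez ew subrr.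
    + split; first by apply: submodD => //; exact: Q_sub.1.
      by move: zc; rewrite /= ec linearD linearD ez ew addrC.
    + by rewrite addrCA subrK ec addrC.
  move=> [u' [v' [[Pu' zu'] [Qv' zv'] ec']]]; exists (u - u').
    split; first by apply: submodB => //; exact: P_sub.1.
    have -> : u - u' = v' - v.
      by apply/eqP; rewrite subr_eq addrAC eq_sym subr_eq -ec addrC ec'.
    by apply: submodB => //; exact: Q_sub.1.
  by rewrite linearB ez (zu' : bd n u' = 0) subr0.
Qed.

(** Rank count along the exact stretch from the intersection, through pairs of classes, to the image
    [Y]. Here [IM] is the diagonal image of the intersection inside the pairs [ZZ], and the
    difference of the two components maps ZZ / IM onto [Y] modulo boundaries. *)
Lemma sqdim_image n a p q k :
  hdim cpxI n a -> hdim P n p -> hdim Q n q -> sqdim (@K n) (bnd cpxI (n:=n)) k ->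
  exists2 s, (p + q + k = a + s)%N & sqdim (@Y n) (bnd cpxD (n:=n)) s.
Proof.
move=> dI dP dQ dK.
pose W := (E n * E n)%type : lmodType rat.
pose ZZ (w : W) := cyc P w.1 /\ cyc Q w.2.
pose ZB (w : W) := cyc P w.1 /\ bnd Q w.2.
pose BB (w : W) := bnd P w.1 /\ bnd Q w.2.
pose IM (w : W) := ZZ w /\ exists z, [/\ cyc cpxI z, bnd P (w.1 - z) & bnd Q (w.2 - z)].
have prod_mod (A B : E n -> Prop) : submod A -> submod B ->
    submod (fun w : W => A w.1 /\ B w.2).
  move=> hA hB; split; first by split; [exact: hA.1 | exact: hB.1].
  by move=> x [u v] [u' v'] [/= ? ?] [/= ? ?]; split=> /=; [exact: hA.2 | exact: hB.2].
have hZP := cyc_mod P_sub n; have hBP := bnd_mod P_sub n.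
have hZQ := cyc_mod Q_sub n; have hBQ := bnd_mod Q_sub n.
have hZI := cyc_mod cpxI_sub n; have hBI := bnd_mod cpxI_sub n.
have hZZ : submod ZZ := prod_mod _ _ hZP hZQ.
have hZB : submod ZB := prod_mod _ _ hZP hBQ.
have hBB : submod BB := prod_mod _ _ hBP hBQ.
have hIM : submod IM.
  apply: submodI => //; split.
    by exists 0; rewrite !subr0; split; [exact: hZI.1 | exact: hBP.1 | exact: hBQ.1].
  move=> x [u v] [u' v'] [z [h1 h2 h3]] [z' [h1' h2' h3']]; exists (x *: z + z') => /=.
  rewrite !lincombB.
  by split; [exact: hZI.2 | exact: hBP.2 | exact: hBQ.2].
have dZZ : sqdim ZZ BB (p + q).
  apply: (sqdim_cat (Y := ZB)) => //.
  - by move=> w [/(bnd_cyc P_sub) ? ?].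
  - by move=> w [? /(bnd_cyc Q_sub) ?].
  - apply: (sqdim_rel (L := fun (u : E n) (w : W) => w.1 = u) hZP hZB _ _ _ _ _ dP) => //.
    + by move=> x u v [w1 w2] [w1' w2'] /= <- <-.
    + by move=> u hu; exists (u, 0); split=> //; exact: hBQ.1.
    + by move=> [u v] [/= ? ?]; exists u.
    + by move=> u [u' v] hu [/= ? hv] <-; split=> [?|[]//]; split.
  - apply: (sqdim_rel (L := fun (u : E n) (w : W) => w.2 = u) hZQ hZZ _ _ _ _ _ dQ) => //.
    + by move=> x u v [w1 w2] [w1' w2'] /= <- <-.
    + by move=> u hu; exists (0, u); split=> //; exact: hZP.1.
    + by move=> [u v] [/= ? ?]; exists v.
    + by move=> u [u' v] hu [/= ? hv] <-; split=> [?|[]//]; split.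
have BBIM w : BB w -> IM w.
  move=> [h1 h2]; split; first by split; exact: bnd_cyc.
  by exists 0; rewrite !subr0; split=> //; exact: hZI.1.
have [i [s [ispq dIM dY]]] := sqdim_split hBB hIM hZZ BBIM (fun w => @proj1 _ _) dZZ.
have [k' [r [kra dK' dr]]] := sqdim_split hBI (@K_mod n) hZI (@bndI_K n) (fun w => @proj1 _ _) dI.
have {dK'}ek : k' = k by exact: sqdim_inj hBI dK' dK.
(* First isomorphism theorem for the diagonal map, whose kernel is [K]. *)
have er : i = r.
  apply: (sqdim_inj hBB dIM).
  apply: (sqdim_rel (L := fun (z : E n) (w : W) => bnd P (w.1 - z) /\ bnd Q (w.2 - z))
    hZI hIM _ _ _ _ _ dr) => /=.
  - by rewrite !subr0; split; [exact: hBP.1 | exact: hBQ.1].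
  - move=> x u v [w1 w2] [w1' w2'] [h1 h2] [h1' h2'] /=.
    rewrite !lincombB.
    by split; [exact: hBP.2 | exact: hBQ.2].
  - move=> z hz; exists (z, z); last by rewrite /= subrr; split; [exact: hBP.1 | exact: hBQ.1].
    case: (hz) => -[Pz Qz] cz; split; first by split.
    by exists z; rewrite /= subrr; split=> //; [exact: hBP.1 | exact: hBQ.1].
  - by move=> w [_ [z [hz h1 h2]]]; exists z.
  - move=> z [w1 w2] hz [_ _] /= [h1 h2]; split=> [[_ [h3 h4]]|[h3 h4]].
      by split; [exact: submod_subr h1 h3 | exact: submod_subr h2 h4].
    split=> //; split; [rewrite -(subKr w1 z) | rewrite -(subKr w2 z)]; exact: submodB.
exists s; first by lia.
apply: (sqdim_rel (L := fun (w : W) (c : E n) => c = w.1 - w.2) hZZ (@Y_mod n) _ _ _ _ _ dY).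
- by rewrite subrr.
- by move=> x [u v] [u' v'] _ _ /= -> ->; rewrite opprD addrACA -scalerBr.
- move=> [u v] [/= hu hv]; exists (u - v) => //; exists u, (- v); split=> //.
  exact: submodN.
- move=> c [u [v [hu hv ->]]]; exists (u, - v); last by rewrite opprK.
  by split=> //=; exact: submodN.
- move=> [u v] c [/= hu hv] _ ->; split.
    move=> [_ [z [_ [b1 Pb1 e1] [b2 Qb2 e2]]]]; exists (b1 - b2).
      by exists b1, (- b2); split=> //; apply: submodN => //; exact: Q_sub.1.
    by rewrite linearB e1 e2 opprB addrA subrK.
  move=> [_ [b1 [b2 [Pb1 Qb2 ->]]] e]; split=> //; exists (u - bd n b1).
  have bP : bnd P (bd n b1) by exists b1.
  have bQ : bnd Q (bd n b2) by exists b2.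
  have euv : u - bd n b1 = v + bd n b2.
    by apply/eqP; rewrite subr_eq -addrA [X in _ == _ + X]addrC -linearD e addrCA subrr addr0.
  have h1 : cyc P (u - bd n b1) by apply: submodB => //; exact: bnd_cyc.
  have h2 : cyc Q (u - bd n b1) by rewrite euv; apply: submodD => //; exact: bnd_cyc.
  split; first by case: h1 h2 => [? ?] [? _]; split.
    by rewrite subKr.
  by rewrite euv opprD addrA subrr add0r; exact: submodN.
Qed.

Lemma mayer_vietoris (a p q : nat -> nat) :
  (forall n, hdim cpxI n (a n)) -> (forall n, hdim P n (p n)) ->
  (forall n, hdim Q n (q n)) ->
  exists k s : nat -> nat, [/\ forall n, (k n <= a n)%N,
    forall n, (p n + q n + k n = a n + s n)%N, hdim cpxD 0 (s 0%N) &
    forall n, hdim cpxD n.+1 (s n.+1 + k n)].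
Proof.
move=> dI dP dQ.
have /choice[k hk] n : exists k, (k <= a n)%N /\ sqdim (@K n) (bnd cpxI (n:=n)) k.
  have [k [r [<- dK _]]] := sqdim_split (bnd_mod cpxI_sub n) (@K_mod n)
    (cyc_mod cpxI_sub n) (@bndI_K n) (fun w => @proj1 _ _) (dI n).
  by exists k; rewrite leq_addr.
have /choice[s hs] n : exists s, (p n + q n + k n = a n + s)%N /\
    sqdim (@Y n) (bnd cpxD (n:=n)) s.
  by have [s ? ?] := sqdim_image (dI n) (dP n) (dQ n) (hk n).2; exists s.
exists k, s; split=> [n|n||n]; [by case: (hk n) | by case: (hs n) | |].
  apply: eq_sqdim (hs 0%N).2 => // c; split=> [/Y_cyc//|[[u [v [Pu Qv ->]]] _]].
  by exists u, v; split.
apply: (sqdim_cat (Y := @Y n.+1)).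
- exact: bnd_mod cpxD_sub _.
- exact: Y_mod.
- exact: cyc_mod cpxD_sub _.
- exact: bndD_Y.
- exact: Y_cyc.
- exact: (hs _).2.
- exact: sqdim_connecting (hk _).2.
Qed.

Lemma euler_mayer_vietoris a p q : has_euler cpxI a -> has_euler P p ->
  has_euler Q q -> has_euler cpxD (p + q - a).
Proof.
move=> [ba [Na [da a0 <-]]] [bp [Np [dp p0 <-]]] [bq [Nq [dq q0 <-]]].
have [k [s [ka ks d0 dS]]] := mayer_vietoris da dp dq.
pose N := (maxn Na (maxn Np Nq)).
exists (fun n => (s n + (if n is n'.+1 then k n' else 0))%N), N.+1; split.
- by case=> [|n]; rewrite ?addn0.
- case=> // n; rewrite ltnS => Nn; have := ka n; have := ks n.+1; have := ka n.+1.
  by rewrite a0 ?p0 ?q0 ?a0; lia.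
rewrite -(euler_widen (N' := N.+1) _ a0); last by lia.
rewrite -(euler_widen (N' := N.+1) _ p0); last by lia.
rewrite -(euler_widen (N' := N.+1) _ q0); last by lia.
have kN : k N = 0%N by have := ka N; rewrite a0; lia.
(* The kernel of index [n] reappears in index [n.+1], hence with the opposite sign. Nothing is lost
   at the end of the shifted sum, since [k N] is zero. *)
have -> : \sum_(n < N.+1) (-1) ^+ n * (s n + (if val n is n'.+1 then k n' else 0))%N%:Z =
    \sum_(n < N.+1) (-1) ^+ n * (s n)%:Z - \sum_(n < N.+1) (-1) ^+ n * (k n)%:Z :> int.
  under eq_bigr do rewrite PoszD mulrDr.
  rewrite big_split /=; congr (_ + _).
  rewrite big_ord_recl mulr0 add0r big_ord_recr /= kN mulr0 addr0 -sumrN.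
  by apply: eq_bigr => i _; rewrite /bump add1n exprS mulN1r mulNr.
rewrite -big_split -!sumrB /=; apply: eq_bigr => n _.
by rewrite -mulrDr -!mulrBr; congr (_ * _); have := ks n; lia.
Qed.

End MayerVietoris.
End Complexes.

(** * Free modules and boundaries *)

Section FreeModules.
Variable K : choiceType.

Definition gen (s : K) : malg K rat := mkmalgU s 1.

Lemma sum_msupp_widen (V : lmodType rat) (f : K -> V) (c : malg K rat) (D : seq K) :
  uniq D -> {subset msupp c <= D} ->
  \sum_(s <- msupp c) mcoeff s c *: f s = \sum_(s <- D) mcoeff s c *: f s.
Proof.
move=> uD sD; rewrite [RHS](bigID (mem (msupp c)) predT) /= [X in _ = _ + X]big1 ?addr0.
  rewrite -[RHS]big_filter; apply: perm_big; apply: uniq_perm.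
  - exact: fset_uniq.
  - exact: filter_uniq.
  - move=> s; rewrite mem_filter /=; case: (boolP (s \in msupp c)) => //= h.
    by rewrite sD.
by move=> s h; rewrite mcoeff_outdom // scale0r.
Qed.

Definition lin (V : lmodType rat) (f : K -> V) (c : malg K rat) : V :=
  \sum_(s <- msupp c) mcoeff s c *: f s.

Lemma lin_is_linear (V : lmodType rat) (f : K -> V) : linear (lin f).
Proof.
move=> a u v; pose D := undup (msupp (a *: u + v) ++ msupp u ++ msupp v).
have uD : uniq D by exact: undup_uniq.
rewrite /lin !(@sum_msupp_widen _ _ _ D)//; last first.
- by move=> s h; rewrite mem_undup !mem_cat h.
- by move=> s h; rewrite mem_undup !mem_cat h orbT.
- by move=> s h; rewrite mem_undup !mem_cat h !orbT.
rewrite scaler_sumr -big_split /=; apply: eq_bigr => s _.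
by rewrite mcoeffD mcoeffZ scalerDl scalerA.
Qed.

HB.instance Definition _ (V : lmodType rat) (f : K -> V) :=
  GRing.isLinear.Build rat (malg K rat) V *:%R (lin f) (lin_is_linear f).

Lemma lin_gen (V : lmodType rat) (f : K -> V) s : lin f (gen s) = f s.
Proof. by rewrite /lin /gen msuppU oner_eq0 big_seq_fset1 mcoeffUU scale1r. Qed.

Lemma malg_genE (c : malg K rat) : c = \sum_(s <- msupp c) mcoeff s c *: gen s.
Proof.
rewrite {1}[c]monalgE; apply: eq_bigr => s _.
by apply/malgP => k; rewrite mcoeffZ !mcoeffU; case: eqP; rewrite ?mulr1 ?mulr0.
Qed.

Definition supp (P : K -> Prop) (c : malg K rat) : Prop :=
  forall s, mcoeff s c != 0 -> P s.

Lemma supp_mod (P : K -> Prop) : submod (supp P).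
Proof.
split=> [s|a u v hu hv s]; first by rewrite mcoeff0 eqxx.
rewrite mcoeffD mcoeffZ; have [u0|/hu//] := eqVneq (mcoeff s u) 0.
by rewrite u0 mulr0 add0r => /hv.
Qed.

Lemma supp_gen (P : K -> Prop) s : P s -> supp P (gen s).
Proof. by move=> Ps t; rewrite mcoeffU; case: (s =P t) => [<-//|_]; rewrite mulr0n eqxx. Qed.

Lemma supp_ind (P : K -> Prop) (A : malg K rat -> Prop) : submod A ->
  (forall s, P s -> A (gen s)) -> forall c, supp P c -> A c.
Proof.
move=> hA AP c hc; rewrite [c]malg_genE big_seq_cond.
apply: submod_sum => // s /andP[h _]; apply: submodZ => //; apply/AP/hc.
by rewrite mcoeff_neq0.
Qed.

Lemma supp_imp (P Q : K -> Prop) c : (forall s, P s -> Q s) -> supp P c -> supp Q c.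
Proof. by move=> PQ h s /h /PQ. Qed.

Lemma eq_mod (V : lmodType rat) (f g : {linear malg K rat -> V}) :
  submod (fun c => f c = g c).
Proof. by split=> [|a u v hu hv]; rewrite ?linear0// !linearP hu hv. Qed.

Lemma lin_eq (V : lmodType rat) (f g : {linear malg K rat -> V}) :
  (forall s, f (gen s) = g (gen s)) -> f =1 g.
Proof.
move=> h c; apply: (supp_ind (P := fun=> True) (eq_mod f g)) => // s _; exact: h.
Qed.

End FreeModules.

Lemma supp_lin (K L : choiceType) (P : K -> Prop) (Q : L -> Prop)
    (f : K -> malg L rat) c :
  (forall s, P s -> supp Q (f s)) -> supp P c -> supp Q (lin f c).
Proof.
move=> h; apply: (supp_ind (A := fun c => supp Q (lin f c))) => [|s /h]; last first.
  by rewrite lin_gen.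
split=> [|a u v hu hv]; first by rewrite linear0; exact: (supp_mod Q).1.
by rewrite linearP; exact: (supp_mod Q).2.
Qed.

(** The pairs with i < j and those with j <= i are matched by exchanging (i, j.+1) with (j, i),
    which changes the parity of the exponent. Both [bdry_bdry] and [cobd_cobd] rest on this. *)
Lemma alternating_sum_cancel (V : lmodType rat) n (G : nat -> nat -> V) :
  (forall i j, (i <= j <= n)%N -> G i j.+1 = G j i) ->
  \sum_(j < n.+2) \sum_(i < n.+1) ((-1) ^+ (j + i) : rat) *: G i j = 0.
Proof.
move=> hG.
have -> : \sum_(j < n.+2) \sum_(i < n.+1) ((-1) ^+ (j + i) : rat) *: G i j =
  \sum_(j < n.+2) \sum_(i < n.+1 | (i < j)%N) ((-1) ^+ (j + i) : rat) *: G i j +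
  \sum_(j < n.+2) \sum_(i < n.+1 | (j <= i)%N) ((-1) ^+ (j + i) : rat) *: G i j.
  rewrite -big_split /=; apply: eq_bigr => j _.
  rewrite (bigID (fun i : 'I_n.+1 => (i < j)%N)) /=; congr (_ + _).
  by apply: eq_bigl => i; rewrite -leqNgt.
rewrite [X in _ + X]big_ord_recr /= [X in _ + (_ + X)]big1 ?addr0; last first.
  by move=> i h; have := ltn_ord i; rewrite ltnNge h.
rewrite big_ord_recl /= big1 ?add0r //.
rewrite (exchange_big_dep predT) //= -big_split /= big1// => i _.
rewrite (eq_bigl (fun j : 'I_n.+1 => (i <= j)%N)); last first.
  by move=> j; rewrite /bump add1n ltnS.
rewrite -big_split big1 //= => j ij; rewrite /bump add1n hG; last first.
  by rewrite ij -ltnS ltn_ord.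
by rewrite addSn exprS mulN1r scaleNr addnC addNr.
Qed.

Section Presimplicial.
Variables (K : nat -> choiceType) (d : forall n, 'I_n.+1 -> K n.+1 -> K n).

Definition bdry n : malg (K n.+1) rat -> malg (K n) rat :=
  lin (fun s => \sum_(i < n.+1) ((-1) ^+ i : rat) *: gen (d i s)).

HB.instance Definition _ n := GRing.Linear.on (@bdry n).

Lemma bdry_gen n s :
  bdry (gen s) = \sum_(i < n.+1) ((-1) ^+ i : rat) *: gen (d i s).
Proof. exact: lin_gen. Qed.

Hypothesis dd : forall n (i j : 'I_n.+1) (s : K n.+2), (i <= j)%N ->
  d i (d (lift ord0 j) s) = d j (d (widen_ord (leqnSn _) i) s).

Lemma bdry_bdry n (c : malg (K n.+2) rat) : bdry (bdry c) = 0.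
Proof.
pose f : {linear malg (K n.+2) rat -> malg (K n) rat} := @bdry n \o @bdry n.+1.
pose g : {linear malg (K n.+2) rat -> malg (K n) rat} := \0.
apply: (lin_eq (f := f) (g := g)) => s; rewrite /f /g /= bdry_gen linear_sum.
pose G i j : malg (K n) rat := gen (d (inord i) (d (inord j : 'I_n.+2) s)).
rewrite -[RHS](@alternating_sum_cancel _ n G); last first.
  move=> i j /andP[ij jn]; congr gen.
  have -> : inord j.+1 = lift ord0 (inord j : 'I_n.+1) :> 'I_n.+2.
    by apply/val_inj; rewrite /= inordK // inordK.
  rewrite dd; last by rewrite !inordK // ltnS (leq_trans ij).
  congr (d _ (d _ _)); apply/val_inj; rewrite /= !inordK //; lia.
apply: eq_bigr => j _; rewrite linearZ /= bdry_gen scaler_sumr; apply: eq_bigr => i _.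
by rewrite scalerA -exprD /G !inord_val.
Qed.

End Presimplicial.

(** * Formal simplices and the subdivided prism *)

Section Tuples.
Variable V : choiceType.

Definition tup_face n (i : 'I_n.+1) (w : 'I_n.+1 -> V) : 'I_n -> V :=
  fun j => w (lift i j).

Lemma tup_face_face n (i j : 'I_n.+1) (w : 'I_n.+2 -> V) : (i <= j)%N ->
  tup_face i (tup_face (lift ord0 j) w) =
  tup_face j (tup_face (widen_ord (leqnSn _) i) w).
Proof.
move=> ij; apply/funext => k; rewrite /tup_face; congr (w _); apply/val_inj => /=.
by rewrite /bump; lia.
Qed.

Definition tup_bd n := @bdry (fun n => 'I_n -> V) tup_face n.

HB.instance Definition _ n := GRing.Linear.on (@tup_bd n).

Definition tup_cons n (b : V) (w : 'I_n -> V) : 'I_n.+1 -> V :=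
  fun j => if unlift ord0 j is Some j' then w j' else b.

Definition cone n (b : V) : malg ('I_n -> V) rat -> malg ('I_n.+1 -> V) rat :=
  lin (fun w => gen (tup_cons b w)).

HB.instance Definition _ n b := GRing.Linear.on (@cone n b).

Lemma tup_face0_cons n b (w : 'I_n -> V) : tup_face ord0 (tup_cons b w) = w.
Proof. by apply/funext => j; rewrite /tup_face /tup_cons liftK. Qed.

Lemma tup_faceS_cons n b (w : 'I_n.+1 -> V) i :
  tup_face (lift ord0 i) (tup_cons b w) = tup_cons b (tup_face i w).
Proof.
apply/funext => j; rewrite /tup_face /tup_cons.
case: (unliftP ord0 j) => [k ->|->]; case: unliftP => [k'|].
- by move=> e; congr (w _); apply/val_inj; have /= := congr1 val e; rewrite /bump; lia.
- by move=> e; have /= := congr1 val e; rewrite /bump; lia.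
- by move=> e; have /= := congr1 val e; rewrite /bump; lia.
- by [].
Qed.

Lemma tup_bd_cone0 b (z : malg ('I_0 -> V) rat) : tup_bd (cone b z) = z.
Proof.
apply: (lin_eq (f := @tup_bd 0 \o @cone 0 b) (g := idfun)) => w /=.
by rewrite /cone lin_gen /tup_bd bdry_gen big_ord1 expr0 scale1r tup_face0_cons.
Qed.

Lemma tup_bd_cone n b (z : malg ('I_n.+1 -> V) rat) :
  tup_bd (cone b z) = z - cone b (tup_bd z).
Proof.
apply: (lin_eq (f := @tup_bd n.+1 \o @cone n.+1 b)
               (g := idfun \- (@cone n b \o @tup_bd n))) => w /=.
rewrite /cone lin_gen /tup_bd !bdry_gen big_ord_recl expr0 scale1r tup_face0_cons.
congr (_ + _); rewrite [X in _ = - X]linear_sum -sumrN; apply: eq_bigr => i _.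
by rewrite linearZ /= lin_gen tup_faceS_cons exprS mulN1r scaleNr.
Qed.

End Tuples.

Section TuplePush.
Variables (V V' : choiceType) (g : V -> V').

Definition tup_push n : malg ('I_n -> V) rat -> malg ('I_n -> V') rat :=
  lin (fun w => gen (g \o w)).

HB.instance Definition _ n := GRing.Linear.on (@tup_push n).

Lemma tup_push_bd n (z : malg ('I_n.+1 -> V) rat) :
  tup_push (tup_bd z) = tup_bd (tup_push z).
Proof.
apply: (lin_eq (f := @tup_push n \o @tup_bd V n)
               (g := @tup_bd V' n \o @tup_push n.+1)) => w /=.
rewrite /tup_push lin_gen /tup_bd !bdry_gen linear_sum; apply: eq_bigr => i _.
by rewrite linearZ /= lin_gen.
Qed.

End TuplePush.

Section Prism.
Variable R : realType.

Definition Simplex n : set 'rV[R]_n :=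
  [set x | (forall j, 0 <= x 0 j) /\ \sum_j x 0 j = 1].

Definition ins n (i : 'I_n.+1) (x : 'rV[R]_n) : 'rV[R]_n.+1 :=
  \row_j (if unlift i j is Some j' then x 0 j' else 0).

Lemma ins_lift n (i : 'I_n.+1) x j : ins i x 0 (lift i j) = x 0 j.
Proof. by rewrite mxE liftK. Qed.

Lemma ins_i n (i : 'I_n.+1) x : ins i x 0 i = 0.
Proof. by rewrite mxE unlift_none. Qed.

Lemma ins_ins n (i j : 'I_n.+1) (x : 'rV[R]_n) : (i <= j)%N ->
  ins (lift ord0 j) (ins i x) = ins (widen_ord (leqnSn _) i) (ins j x).
Proof.
move=> ij; apply/rowP => k; set i' := widen_ord _ i; set j' := lift ord0 j.
case: (unliftP j' k) => [k' ->|->].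
  rewrite ins_lift; case: (unliftP i k') => [l ->|->].
    have -> : lift j' (lift i l) = lift i' (lift j l).
      by apply/val_inj; rewrite /= /bump; lia.
    by rewrite !ins_lift.
  have -> : lift j' i = i' by apply/val_inj; rewrite /= /bump; lia.
  by rewrite !ins_i.
have -> : j' = lift i' j by apply/val_inj; rewrite /= /bump; lia.
by rewrite ins_lift ins_i ins_i.
Qed.

Lemma sum_ins n (i : 'I_n.+1) (x : 'rV[R]_n) : \sum_j ins i x 0 j = \sum_j x 0 j.
Proof.
rewrite (bigD1_ord i) //= ins_i add0r; apply: eq_bigr => j _; exact: ins_lift.
Qed.

Lemma Simplex_ins n (i : 'I_n.+1) (x : 'rV[R]_n) : Simplex (ins i x) <-> Simplex x.
Proof.
rewrite /Simplex /= sum_ins; split=> -[x0 x1]; split=> // j.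
  by have := x0 (lift i j); rewrite ins_lift.
by case: (unliftP i j) => [k ->|->]; rewrite ?ins_lift ?ins_i.
Qed.

(* Points of (the affine span of) the prism on the standard simplex. *)
Definition prism n : Type := ('rV[R]_n * R)%type.
HB.instance Definition _ n := Choice.on (prism n).

Definition pins n (i : 'I_n.+1) (v : prism n) : prism n.+1 := (ins i v.1, v.2).

(** Signed copies of [z] on all side walls of the next prism. Realized along a simplex, it becomes
    [z] realized along the boundary of that simplex ([real_op_cobd]); this turns identities between
    formal prisms into chain homotopies. *)
Definition cobd n m (z : malg ('I_m -> prism n) rat) : malg ('I_m -> prism n.+1) rat :=
  \sum_(i < n.+1) ((-1) ^+ i : rat) *: tup_push (pins i) z.

Lemma cobd_is_linear n m : linear (@cobd n m).
Proof.
move=> a u v; rewrite /cobd scaler_sumr -big_split /=; apply: eq_bigr => i _.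
by rewrite linearP scalerDr !scalerA mulrC.
Qed.

HB.instance Definition _ n m := GRing.isLinear.Build rat
  (malg ('I_m -> prism n) rat) (malg ('I_m -> prism n.+1) rat) *:%R (@cobd n m)
  (@cobd_is_linear n m).

Lemma cobd_bd n m (z : malg ('I_m.+1 -> prism n) rat) :
  cobd (tup_bd z) = tup_bd (cobd z).
Proof.
rewrite /cobd [RHS]linear_sum; apply: eq_bigr => i _.
by rewrite [RHS]linearZ /= tup_push_bd.
Qed.

Lemma cobd_cobd n m (z : malg ('I_m -> prism n) rat) : cobd (cobd z) = 0.
Proof.
apply: (lin_eq (f := @cobd n.+1 m \o @cobd n m) (g := \0)) => w /=.
have cobdE k (w' : 'I_m -> prism k) :
    cobd (gen w') = \sum_(i < k.+1) ((-1) ^+ i : rat) *: gen (pins i \o w').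
  by apply: eq_bigr => i _; rewrite /tup_push lin_gen.
rewrite cobdE linear_sum /=.
under eq_bigr do rewrite linearZ /= cobdE scaler_sumr.
pose G i j : malg ('I_m -> prism n.+2) rat :=
  gen (pins (inord i : 'I_n.+2) \o (pins (inord j : 'I_n.+1) \o w)).
rewrite exchange_big /=.
rewrite -[RHS](@alternating_sum_cancel _ n (fun i j => G j i)); last first.
  move=> i j /andP[ij jn]; congr gen; apply/funext => k /=.
  have -> : inord j.+1 = lift ord0 (inord j : 'I_n.+1) :> 'I_n.+2.
    by apply/val_inj; rewrite /= inordK // inordK.
  rewrite /pins /= ins_ins; last by rewrite !inordK // ltnS (leq_trans ij).
  congr (ins _ _, _); apply/val_inj; rewrite /= !inordK //; lia.
apply: eq_bigr => j _; apply: eq_bigr => i _.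
by rewrite scalerA -exprD addnC /G !inord_val.
Qed.

Definition vertex n (j : 'I_n) : 'rV[R]_n := delta_mx 0 j.
Definition barycenter n : 'rV[R]_n := const_mx n%:R^-1.
Definition bottom n : 'I_n -> prism n := fun j => (vertex j, 0).

Lemma pins_bottom n (i : 'I_n.+1) : pins i \o @bottom n = tup_face i (@bottom n.+1).
Proof.
apply/funext => j; rewrite /tup_face /bottom /pins /=; congr (_, _).
apply/rowP => k; case: (unliftP i k) => [l ->|->].
  by rewrite ins_lift !mxE (inj_eq lift_inj).
by rewrite ins_i mxE (negPf (neq_lift _ _)).
Qed.

(* [subdiv n] is the barycentric subdivision of the top of the prism. The prism
   operator [prism_op n] interpolates between it and the undivided bottom. *)
Fixpoint subdiv n : malg ('I_n -> prism n) rat :=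
  if n is n'.+1 then cone (barycenter n'.+1, 1) (cobd (subdiv n'))
  else gen (@bottom 0).

Fixpoint prism_op n : malg ('I_n.+1 -> prism n) rat :=
  if n is n'.+1 then
    cone (barycenter n'.+1, 1) (- gen (@bottom n'.+1) - cobd (prism_op n'))
  else 0.

Lemma bd_prism_op0 : tup_bd (prism_op 0) = subdiv 0 - gen (@bottom 0).
Proof. by rewrite /= linear0 subrr. Qed.

(** The chain being coned has boundary [- cobd (subdiv n)], because [cobd] commutes with the
    boundary and squares to zero. The cone formula then returns that chain plus the cone which
    defines [subdiv n.+1]. *)
Lemma bd_prism_op n :
  tup_bd (prism_op n.+1) = subdiv n.+1 - gen (@bottom n.+1) - cobd (prism_op n).
Proof.
have bd_bot k : tup_bd (gen (@bottom k.+1)) = cobd (gen (@bottom k)).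
  rewrite /tup_bd bdry_gen; apply: eq_bigr => i _.
  by rewrite /tup_push lin_gen pins_bottom.
have bdE k (g : malg ('I_k.+1 -> prism k.+1) rat) z :
    tup_bd (- g - z) = - tup_bd g - tup_bd z by rewrite linearB linearN.
have conE k b (z : malg ('I_k -> prism k.+1) rat) : cone b (- z) = - cone b z.
  by rewrite linearN.
have cobdB k m (y z : malg ('I_m -> prism k) rat) : cobd (y - z) = cobd y - cobd z.
  by rewrite linearB.
elim: n => [|n IH]; rewrite [prism_op _]/= tup_bd_cone bdE bd_bot -cobd_bd.
  by rewrite bd_prism_op0 cobdB opprB addKr conE opprK addrC addrA.
rewrite IH !cobdB cobd_cobd subr0 opprB addKr conE opprK.
by rewrite addrC addrA.
Qed.


End Prism.

Section Hulls.
Variable R : realType.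
Local Notation Simplex := (@Simplex R).

Definition comb n (V : lmodType R) (x : 'rV[R]_n) (W : 'I_n -> V) : V :=
  \sum_k x 0 k *: W k.

Lemma comb_ins n (V : lmodType R) (i : 'I_n.+1) x (W : 'I_n.+1 -> V) :
  comb (ins i x) W = comb x (fun k => W (lift i k)).
Proof.
rewrite /comb (bigD1_ord i) //= ins_i scale0r add0r.
by apply: eq_bigr => k _; rewrite ins_lift.
Qed.

Lemma comb_vertex n (x : 'rV[R]_n) : comb x (@vertex R n) = x.
Proof. by rewrite [RHS]row_sum_delta. Qed.

Lemma comb_comb n m (V : lmodType R) (x : 'rV[R]_m) (w : 'I_m -> 'rV[R]_n) (W : 'I_n -> V) :
  comb (comb x w) W = comb x (fun i => comb (w i) W).
Proof.
rewrite /comb; under [RHS]eq_bigr do rewrite scaler_sumr.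
rewrite exchange_big /=; apply: eq_bigr => k _; rewrite summxE scaler_suml.
by apply: eq_bigr => i _; rewrite mxE scalerA.
Qed.

Lemma sum_comb n m (x : 'rV[R]_m) (w : 'I_m -> 'rV[R]_n) :
  \sum_k comb x w 0 k = \sum_i x 0 i * \sum_k w i 0 k.
Proof.
under eq_bigr do rewrite summxE; rewrite exchange_big /=; apply: eq_bigr => i _.
by rewrite mulr_sumr; apply: eq_bigr => k _; rewrite mxE.
Qed.

Lemma Simplex_comb n m (x : 'rV[R]_m) (w : 'I_m -> 'rV[R]_n) :
  Simplex x -> (forall i, Simplex (w i)) -> Simplex (comb x w).
Proof.
move=> [x0 x1] hw; split=> [j|].
  rewrite summxE; apply: sumr_ge0 => i _; rewrite mxE; apply: mulr_ge0 => //.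
  by case: (hw i).
rewrite sum_comb -x1; apply: eq_bigr => i _.
by case: (hw i) => _ ->; rewrite mulr1.
Qed.

Lemma Simplex_vertex n (j : 'I_n) : Simplex (vertex R j).
Proof.
split=> [k|]; first by rewrite mxE; case: (_ && _).
rewrite (bigD1 j) //= mxE !eqxx big1 ?addr0// => k /negPf kj.
by rewrite mxE kj andbF.
Qed.

Lemma Simplex_barycenter n : Simplex (barycenter R n.+1).
Proof.
split=> [k|]; first by rewrite mxE invr_ge0.
under eq_bigr do rewrite mxE.
by rewrite sumr_const card_ord -[_ *+ _]mulr_natl mulfV ?pnatr_eq0.
Qed.

Lemma norm_comb_le n m (x : 'rV[R]_n) (W : 'I_n -> 'rV[R]_m) p r :
  Simplex x -> (forall k, `|p - W k| <= r) -> `|p - comb x W| <= r.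
Proof.
move=> [x0 x1] h.
have -> : p - comb x W = \sum_k x 0 k *: (p - W k).
  under eq_bigr do rewrite scalerBr.
  by rewrite sumrB -scaler_suml x1 scale1r.
apply: (le_trans (ler_norm_sum _ _ _)).
rewrite -[leRHS]mul1r -x1 mulr_suml; apply: ler_sum => k _.
by rewrite normrZ ger0_norm // ler_wpM2l.
Qed.

(** A simplex with n vertices has dimension d = n - 1, so this is the classical factor d / (d + 1)
    of barycentric subdivision. *)
Definition contr_factor n : R := n.-1%:R / n%:R.

Lemma contr_factor_ge0 n : 0 <= contr_factor n.
Proof. by rewrite divr_ge0. Qed.

Lemma contr_factor_lt1 n : contr_factor n < 1.
Proof.
case: n => [|n]; first by rewrite /contr_factor invr0 mulr0.
by rewrite ltr_pdivrMr ?ltr0n// mul1r ltr_nat.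
Qed.

Lemma contr_factorS n : contr_factor n <= contr_factor n.+1.
Proof.
case: n => [|n]; first by rewrite /contr_factor invr0 mulr0 divr_ge0.
rewrite /contr_factor /= ler_pdivrMr ?ltr0n// mulrAC ler_pdivlMr ?ltr0n//.
by rewrite -!natrM ler_nat; lia.
Qed.

Lemma barycenter_near n m (W : 'I_n.+1 -> 'rV[R]_m) r k :
  (forall i j, `|W i - W j| <= r) ->
  `|comb (barycenter R n.+1) W - W k| <= contr_factor n.+1 * r.
Proof.
move=> h.
have -> : comb (barycenter R n.+1) W - W k =
    \sum_(i | i != k) n.+1%:R^-1 *: (W i - W k).
  under [RHS]eq_bigr do rewrite scalerBr.
  have e : W k = \sum_(i < n.+1) n.+1%:R^-1 *: W k.
    by rewrite sumr_const card_ord -[X in _ = X]scaler_nat scalerA mulfV ?pnatr_eq0 ?scale1r.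
  rewrite [X in _ - X]e -sumrB (bigD1 k) //= mxE subrr add0r.
  by apply: eq_bigr => i _; rewrite mxE.
apply: (le_trans (ler_norm_sum _ _ _)).
apply: (@le_trans _ _ (\sum_(i < n.+1 | i != k) n.+1%:R^-1 * r)).
  apply: ler_sum => i _; rewrite normrZ ger0_norm ?invr_ge0//.
  by rewrite ler_wpM2l ?invr_ge0.
rewrite sumr_const (eq_card (B := predC1 k)) // cardC1 card_ord.
by rewrite -[leLHS]mulr_natl mulrA.
Qed.

(** The bound is required for every affine placement [W] of the vertices. It can thus be restricted
    to faces in the induction, and applied anew to each piece when the subdivision is iterated. *)
Definition contracting n (w : 'I_n -> prism R n) : Prop :=
  forall m (W : 'I_n -> 'rV[R]_m) r, (forall i j, `|W i - W j| <= r) ->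
  forall i j, `|comb (w i).1 W - comb (w j).1 W| <= contr_factor n * r.

Definition in_prism n (v : prism R n) : Prop := Simplex v.1 /\ 0 <= v.2 <= 1.

Definition small_top n (w : 'I_n -> prism R n) : Prop :=
  (forall i, Simplex (w i).1 /\ (w i).2 = 1) /\ contracting w.

Lemma supp_cobd n m (P : ('I_m -> prism R n) -> Prop) (Q : ('I_m -> prism R n.+1) -> Prop) z :
  (forall i w, P w -> Q (pins i \o w)) -> supp P z -> supp Q (cobd z).
Proof.
move=> PQ Pz; apply: (submod_sum (supp_mod _)) => i _.
apply: (submodZ (supp_mod _)).
by apply: supp_lin Pz => w Pw; apply: supp_gen; exact: PQ.
Qed.

Lemma prism_op_hull n : supp (fun w => forall i, in_prism (w i)) (prism_op R n).
Proof.
elim: n => [|n IH]; first exact: (supp_mod _).1.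
apply: (supp_lin (P := fun w => forall i, in_prism (w i))) => [w hw|].
  apply: supp_gen => i; rewrite /tup_cons; case: unliftP => // _.
  by split; [exact: Simplex_barycenter | rewrite ler01 lexx].
apply: (submodB (supp_mod _)).
  apply: (submodN (supp_mod _)).
  apply: supp_gen => i; split; [exact: Simplex_vertex | by rewrite lexx ler01].
by apply: supp_cobd IH => i w hw j; case: (hw j) => h1 h2; split=> //; apply/Simplex_ins.
Qed.

(** Two vertices of a piece either both lie on one face, where the smaller factor of the face
    applies, or one of them is the barycenter. *)
Lemma subdiv_small n : supp (@small_top n) (subdiv R n).
Proof.
elim: n => [|n IH]; first by apply: supp_gen; split=> [[]|m W r _ []].
pose P (w : 'I_n -> prism R n.+1) := exists a w', w = @pins R n a \o w' /\ small_top w'.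
apply: (supp_lin (P := P)); last by apply: supp_cobd IH => a w hw; exists a, w.
move=> _ [a [w [-> [hw cw]]]]; apply: supp_gen; split=> [i|m W r hW i j].
  rewrite /tup_cons; case: unliftP => [k _|_] /=.
    by case: (hw k) => h1 h2; split=> //; apply/Simplex_ins.
  by split=> //; exact: Simplex_barycenter.
have r0 : 0 <= r by apply: le_trans (hW i i).
have bnear k : `|comb (barycenter R n.+1) W - comb (ins a (w k).1) W| <= contr_factor n.+1 * r.
  apply: norm_comb_le => [|l]; last exact: barycenter_near.
  by apply/Simplex_ins; case: (hw k).
rewrite /tup_cons; case: unliftP => [k _|_]; case: unliftP => [l _|_] /=.
- rewrite !comb_ins; apply: (@le_trans _ _ (contr_factor n * r)).
    by apply: cw => ? ?; exact: hW.
  by rewrite ler_wpM2r ?contr_factorS.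
- by rewrite distrC.
- exact: bnear.
- by rewrite subrr normr0 mulr_ge0// contr_factor_ge0.
Qed.

End Hulls.

(** * Singular chains and homotopies *)

Section SimplexFaces.
Variables (R : realType) (X : choiceType).

Definition simp_face n (i : 'I_n.+1) (s : 'rV[R]_n.+1 -> X) : 'rV[R]_n -> X :=
  s \o ins i.

Lemma simp_face_face n (i j : 'I_n.+1) (s : 'rV[R]_n.+2 -> X) : (i <= j)%N ->
  simp_face i (simp_face (lift ord0 j) s) =
  simp_face j (simp_face (widen_ord (leqnSn _) i) s).
Proof. by move=> ij; apply/funext => x; rewrite /simp_face /= ins_ins. Qed.

Definition chain n : lmodType rat := malg ('rV[R]_n -> X) rat.

Definition simp_bd n : chain n.+1 -> chain n :=
  @bdry (fun n => ('rV[R]_n -> X) : choiceType) simp_face n.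

HB.instance Definition _ n := GRing.Linear.on (@simp_bd n).

Lemma simp_bd_bd n (c : chain n.+2) : simp_bd (simp_bd c) = 0.
Proof. exact/bdry_bdry/simp_face_face. Qed.

(* Singular simplices are total functions on 'rV_n with a fixed value outside
   the standard simplex. *)
Definition cut (x0 : X) n (s : 'rV[R]_n -> X) : 'rV[R]_n -> X :=
  fun x => if `[< Simplex x >] then s x else x0.

Lemma cut_in x0 n (s : 'rV[R]_n -> X) x : Simplex x -> cut x0 s x = s x.
Proof. by move=> h; rewrite /cut; case: asboolP. Qed.

Lemma cut_out x0 n (s : 'rV[R]_n -> X) x : ~ Simplex x -> cut x0 s x = x0.
Proof. by move=> h; rewrite /cut; case: asboolP. Qed.

End SimplexFaces.

Section Realization.
Variables (R : realType) (X Y : choiceType) (y0 : Y).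

Definition chain_push (f : X -> Y) n : chain R X n -> chain R Y n :=
  lin (fun s => gen (cut y0 (f \o s))).

HB.instance Definition _ f n := GRing.Linear.on (@chain_push f n).

Lemma simp_face_cut n (i : 'I_n.+1) (s : 'rV[R]_n.+1 -> Y) :
  simp_face i (cut y0 s) = cut y0 (simp_face i s).
Proof.
apply/funext => x; rewrite /simp_face /cut /=.
by congr (if _ then _ else _); apply/asbool_equiv_eq/Simplex_ins.
Qed.

Lemma chain_push_bd (f : X -> Y) n (c : chain R X n.+1) :
  chain_push f (simp_bd c) = simp_bd (chain_push f c).
Proof.
apply: (lin_eq (f := @chain_push f n \o @simp_bd R X n)
               (g := @simp_bd R Y n \o @chain_push f n.+1)) => s /=.
rewrite /chain_push lin_gen /simp_bd !bdry_gen linear_sum; apply: eq_bigr => i _.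
by rewrite linearZ /= lin_gen simp_face_cut.
Qed.

Variable H : X * R -> Y.

Definition realize n m (s : 'rV[R]_n -> X) (w : 'I_m -> prism R n) : 'rV[R]_m -> Y :=
  cut y0 (fun x => H (s (comb x (fun i => (w i).1)), \sum_i x 0 i * (w i).2)).

Definition real_op n m (s : 'rV[R]_n -> X) :
    malg ('I_m -> prism R n) rat -> chain R Y m :=
  lin (fun w => gen (realize s w)).

HB.instance Definition _ n m s := GRing.Linear.on (@real_op n m s).

Lemma realize_face n m (s : 'rV[R]_n -> X) (w : 'I_m.+1 -> prism R n) i :
  simp_face i (realize s w) = realize s (tup_face i w).
Proof.
rewrite /realize simp_face_cut; congr cut; apply/funext => x; rewrite /simp_face /=.
rewrite comb_ins; congr (H (s _, _)).
rewrite (bigD1_ord i) //= ins_i mul0r add0r.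
by apply: eq_bigr => k _; rewrite ins_lift.
Qed.

Lemma ins_comb n m (i : 'I_n.+1) x (w : 'I_m -> 'rV[R]_n) :
  ins i (comb x w) = comb x (fun k => ins i (w k)).
Proof.
apply/rowP => k; rewrite [in RHS]summxE; case: (unliftP i k) => [l ->|->].
  by rewrite ins_lift summxE; apply: eq_bigr => j _; rewrite !mxE liftK.
by rewrite ins_i big1// => j _; rewrite !mxE unlift_none mulr0.
Qed.

Lemma realize_pins n m (s : 'rV[R]_n.+1 -> X) (w : 'I_m -> prism R n) i :
  realize (simp_face i s) w = realize s (pins i \o w).
Proof.
rewrite /realize; congr cut; apply/funext => x.
by rewrite /simp_face /= ins_comb.
Qed.

Lemma real_op_bd n m (s : 'rV[R]_n -> X) (z : malg ('I_m.+1 -> prism R n) rat) :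
  real_op s (tup_bd z) = simp_bd (real_op s z).
Proof.
apply: (lin_eq (f := @real_op n m s \o @tup_bd _ m)
               (g := @simp_bd R Y m \o @real_op n m.+1 s)) => w /=.
rewrite /real_op lin_gen /simp_bd /tup_bd !bdry_gen linear_sum; apply: eq_bigr => i _.
by rewrite linearZ /= lin_gen realize_face.
Qed.

Lemma real_op_cobd n m (s : 'rV[R]_n.+1 -> X) (z : malg ('I_m -> prism R n) rat) :
  real_op s (cobd z) = \sum_(i < n.+1) ((-1) ^+ i : rat) *: real_op (simp_face i s) z.
Proof.
rewrite /cobd linear_sum; apply: eq_bigr => i _; rewrite linearZ; congr (_ *: _).
apply: (lin_eq (f := @real_op n.+1 m s \o @tup_push _ _ (pins i) m)
               (g := @real_op n m (simp_face i s))) => w /=.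
by rewrite /tup_push /real_op !lin_gen realize_pins.
Qed.

Definition homotopy_op n : chain R X n -> chain R Y n.+1 :=
  lin (fun s => real_op s (prism_op R n)).
Definition subdivide n : chain R X n -> chain R Y n :=
  lin (fun s => real_op s (subdiv R n)).

HB.instance Definition _ n := GRing.Linear.on (@homotopy_op n).
HB.instance Definition _ n := GRing.Linear.on (@subdivide n).

Lemma realize_bottom n (s : 'rV[R]_n -> X) :
  realize s (@bottom R n) = cut y0 ((fun x => H (x, 0)) \o s).
Proof.
rewrite /realize; congr cut; apply/funext => x /=.
by rewrite comb_vertex big1 // => i _; rewrite mulr0.
Qed.

Lemma homotopy_op_bd0 (c : chain R X 0) :
  simp_bd (homotopy_op c) = subdivide c - chain_push (fun x => H (x, 0)) c.
Proof.
apply: (lin_eq (f := @simp_bd R Y 0 \o @homotopy_op 0)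
  (g := @subdivide 0 \- @chain_push (fun x => H (x, 0)) 0)) => s /=.
rewrite /homotopy_op /subdivide /chain_push !lin_gen -real_op_bd bd_prism_op0 linearB.
by congr (_ - _); rewrite /= /real_op lin_gen realize_bottom.
Qed.

Lemma homotopy_op_bd n (c : chain R X n.+1) :
  simp_bd (homotopy_op c) =
  subdivide c - chain_push (fun x => H (x, 0)) c - homotopy_op (simp_bd c).
Proof.
apply: (lin_eq (f := @simp_bd R Y n.+1 \o @homotopy_op n.+1)
  (g := (@subdivide n.+1 \- @chain_push (fun x => H (x, 0)) n.+1) \-
        (@homotopy_op n \o @simp_bd R X n))) => s /=.
rewrite /homotopy_op /subdivide /chain_push !lin_gen -real_op_bd bd_prism_op !linearB /=.
congr (_ - _ - _); first by rewrite /real_op lin_gen realize_bottom.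
rewrite real_op_cobd /simp_bd bdry_gen linear_sum; apply: eq_bigr => i _.
by rewrite linearZ /= lin_gen.
Qed.

End Realization.

(** * Continuity on a subset *)

Section ContinuousOn.
Implicit Types X Y Z : topologicalType.

(** Continuity of the restriction to [A], for total functions. Simplices, charts and homotopies all
    carry arbitrary values outside their domain, and no subtype has to be formed. *)
Definition con X Y (A : set X) (f : X -> Y) : Prop :=
  forall x, A x -> f y @[y --> within A (nbhs x)] --> f x.

Lemma conP X Y (A : set X) (f : X -> Y) : con A f <->
  forall x, A x -> forall V, nbhs (f x) V -> \forall y \near x, A y -> V (f y).
Proof. by split=> cf x Ax V hV; exact: cf hV. Qed.

Lemma con_comp X Y Z (A : set X) (B : set Y) (f : X -> Y) (g : Y -> Z) :
  con A f -> (forall x, A x -> B (f x)) -> con B g -> con A (g \o f).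
Proof.
move=> /conP cf fAB /conP cg; apply/conP => x Ax V hV.
have := cf _ Ax _ (cg _ (fAB _ Ax) _ hV).
by apply: filterS => y h Ay; apply: h => //; exact: fAB.
Qed.

Lemma con_continuous X Y (A : set X) (f : X -> Y) : continuous f -> con A f.
Proof.
move=> cf; apply/conP => x Ax V hV.
have : \forall y \near x, V (f y) by exact: cf.
by apply: filterS.
Qed.

Lemma con_cst X Y (A : set X) (y : Y) : con A (fun=> y).
Proof. by apply/conP => x Ax V hV; apply: nearW => ? _; exact: nbhs_singleton hV. Qed.

Lemma con_sub X Y (A B : set X) (f : X -> Y) : A `<=` B -> con B f -> con A f.
Proof.
move=> AB /conP cf; apply/conP => x /AB Bx V /(cf _ Bx).
by apply: filterS => y h /AB.
Qed.

Lemma con_eq X Y (A : set X) (f g : X -> Y) :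
  (forall x, A x -> f x = g x) -> con A f -> con A g.
Proof.
move=> e /conP cf; apply/conP => x Ax V; rewrite -e// => /(cf _ Ax).
by apply: filterS => y h Ay; rewrite -e//; exact: h.
Qed.

Lemma con_pair X Y Z (A : set X) (f : X -> Y) (g : X -> Z) :
  con A f -> con A g -> con A (fun x => (f x, g x)).
Proof. by move=> cf cg x Ax; apply: cvg_pair; [exact: cf | exact: cg]. Qed.

Lemma con_row X (R : realType) n (A : set X) (f : X -> 'rV[R]_n) :
  (forall j, con A (fun x => f x 0 j)) -> con A f.
Proof.
move=> cf; apply/conP => x Ax V [P Px PV].
have : \forall y \near x, forall j, A y -> P 0 j (f y 0 j).
  by apply: filter_forall => j; have /conP/(_ x Ax) := cf j; apply; exact: Px.
by apply: filterS => y h Ay; apply: PV => i j; rewrite ord1; exact: h.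
Qed.

Lemma con_fst X Y (A : set X) (B : set Y) : con (A `*` B) fst.
Proof. by apply: con_continuous => -[x y]; exact: cvg_fst. Qed.

Lemma con_snd X Y (A : set X) (B : set Y) : con (A `*` B) snd.
Proof. by apply: con_continuous => -[x y]; exact: cvg_snd. Qed.

End ContinuousOn.

Section Continuity.
Variable R : realType.

Lemma ins_continuous n (i : 'I_n.+1) : continuous (@ins R n i).
Proof.
suff /conP h : con setT (@ins R n i).
  move=> x V /(h x I) hV; rewrite /nbhs /=.
  by apply: filterS hV => y; exact.
apply: con_row => j; case: (unliftP i j) => [k ->|->].
  apply: (con_eq (f := fun x : 'rV[R]_n => x 0 k)) => [x _|]; first by rewrite ins_lift.
  by apply: con_continuous => x; exact: coord_continuous.
apply: (con_eq (f := fun=> 0)) => [x _|]; first by rewrite ins_i.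
exact: con_cst.
Qed.

Lemma comb_continuous n (V : normedModType R) (W : 'I_n -> V) :
  continuous (fun x : 'rV[R]_n => comb x W).
Proof.
move=> x; apply: (@cvg_big V _ +%R 0 xpredT _ _ (nbhs x)) => [|i _]; first exact: add_continuous.
apply: (@cvgZr_tmp _ _ _ (nbhs x)); exact: coord_continuous.
Qed.

Lemma Simplex0 (x : 'rV[R]_0) : ~ Simplex x.
Proof. by case=> _; rewrite big_ord0 => /eqP; rewrite eq_sym oner_eq0. Qed.

End Continuity.

Section SingularComplex.
Variables (R : realType) (X : topologicalType) (x0 : X).

Definition sing_bd n : {linear chain R X n.+1 -> chain R X n} := @simp_bd R X n.

(** Fixing the value outside the simplex makes a singular simplex unique as a total function. The
    standard simplex with n = 0 vertices is empty, so exactly one function is good in index 0,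
    whatever [A] is: this is the augmentation. *)
Definition good (A : set X) n (s : 'rV[R]_n -> X) : Prop :=
  [/\ con (@Simplex R n) s, forall x, Simplex x -> A (s x) &
      forall x, ~ Simplex x -> s x = x0].

Definition sing (A : set X) n : chain R X n -> Prop := supp (@good A n).

Lemma sing_sub A : subcomplex sing_bd (sing A).
Proof.
split=> [n|n c]; first exact: supp_mod.
apply: supp_lin => s [cs sA s0]; apply: (submod_sum (supp_mod _)) => i _.
apply: (submodZ (supp_mod _)); apply: supp_gen; split.
- apply: (con_comp (B := @Simplex R n.+1)) cs => [|x /(Simplex_ins i)//].
  by apply: con_continuous; exact: ins_continuous.
- by move=> x /(Simplex_ins i) /sA.
- by move=> x hx; apply: s0 => /Simplex_ins.
Qed.

Lemma sing_mono (A B : set X) n (c : chain R X n) : A `<=` B -> sing A c -> sing B c.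
Proof. by move=> AB; apply: supp_imp => s [? sA ?]; split=> // x /sA /AB. Qed.

Lemma singI (A B : set X) n (c : chain R X n) :
  sing (A `&` B) c <-> cpxI (sing A) (sing B) c.
Proof.
split=> [h|[h1 h2] s hs]; first by split; apply: sing_mono h => x [].
have [c1 a1 o1] := h1 _ hs; have [c2 a2 o2] := h2 _ hs.
by split=> // x hx; split; [exact: a1 | exact: a2].
Qed.

Definition Hdim (A : set X) n m : Prop := hdim sing_bd (sing A) n m.
Definition Euler (A : set X) e : Prop := has_euler sing_bd (sing A) e.

End SingularComplex.

Section ChainMaps.
Variables (R : realType) (X Y : topologicalType) (x0 : X) (y0 : Y).
Variables (A : set X) (B : set Y).
Local Notation unit01 := [set t : R | 0 <= t <= 1].

Lemma cut_good n (s : 'rV[R]_n -> Y) :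
  con (@Simplex R n) s -> (forall x, Simplex x -> B (s x)) -> good y0 B (cut y0 s).
Proof.
move=> cs sB; split=> [|x hx|x hx]; last by rewrite cut_out.
  by apply: con_eq cs => x hx; rewrite cut_in.
by rewrite cut_in//; exact: sB.
Qed.

Lemma sing_push (f : X -> Y) n (c : chain R X n) :
  con A f -> (forall x, A x -> B (f x)) -> sing x0 A c -> sing y0 B (chain_push y0 f c).
Proof.
move=> cf fAB; apply: supp_lin => s [cs sA _]; apply: supp_gen; apply: cut_good.
  exact: con_comp cs sA cf.
by move=> x /sA /fAB.
Qed.

Lemma chain_push_eq (f g : X -> Y) n (c : chain R X n) :
  (forall x, A x -> f x = g x) -> sing x0 A c -> chain_push y0 f c = chain_push y0 g c.
Proof.
move=> fg; apply: (supp_ind (eq_mod (@chain_push R X Y y0 f n) (@chain_push R X Y y0 g n))).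
move=> s [_ sA _]; rewrite /= /chain_push !lin_gen; congr gen; apply/funext => x.
by rewrite /cut; case: asboolP => //= /sA /fg.
Qed.

Lemma cyc_push (f : X -> Y) n (c : chain R X n) :
  con A f -> (forall x, A x -> B (f x)) ->
  cyc (@sing_bd R X) (sing x0 A) c -> cyc (@sing_bd R Y) (sing y0 B) (chain_push y0 f c).
Proof.
move=> cf fAB [sc zc]; split; first exact: sing_push.
by case: n c sc zc => //= n c _ zc; rewrite /sing_bd /= -chain_push_bd zc linear0.
Qed.

Lemma bnd_push (f : X -> Y) n (c : chain R X n) :
  con A f -> (forall x, A x -> B (f x)) ->
  bnd (@sing_bd R X) (sing x0 A) c -> bnd (@sing_bd R Y) (sing y0 B) (chain_push y0 f c).
Proof.
move=> cf fAB [b sb <-]; exists (chain_push y0 f b); first exact: sing_push.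
by rewrite /sing_bd /= -chain_push_bd.
Qed.

Lemma realize_good (H : X * R -> Y) n m (s : 'rV[R]_n -> X) (w : 'I_m -> prism R n) :
  con (A `*` unit01) H -> (forall p, (A `*` unit01) p -> B (H p)) ->
  good x0 A s -> (forall i, in_prism (w i)) -> good y0 B (realize y0 H s w).
Proof.
move=> cH HB [cs sA _] hw.
have hin x : @Simplex R m x -> Simplex (comb x (fun i => (w i).1)) /\
    unit01 (\sum_i x 0 i * (w i).2).
  move=> hx; split; first by apply: Simplex_comb => // i; case: (hw i).
  case: hx => hx0 hx1; apply/andP; split.
    by apply: sumr_ge0 => i _; apply: mulr_ge0 => //; case: (hw i) => _ /andP[].
  rewrite -hx1; apply: ler_sum => i _; rewrite ler_piMr//.
  by case: (hw i) => _ /andP[].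
apply: cut_good => [|x /hin [h1 h2]]; last by apply: HB; split=> //; exact: sA.
apply: (con_comp (f := fun x => (s (comb x (fun i => (w i).1)), \sum_i x 0 i * (w i).2))
  (B := A `*` unit01)) cH => [|x /hin [h1 h2]]; last by split=> //; exact: sA.
apply: con_pair.
  apply: (con_comp (f := fun x => comb x (fun i => (w i).1)) (B := @Simplex R n)) cs.
    by apply: con_continuous; exact: comb_continuous.
  by move=> x /hin [].
by apply: con_continuous; exact: (@comb_continuous R m R^o).
Qed.

Lemma sing_homotopy_op (H : X * R -> Y) n (c : chain R X n) :
  con (A `*` unit01) H -> (forall p, (A `*` unit01) p -> B (H p)) ->
  sing x0 A c -> sing y0 B (homotopy_op y0 H c).
Proof.
move=> cH HB; apply: supp_lin => s gs.
by apply: supp_lin (@prism_op_hull R n) => w hw; apply: supp_gen; exact: realize_good.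
Qed.

Lemma sing_subdivide (H : X * R -> Y) n (c : chain R X n) :
  con (A `*` unit01) H -> (forall p, (A `*` unit01) p -> B (H p)) ->
  sing x0 A c -> sing y0 B (subdivide y0 H c).
Proof.
move=> cH HB; apply: supp_lin => s gs.
apply: supp_lin (@subdiv_small R n) => w [hw _]; apply: supp_gen; apply: realize_good => // i.
by case: (hw i) => h1 h2; split=> //; rewrite h2 ler01 lexx.
Qed.

(** All vertices of [subdiv] have height 1, so only the final map of the homotopy is seen. *)
Lemma subdivide_top (H : X * R -> Y) n (c : chain R X n) :
  subdivide y0 H c = subdivide y0 (fun p => H (p.1, 1)) c.
Proof.
apply: (lin_eq (f := @subdivide R X Y y0 H n)
               (g := @subdivide R X Y y0 (fun p => H (p.1, 1)) n)) => s /=.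
rewrite /subdivide !lin_gen.
apply: (supp_ind (eq_mod (@real_op R X Y y0 H n n s)
  (@real_op R X Y y0 (fun p => H (p.1, 1)) n n s)) _ (@subdiv_small R n)).
move=> w [hw _]; rewrite /= /real_op !lin_gen; congr gen; apply/funext => x.
rewrite /realize /cut; case: asboolP => //= -[_ hx]; congr (H (_, _)).
by rewrite -[RHS]hx; apply: eq_bigr => i _; case: (hw i) => _ ->; rewrite mulr1.
Qed.

(* Both ends of a homotopy are compared with the subdivision of its top end. *)
Lemma homotopy_bnd (H : X * R -> Y) n (c : chain R X n) :
  con (A `*` unit01) H -> (forall p, (A `*` unit01) p -> B (H p)) ->
  cyc (@sing_bd R X) (sing x0 A) c ->
  bnd (@sing_bd R Y) (sing y0 B)
    (chain_push y0 (fun x => H (x, 1)) c - chain_push y0 (fun x => H (x, 0)) c).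
Proof.
move=> cH HB [sc zc].
have key (K : X * R -> Y) : con (A `*` unit01) K ->
    (forall p, (A `*` unit01) p -> B (K p)) ->
    bnd (@sing_bd R Y) (sing y0 B) (subdivide y0 K c - chain_push y0 (fun x => K (x, 0)) c).
  move=> cK KB; exists (homotopy_op y0 K c); first exact: sing_homotopy_op.
  case: n c sc zc => [|n] c sc zc; first exact: homotopy_op_bd0.
  by rewrite /sing_bd /= homotopy_op_bd (zc : simp_bd c = 0) linear0 subr0.
pose K := fun p : X * R => H (p.1, 1).
have m01 p : (A `*` unit01) p -> (A `*` unit01) (p.1, 1).
  by case=> h _; split=> //=; rewrite ler01 lexx.
have cK : con (A `*` unit01) K.
  apply: (con_comp (f := fun p => (p.1, 1)) (B := A `*` unit01)) cH => //.
  by apply: con_pair; [exact: con_fst | exact: con_cst].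
have h1 := key _ cH HB; have h2 := key _ cK (fun p hp => HB _ (m01 p hp)).
have := submodB (bnd_mod (sing_sub R y0 B) n) h1 h2.
by rewrite subdivide_top -/K opprB addrC addrA subrK.
Qed.

End ChainMaps.

Lemma chain_push_comp (R : realType) (X Y Z : topologicalType) (y0 : Y) (z0 : Z)
    (f : X -> Y) (g : Y -> Z) n (c : chain R X n) :
  chain_push z0 g (chain_push y0 f c) = chain_push z0 (g \o f) c.
Proof.
apply: (lin_eq (f := @chain_push R Y Z z0 g n \o @chain_push R X Y y0 f n)
  (g := @chain_push R X Z z0 (g \o f) n)) => s /=.
rewrite /chain_push !lin_gen; congr gen; apply/funext => x.
by rewrite /cut; case: asboolP => // h; rewrite /= ; case: asboolP.
Qed.

Lemma chain_push_id (R : realType) (X : topologicalType) (x0 : X) (A : set X) (f : X -> X)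
    n (c : chain R X n) :
  (forall x, A x -> f x = x) -> sing x0 A c -> chain_push x0 f c = c.
Proof.
move=> fid; apply: (supp_ind (eq_mod (@chain_push R X X x0 f n) idfun)) => s [_ sA s0].
rewrite /= /chain_push lin_gen; congr gen; apply/funext => x.
by rewrite /cut; case: asboolP => [/sA/fid//|/s0 ->].
Qed.

Section HomotopyEquivalence.
Variables (R : realType) (X Y : topologicalType) (x0 : X) (y0 : Y).
Variables (A : set X) (B : set Y) (f : X -> Y) (g : Y -> X).
Variables (H : X * R -> X) (H' : Y * R -> Y).
Local Notation unit01 := [set t : R | 0 <= t <= 1].
Hypotheses (cf : con A f) (fAB : forall x, A x -> B (f x)).
Hypotheses (cg : con B g) (gBA : forall y, B y -> A (g y)).
Hypotheses (cH : con (A `*` unit01) H) (HA : forall p, (A `*` unit01) p -> A (H p)).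
Hypotheses (cH' : con (B `*` unit01) H') (HB : forall p, (B `*` unit01) p -> B (H' p)).
Hypotheses (H0 : forall x, A x -> H (x, 0) = x) (H1 : forall x, A x -> H (x, 1) = g (f x)).
Hypotheses (H'0 : forall y, B y -> H' (y, 0) = y) (H'1 : forall y, B y -> H' (y, 1) = f (g y)).

Lemma Hdim_equiv n m : Hdim R x0 A n m -> Hdim R y0 B n m.
Proof.
have hZA := cyc_mod (@sing_sub R X x0 A) n; have hBA := bnd_mod (@sing_sub R X x0 A) n.
have hZB := cyc_mod (@sing_sub R Y y0 B) n; have hBB := bnd_mod (@sing_sub R Y y0 B) n.
have gf c : cyc (@sing_bd R X) (sing x0 A) c ->
    bnd (@sing_bd R X) (sing x0 A) (chain_push x0 g (chain_push y0 f c) - c :> chain R X n).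
  move=> hc; have sc := hc.1; have := homotopy_bnd x0 cH HA hc.
  rewrite (chain_push_eq x0 H1 sc) (chain_push_id (f := fun x => H (x, 0)) H0 sc).
  by rewrite chain_push_comp.
have fg c : cyc (@sing_bd R Y) (sing y0 B) c ->
    bnd (@sing_bd R Y) (sing y0 B) (chain_push y0 f (chain_push x0 g c) - c :> chain R Y n).
  move=> hc; have sc := hc.1; have := homotopy_bnd y0 cH' HB hc.
  rewrite (chain_push_eq y0 H'1 sc) (chain_push_id (f := fun x => H' (x, 0)) H'0 sc).
  by rewrite chain_push_comp.
apply: (sqdim_rel (L := fun (z : chain R X n) (z' : chain R Y n) =>
  bnd (@sing_bd R Y) (sing y0 B) (chain_push y0 f z - z')) hZA hZB).
- by rewrite linear0 subrr; exact: hBB.1.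
- by move=> a u v u' v' h h'; rewrite linearP lincombB; exact: hBB.2.
- move=> z hz; exists (chain_push y0 f z); first exact: cyc_push hz.
  by rewrite subrr; exact: hBB.1.
- by move=> z' hz'; exists (chain_push x0 g z'); [exact: cyc_push hz' | exact: fg].
- move=> z z' hz hz' hL; split=> [bz|bz'].
    have := submodB hBB (bnd_push y0 cf fAB bz : bnd _ _ (chain_push y0 f z)) hL.
    by rewrite subKr.
  have h : bnd (@sing_bd R Y) (sing y0 B) (chain_push y0 f z) by exact: submod_subr hL bz'.
  by rewrite -(subKr (chain_push x0 g (chain_push y0 f z)) z); apply: submodB (gf _ hz) => //; exact: bnd_push h.
Qed.

Lemma Euler_equiv e : Euler R x0 A e -> Euler R y0 B e.
Proof.
by move=> [b [N [hb b0 eb]]]; exists b, N; split=> // n; apply: Hdim_equiv; exact: hb.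
Qed.

End HomotopyEquivalence.

Lemma near_row (R : realType) n (x : 'rV[R]_n) (P : 'rV[R]_n -> Prop) :
  (\forall y \near x, P y) <-> exists2 r, 0 < r & forall y, `|x - y| < r -> P y.
Proof.
split.
  by move=> /(@nbhs_normP R 'rV[R]_n) [r r0 h]; exists r.
by move=> [r r0 h]; apply/(@nbhs_normP R 'rV[R]_n); exists r.
Qed.
Lemma near_real (R : realType) (x : R) (P : R -> Prop) :
  (\forall y \near x, P y) <-> exists2 r, 0 < r & forall y, `|x - y| < r -> P y.
Proof.
split.
  by move=> /(@nbhs_normP R R^o) [r r0 h]; exists r.
by move=> [r r0 h]; apply/(@nbhs_normP R R^o); exists r.
Qed.

(** * Homotopy invariance, contractible sets and the empty set *)

Section Corollaries.
Variable R : realType.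
Local Notation unit01 := [set t : R | 0 <= t <= 1].

Lemma Hdim_homeo (X Y : topologicalType) (x0 : X) (y0 : Y) (A : set X) (B : set Y) f g n m :
  con A f -> (forall x, A x -> B (f x)) -> con B g -> (forall y, B y -> A (g y)) ->
  (forall x, A x -> g (f x) = x) -> (forall y, B y -> f (g y) = y) ->
  Hdim R x0 A n m -> Hdim R y0 B n m.
Proof.
move=> cf fAB cg gBA gf fg.
apply: (@Hdim_equiv R X Y x0 y0 A B f g fst fst) => //=.
- exact: con_fst.
- by move=> p [].
- exact: con_fst.
- by move=> p [].
- by move=> x /gf.
- by move=> y /fg.
Qed.

Lemma Hdim_retract (X : topologicalType) (x0 : X) (A B : set X) (H : X * R -> X) n m :
  B `<=` A -> con (A `*` unit01) H -> (forall p, (A `*` unit01) p -> A (H p)) ->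
  (forall x, A x -> H (x, 0) = x) -> (forall x, A x -> B (H (x, 1))) ->
  (forall x, B x -> H (x, 1) = x) ->
  Hdim R x0 B n m -> Hdim R x0 A n m.
Proof.
move=> BA cH HA H0 H1 H1B.
apply: (@Hdim_equiv R X X x0 x0 B A id (fun x => H (x, 1)) fst H) => //.
- by apply: con_continuous => x.
- apply: (con_comp (f := fun x => (x, 1)) (B := A `*` unit01)) cH.
    by apply: con_pair; [apply: con_continuous => x | exact: con_cst].
  by move=> x Ax; split=> //=; rewrite ler01 lexx.
- exact: con_fst.
- by move=> p [].
- by move=> x /H1B.
Qed.

Lemma Euler_acyclic (X : topologicalType) (x0 : X) (A : set X) :
  (forall n, Hdim R x0 A n 0) -> Euler R x0 A 0.
Proof. by move=> h; exists (fun=> 0%N), 0%N; split=> //; rewrite big_ord0. Qed.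

Lemma Euler_Hdim (X Y : topologicalType) (x0 : X) (y0 : Y) (A : set X) (B : set Y) e :
  (forall n m, Hdim R x0 A n m -> Hdim R y0 B n m) -> Euler R x0 A e -> Euler R y0 B e.
Proof. by move=> h [b [N [hb b0 eb]]]; exists b, N; split=> // n; exact/h/hb. Qed.

Section Constant.
Variables (X : topologicalType) (x0 p : X).

Definition const_simplex n : 'rV[R]_n -> X := cut x0 (fun=> p).

Lemma good_const n : good x0 [set p] (@const_simplex n).
Proof. by apply: cut_good => //; exact: con_cst. Qed.

Lemma bd_const n : simp_bd (gen (@const_simplex n.+1)) =
  (~~ odd n)%:R *: gen (@const_simplex n).
Proof.
rewrite /simp_bd bdry_gen.
have e i : simp_face i (@const_simplex n.+1) = @const_simplex n.
  by rewrite /const_simplex simp_face_cut.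
under eq_bigr do rewrite e.
rewrite -scaler_suml; congr (_ *: _); elim: n {e} => [|n IH]; first by rewrite big_ord1.
by rewrite big_ord_recr /= IH -signr_odd /=; case: (odd n); rewrite ?expr0 ?expr1 ?add0r ?subrr.
Qed.

Lemma push_const n (c : chain R X n) :
  chain_push x0 (fun=> p) c = lin (fun=> 1 : rat^o) c *: gen (@const_simplex n).
Proof.
apply: (supp_ind (P := fun=> True)
  (A := fun c => chain_push x0 (fun=> p) c = lin (fun=> 1 : rat^o) c *: gen (@const_simplex n))) => //.
  split=> [|a u v hu hv]; first by rewrite !linear0 scale0r.
  rewrite [LHS]linearP /= hu hv [lin _ (a *: u + v)]linearP.
  by rewrite [RHS]scalerDl scalerA.
by move=> s _; rewrite /chain_push !lin_gen scale1r.
Qed.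

(** For even [n] the constant simplex is itself a boundary. For odd [n] its own boundary is a
    nonzero simplex, so a closed chain must have total coefficient zero and its image vanishes. *)
Lemma bnd_push_const n (c : chain R X n) :
  closed_chain (@sing_bd R X) c ->
  bnd (@sing_bd R X) (sing x0 [set p]) (chain_push x0 (fun=> p) c).
Proof.
have hB := bnd_mod (@sing_sub R X x0 [set p]).
rewrite push_const; have [on|en] := boolP (odd n); last first.
  move=> _; apply: (submodZ (hB _)); exists (gen (@const_simplex n.+1)).
    by apply: supp_gen; exact: good_const.
  by rewrite /sing_bd /= bd_const en scale1r.
case: n on c => // n; rewrite [odd _]/= => on c zc.
have : chain_push x0 (fun=> p) (simp_bd c) = 0 by rewrite (zc : simp_bd c = 0) linear0.
rewrite chain_push_bd push_const linearZ /= bd_const on scale1r => /(congr1 (mcoeff (@const_simplex n))).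
rewrite mcoeffZ mcoeffU eqxx mulr1 mcoeff0 => ->.
by rewrite scale0r; exact: (hB _).1.
Qed.

End Constant.

Lemma Hdim_contractible (X : topologicalType) (x0 p : X) (A : set X) (H : X * R -> X) n :
  A p -> con (A `*` unit01) H -> (forall q, (A `*` unit01) q -> A (H q)) ->
  (forall x, A x -> H (x, 0) = x) -> (forall x, A x -> H (x, 1) = p) ->
  Hdim R x0 A n 0.
Proof.
move=> Ap cH HA H0 H1; apply/hdim0P => [|c hc]; first exact: sing_sub.
have hB := bnd_mod (@sing_sub R X x0 A) n.
have := homotopy_bnd x0 cH HA hc.
rewrite (chain_push_eq x0 H1 hc.1) (chain_push_id (f := fun x => H (x, 0)) H0 hc.1) => h.
rewrite -(subKr (chain_push x0 (fun=> p) c) c); apply: submodB h => //.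
have [b sb <-] := @bnd_push_const X x0 p n c hc.2; exists b => //.
by apply: sing_mono sb => _ ->.
Qed.

Lemma Hdim_star (k : nat) (x0 p : 'rV[R]_k) (A : set 'rV[R]_k) n :
  A p -> (forall x t, A x -> 0 <= t <= 1 -> A ((1 - t) *: x + t *: p)) ->
  Hdim R x0 A n 0.
Proof.
move=> Ap hA.
apply: (@Hdim_contractible _ x0 p A (fun q => (1 - q.2) *: q.1 + q.2 *: p)) => //.
- apply: con_continuous => q; apply: cvgD; apply: cvgZ.
  + by apply: cvgB; [exact: cvg_cst | exact: cvg_snd].
  + exact: cvg_fst.
  + exact: cvg_snd.
  + exact: cvg_cst.
- by move=> [x t] [/= ? ?]; exact: hA.
- by move=> x _ /=; rewrite subr0 scale1r scale0r addr0.
- by move=> x _ /=; rewrite subrr scale0r scale1r add0r.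
Qed.

Lemma sing_set0 (X : topologicalType) (x0 : X) n (c : chain R X n.+1) : sing x0 set0 c -> c = 0.
Proof.
move=> h; apply/malgP => s; rewrite mcoeff0; apply/eqP/negPn/negP => /h [_ h0 _].
exact: h0 _ (Simplex_vertex R (@ord0 n)).
Qed.

(** The single class is that of the simplex without vertices. The empty set thus acts as the sphere
    of dimension -1 and starts the induction in [Hdim_slit]. *)
Lemma Hdim_set0 (X : topologicalType) (x0 : X) n : Hdim R x0 set0 n (n == 0%N).
Proof.
case: n => [|n]; last first.
  apply/hdim0P => [|c [/sing_set0 -> _]]; first exact: sing_sub.
  exact: (bnd_mod (@sing_sub R X x0 set0) _).1.
pose e : 'rV[R]_0 -> X := fun=> x0.
have ge : good x0 set0 e by split=> // x; [move/Simplex0 | move=> /Simplex0].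
exists (fun=> gen e); split=> [i|a|c [sc _]].
- by split=> //; exact: supp_gen.
- rewrite big_ord1 => -[b /sing_set0 ->]; rewrite linear0 => /(congr1 (mcoeff e)).
  by rewrite mcoeffZ mcoeff0 mcoeffU eqxx mulr1 => h i; rewrite ord1.
- exists (fun=> mcoeff e c); rewrite big_ord1.
  suff -> : c - mcoeff e c *: gen e = 0 by exact: (bnd_mod (@sing_sub R X x0 set0) _).1.
  apply/malgP => s; rewrite mcoeffB mcoeffZ mcoeffU mcoeff0.
  have [->|es] := eqVneq e s; first by rewrite mulr1 subrr.
  rewrite mulr0 subr0; apply/eqP/negPn/negP => /sc [_ _ s0].
  by move/eqP: es; apply; apply/funext => x; rewrite s0//; exact: Simplex0.
Qed.

End Corollaries.

(** * Small chains *)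

Section SmallChains.
Variables (R : realType) (X : topologicalType) (x0 : X) (A B : set X).
Let W := A `|` B.
(** Openness is asked only relative to the union, so that the result applies inside subspaces such
    as subcomplexes. *)
Hypothesis openA : forall x, A x -> \forall y \near x, W y -> A y.
Hypothesis openB : forall x, B x -> \forall y \near x, W y -> B y.

Local Notation sd := (@subdivide R X X x0 fst _).
Local Notation T := (@homotopy_op R X X x0 fst _).
Local Notation small := (cpxD (sing (R := R) x0 A) (sing x0 B)).
Local Notation bdX := (@sing_bd R X).

Lemma Simplex_compact n : compact (@Simplex R n).
Proof.
have -> : @Simplex R n = [set v : 'rV[R]_n | forall i, `[0, 1]%classic (v ord0 i)] `&`
    (fun x => comb x (fun=> 1 : R^o)) @^-1` [set x | x = 1].
  apply/seteqP; split=> x /=.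
    move=> [x_ge0 x1]; split=> [i|].
      rewrite in_itv /= x_ge0 -x1 (bigD1 i)//= lerDl; exact: sumr_ge0.
    by rewrite /comb -[RHS]x1; apply: eq_bigr => i _; rewrite [LHS]mulr1.
  move=> [x_ge0 x1]; split=> [i|]; first by have := x_ge0 i; rewrite in_itv /= => /andP[].
  by rewrite -[RHS]x1; apply: eq_bigr => i _; rewrite [RHS]mulr1.
apply: compact_closedI; last first.
  by apply: preimage_closed; [move=> x _; exact: comb_continuous | exact: closed_eq].
apply: (@rV_compact R n (fun=> `[0, 1]%classic)) => i; exact: segment_compact.
Qed.

(** Around each point the alternative holds for all nearby centres and all small radii at once;
    compactness of the simplex, as a near-covering property, makes the radius uniform. *)
Lemma lebesgue_number n (s : 'rV[R]_n -> X) : good x0 W s -> exists2 e : R, 0 < e &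
  forall x, Simplex x -> (forall y, Simplex y -> `|x - y| < e -> A (s y)) \/
                         (forall y, Simplex y -> `|x - y| < e -> B (s y)).
Proof.
move=> [/conP cs sW _].
pose P (e : R) (x : 'rV[R]_n) := (forall y, Simplex y -> `|x - y| < e -> A (s y)) \/
                         (forall y, Simplex y -> `|x - y| < e -> B (s y)).
have key (C : set X) x : (forall x, C x -> \forall y \near x, W y -> C y) ->
    Simplex x -> C (s x) -> \forall x' \near x & e \near (0 : R)^'+,
      forall y, Simplex y -> `|x' - y| < e -> C (s y).
  move=> openC hx Cx.
  have : \forall y \near x, Simplex y -> C (s y).
    by apply: filterS (cs _ hx _ (openC _ Cx)) => y h hy; apply: h => //; exact: sW.
  move=> /near_row [r r0 hr].
  exists ([set x' | `|x - x'| < r / 2], [set e | e < r / 2]).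
    split=> /=; last by apply: nbhs_right_lt; rewrite divr_gt0.
    by apply/near_row; exists (r / 2); rewrite ?divr_gt0.
  move=> [x' e] [/= hx' he] y hy hxy; apply: hr => //=.
  rewrite -(subrK x' x) -addrA (le_lt_trans (ler_normD _ _))// [ltRHS]splitr.
  by rewrite ltrD// (lt_trans hxy).
have /compact_near_coveringP/(_ R (0 : R)^'+ P) := @Simplex_compact n.
case=> [x hx|].
  have [Ax|Bx] := sW _ hx.
    by have := key A x openA hx Ax; apply: filterS => -[x' e] h; left.
  by have := key B x openB hx Bx; apply: filterS => -[x' e] h; right.
move=> D hD hP.
have [e [e0 hPe]] : exists e : R, 0 < e /\ (@Simplex R n `<=` P e).
  apply: (@filter_ex _ (0 : R)^'+); apply: filterI; first exact: nbhs_right_gt.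
  by exists D.
by exists e.
Qed.

Lemma norm_row_le n (x : 'rV[R]_n) r : 0 <= r -> (forall j, `|x 0 j| <= r) -> `|x| <= r.
Proof.
move=> r0 h; rewrite /Num.Def.normr /= mx_normrE; apply: bigmax_le => // -[i j] _ /=.
by rewrite ord1.
Qed.

Definition affine_piece n (s : 'rV[R]_n -> X) (r : R) (t : 'rV[R]_n -> X) : Prop :=
  exists w : 'I_n -> 'rV[R]_n, [/\ forall i, Simplex (w i),
    forall i j, `|w i - w j| <= r & t = cut x0 (fun x => s (comb x w))].

Lemma subdivide_pieces n (s : 'rV[R]_n -> X) m : good x0 W s ->
  supp (affine_piece s (contr_factor R n ^+ m)) (iter m (@subdivide R X X x0 fst n) (gen s)).
Proof.
move=> [_ _ s0]; elim: m => [|m IH].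
  apply: supp_gen; exists (@vertex R n); split=> [i|i j|].
  - exact: Simplex_vertex.
  (* In the sup norm two vertices of the standard simplex are at distance at most 1, the zeroth
     power of the factor. *)
  - apply: norm_row_le => // k; rewrite !mxE eqxx /= expr0.
    by case: (k == i); case: (k == j); rewrite ?subrr ?subr0 ?sub0r ?normrN ?normr1 ?normr0.
  - by apply/funext => x; rewrite /cut comb_vertex; case: asboolP => // /s0.
rewrite iterS; apply: supp_lin IH => _ [w [hw dw ->]].
apply: supp_lin (@subdiv_small R n) => v [hv cv]; apply: supp_gen.
exists (fun i => comb (v i).1 w); split=> [i|i j|].
- by apply: Simplex_comb => //; case: (hv i).
- by rewrite exprS; exact: cv.
- apply/funext => x; rewrite /realize /cut; case: asboolP => // hx /=.
  case: asboolP => [_|[]]; first by rewrite comb_comb.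
  by apply: Simplex_comb => // i; case: (hv i).
Qed.

Lemma affine_piece_good n (s t : 'rV[R]_n -> X) e r : good x0 W s -> r < e ->
  (forall x, Simplex x -> (forall y, Simplex y -> `|x - y| < e -> A (s y)) \/
                          (forall y, Simplex y -> `|x - y| < e -> B (s y))) ->
  affine_piece s r t -> good x0 A t \/ good x0 B t.
Proof.
move=> [cs _ _] re he [w [hw dw ->]].
have hc x : Simplex x -> Simplex (comb x w) by move=> hx; exact: Simplex_comb.
have cc : con (@Simplex R n) (fun x => s (comb x w)).
  apply: (con_comp (f := fun x => comb x w)) hc cs.
  by apply: con_continuous; exact: comb_continuous.
case: n s t w he hw dw hc cc {cs} => [|n] s t w he hw dw hc cc.
  by left; apply: cut_good => // x /Simplex0.
have dc x : Simplex x -> `|w ord0 - comb x w| < e.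
  by move=> hx; apply: le_lt_trans re; exact: norm_comb_le.
by have [h|h] := he _ (hw ord0); [left|right]; apply: cut_good => // x hx; apply: h; auto.
Qed.

Lemma supp_union n (P Q : ('rV[R]_n -> X) -> Prop) (c : chain R X n) :
  supp (fun s => P s \/ Q s) c -> exists u v, [/\ supp P u, supp Q v & c = u + v].
Proof.
apply: (supp_ind (A := fun c => exists u v, [/\ supp P u, supp Q v & c = u + v]))
  => [|s [Ps|Qs]].
- by apply: submod_add; exact: supp_mod.
- by exists (gen s), 0; rewrite addr0; split=> //; [exact: supp_gen | exact: (supp_mod _).1].
- by exists 0, (gen s); rewrite add0r; split=> //; [exact: (supp_mod _).1 | exact: supp_gen].
Qed.

Let fst_con (C : set X) : con (C `*` [set t : R | 0 <= t <= 1]) fst.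
Proof. exact: con_fst. Qed.

Let fst_in (C : set X) p : (C `*` [set t : R | 0 <= t <= 1]) p -> C p.1.
Proof. by case. Qed.

Lemma sing_sd (C : set X) n (c : chain R X n) : sing x0 C c -> sing x0 C (sd c).
Proof. exact: sing_subdivide (@fst_con C) (@fst_in C). Qed.

Lemma sing_T (C : set X) n (c : chain R X n) : sing x0 C c -> sing x0 C (T c).
Proof. exact: sing_homotopy_op (@fst_con C) (@fst_in C). Qed.

Lemma small_sub : subcomplex bdX small.
Proof. by apply: cpxD_sub; exact: sing_sub. Qed.

Lemma small_sing n (c : chain R X n) : small c -> sing x0 W c.
Proof.
move=> [u [v [hu hv ->]]]; apply: (submodD (supp_mod _)).
  by apply: sing_mono hu => x; left.
by apply: sing_mono hv => x; right.
Qed.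

Lemma small_sd n (c : chain R X n) : small c -> small (sd c).
Proof.
move=> [u [v [hu hv ->]]]; exists (sd u), (sd v).
by rewrite linearD; split=> //; exact: sing_sd.
Qed.

Lemma small_T n (c : chain R X n) : small c -> small (T c).
Proof.
move=> [u [v [hu hv ->]]]; exists (T u), (T v).
by rewrite linearD; split=> //; exact: sing_T.
Qed.

Lemma T_closed (C : set X) n (c : chain R X n) : sing x0 C c -> closed_chain bdX c ->
  bdX _ (T c) = sd c - c.
Proof.
move=> sc zc; have e := chain_push_id (f := fun x => x) (fun _ _ => erefl) sc.
case: n c sc zc e => [|n] c sc zc e; rewrite /sing_bd /=.
  by rewrite homotopy_op_bd0 e.
by rewrite homotopy_op_bd e (zc : simp_bd c = 0) linear0 subr0.
Qed.

(** A consequence of the homotopy formula alone: take the boundary of sd c = bd (T c) + c + T (bd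
    c), then apply [T_closed] to the closed chain bd c. *)
Lemma sd_bd (C : set X) n (c : chain R X n.+1) : sing x0 C c -> bdX _ (sd c) = sd (bdX _ c).
Proof.
move=> sc; have e := chain_push_id (f := fun x => x) (fun _ _ => erefl) sc.
have := @homotopy_op_bd R X X x0 fst n c; rewrite e => h.
have /(congr1 (@simp_bd R X n)) : sd c = simp_bd (T c) + c + T (simp_bd c).
  by rewrite h addrAC !subrK.
rewrite !linearD /= simp_bd_bd add0r => ->.
have := T_closed ((sing_sub R x0 C).2 _ _ sc) (closed_bd (@simp_bd_bd R X) c).
by rewrite /sing_bd /= => ->; rewrite addrC subrK.
Qed.

(** All later iterates are claimed, so that a common number of subdivisions serves a linear
    combination. *)
Lemma iter_sd_small n (c : chain R X n) : sing x0 W c ->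
  exists m, forall m', (m <= m')%N -> small (iter m' (@subdivide R X X x0 fst n) c).
Proof.
move: c; apply: (supp_ind (A := fun c => exists m, forall m', (m <= m')%N ->
  small (iter m' (@subdivide R X X x0 fst n) c))).
  split=> [|a u v [m hm] [m' hm']].
    exists 0%N => m _; suff -> : iter m (@subdivide R X X x0 fst n) 0 = 0.
      exact: (small_sub.1 _).1.
    by elim: m => //= m ->; rewrite linear0.
  exists (maxn m m') => k; rewrite geq_max => /andP[mk m'k].
  suff -> : iter k (@subdivide R X X x0 fst n) (a *: u + v) =
      a *: iter k (@subdivide R X X x0 fst n) u + iter k (@subdivide R X X x0 fst n) v.
    by apply: (small_sub.1 _).2; [exact: hm | exact: hm'].
  by elim: k {mk m'k} => //= k ->; rewrite linearP.
move=> s gs; have [e e0 he] := lebesgue_number gs.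
have : `|contr_factor R n| < 1 by rewrite ger0_norm ?contr_factor_lt1 ?contr_factor_ge0.
move=> /cvg_expr /(_ [set x | `|x| < e]) [|m _ hm].
  by apply/near_real; exists e => // x; rewrite sub0r normrN.
exists m => m' mm'; apply: supp_union; apply: supp_imp (@subdivide_pieces n s m' gs) => t.
apply: affine_piece_good gs _ he; apply: le_lt_trans (hm _ mm').
by rewrite /= ler_norm.
Qed.

(** The subcomplex is kept abstract because both the full complex of the union and the small chains
    are stable under subdivision and its homotopy, and both are needed below. *)
Lemma iter_sd_homologous (C : forall n, chain R X n -> Prop) n (c : chain R X n) m :
  subcomplex bdX C -> (forall n c, C n c -> C n (sd c)) ->
  (forall n c, C n c -> C n.+1 (T c)) -> (forall n c, C n c -> sing x0 W c) ->
  cyc bdX C c ->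
  cyc bdX C (iter m (@subdivide R X X x0 fst n) c) /\
  bnd bdX C (iter m (@subdivide R X X x0 fst n) c - c).
Proof.
move=> hC Csd CT CW hc; have hB := bnd_mod hC n; elim: m => [|m [IH1 IH2]].
  by split=> //=; rewrite subrr; exact: hB.1.
set c' := iter m _ c in IH1 IH2; rewrite iterS -/c'.
have h : bnd bdX C (sd c' - c').
  by exists (T c'); [exact: CT IH1.1 | exact: T_closed (CW _ _ IH1.1) IH1.2].
split; last by rewrite -(subrK c' (sd c')) -addrA; exact: submodD.
apply: (submod_subr (cyc_mod hC n) _ IH1).
exact: (bnd_cyc (@simp_bd_bd R X) hC h).
Qed.

Lemma hdim_small n m : hdim bdX small n m -> Hdim R x0 W n m.
Proof.
have hW := sing_sub R x0 W; have hBW := bnd_mod hW n.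
have hBs := bnd_mod small_sub n.
have sBW (c : chain R X n) : bnd bdX small c -> bnd bdX (sing x0 W) c.
  by case=> b sb <-; exists b => //; exact: small_sing.
have sZW (c : chain R X n) : cyc bdX small c -> cyc bdX (sing x0 W) c.
  by case=> sc zc; split=> //; exact: small_sing.
apply: (sqdim_rel (L := fun z z' : chain R X n => bnd bdX (sing x0 W) (z - z'))
  (cyc_mod small_sub n) (cyc_mod hW n)).
- by rewrite subrr; exact: hBW.1.
- by move=> a u v u' v' h h'; rewrite lincombB; exact: hBW.2.
- by move=> z hz; exists z; [exact: sZW | rewrite subrr; exact: hBW.1].
- move=> z hz; have [k hk] := iter_sd_small hz.1.
  have [h1 h2] := iter_sd_homologous k hW (@sing_sd W) (@sing_T W) (fun _ _ h => h) hz.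
  exists (iter k (@subdivide R X X x0 fst n) z) => //.
  by split; [exact: hk | exact: h1.2].
- move=> z z' hz hz' hL; split=> [/sBW bz|bz'].
    by rewrite -(subKr z z'); exact: submodB.
  (* Injectivity: subdividing a bounding chain until it is small bounds the subdivided cycle, and
     the small homotopy leads back from there to [z]. *)
  have [b sb eb] : bnd bdX (sing x0 W) z by exact: submod_subr hL bz'.
  have [k hk] := iter_sd_small sb.
  have [_ h2] := iter_sd_homologous k small_sub small_sd small_T small_sing hz.
  rewrite -(subKr (iter k (@subdivide R X X x0 fst n) z) z); apply: submodB h2 => //.
  exists (iter k (@subdivide R X X x0 fst n.+1) b); first exact: hk.
  have sk j : sing x0 W (iter j (@subdivide R X X x0 fst n.+1) b).
    by elim: j => // j IH; rewrite iterS; exact: sing_sd.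
  rewrite -eb; elim: k {hk} => // k IH; rewrite iterS [in RHS]iterS -IH.
  exact: sd_bd (sk k).
Qed.

End SmallChains.

Section TopologicalMayerVietoris.
Variables (R : realType) (X : topologicalType) (x0 : X) (A B : set X).
Hypothesis openA : forall x, A x -> \forall y \near x, (A `|` B) y -> A y.
Hypothesis openB : forall x, B x -> \forall y \near x, (A `|` B) y -> B y.

Lemma Euler_union a b e : Euler R x0 (A `&` B) e -> Euler R x0 A a -> Euler R x0 B b ->
  Euler R x0 (A `|` B) (a + b - e).
Proof.
move=> dI dA dB.
have dI' : has_euler (@sing_bd R X) (cpxI (sing (R := R) x0 A) (sing x0 B)) e.
  have [be [N [hb b0 eb]]] := dI; exists be, N; split=> // n; apply: eq_sqdim (hb n) => c.
    by split=> -[/singI ? ?]; split.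
  by split=> -[u /singI ? ?]; exists u.
have [be [N [hb b0 eb]]] := euler_mayer_vietoris (@simp_bd_bd R X) (sing_sub R x0 A) (sing_sub R x0 B) dI' dA dB.
by exists be, N; split=> // n; exact: (hdim_small openA openB).
Qed.

Lemma Hdim_suspension : (forall n, Hdim R x0 A n 0) -> (forall n, Hdim R x0 B n 0) ->
  forall a : nat -> nat, (forall n, Hdim R x0 (A `&` B) n (a n)) ->
  Hdim R x0 (A `|` B) 0 0 /\ forall n, Hdim R x0 (A `|` B) n.+1 (a n).
Proof.
move=> dA dB a dI.
have dI' n : hdim (@sing_bd R X) (cpxI (sing (R := R) x0 A) (sing x0 B)) n (a n).
  apply: eq_sqdim (dI n) => c; first by split=> -[/singI ? ?]; split.
  by split=> -[u /singI ? ?]; exists u.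
have [k [s [ka ks d0 dS]]] := mayer_vietoris (@simp_bd_bd R X) (sing_sub R x0 A) (sing_sub R x0 B) dI' dA dB.
have s0 n : s n = 0%N by have := ka n; have := ks n; lia.
have ek n : k n = a n by have := ka n; have := ks n; lia.
split=> [|n]; first by move: d0; rewrite s0; exact: (hdim_small openA openB).
by have := dS n; rewrite s0 ek add0n; exact: (hdim_small openA openB).
Qed.

End TopologicalMayerVietoris.

(** * Balls and spheres *)

Section Arithmetic.
Variables (R : realType) (X : topologicalType) (A : set X).

Lemma conD (V : normedModType R) (f g : X -> V) :
  con A f -> con A g -> con A (fun x => f x + g x).
Proof. by move=> cf cg x Ax; apply: cvgD; [exact: cf | exact: cg]. Qed.

Lemma conB (V : normedModType R) (f g : X -> V) :
  con A f -> con A g -> con A (fun x => f x - g x).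
Proof. by move=> cf cg x Ax; apply: cvgB; [exact: cf | exact: cg]. Qed.

Lemma conM (f g : X -> R) : con A f -> con A g -> con A (fun x => f x * g x).
Proof. by move=> cf cg x Ax; apply: cvgM; [exact: cf | exact: cg]. Qed.

Lemma conV (f : X -> R) : con A f -> (forall x, A x -> f x != 0) -> con A (fun x => (f x)^-1).
Proof. by move=> cf f0 x Ax; apply: cvgV; [exact: f0 | exact: cf]. Qed.

Lemma conZ (V : normedModType R) (f : X -> R) (g : X -> V) :
  con A f -> con A g -> con A (fun x => f x *: g x).
Proof. by move=> cf cg x Ax; apply: cvgZ; [exact: cf | exact: cg]. Qed.

Lemma con_id : con A id.
Proof. by apply: con_continuous => x. Qed.

End Arithmetic.

Section Spheres.
Variable R : realType.

Lemma coord_le_norm k (x : 'rV[R]_k) i : `|x 0 i| <= `|x|.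
Proof.
rewrite [leRHS]/Num.Def.normr /= mx_normrE.
exact: (le_bigmax _ (fun ij : 'I_1 * 'I_k => `|x ij.1 ij.2|) (0, i)).
Qed.

Lemma near_coord_neq0 k (x : 'rV[R]_k) i : x 0 i != 0 -> \forall y \near x, (y : 'rV[R]_k) 0 i != 0.
Proof.
move=> xi; apply/near_row; exists `|x 0 i|; first by rewrite normr_gt0.
move=> y; apply: contraTneq => yi; rewrite -leNgt.
by have := coord_le_norm (x - y) i; rewrite !mxE yi subr0.
Qed.

Lemma near_coord_gt0 k (x : 'rV[R]_k) i (s : R) : 0 < s * x 0 i ->
  \forall y \near x, 0 < s * (y : 'rV[R]_k) 0 i.
Proof.
move=> xi; have s0 : s != 0 by apply: contraTneq xi => ->; rewrite mul0r ltxx.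
apply/near_row; exists (s * x 0 i / `|s|); first by rewrite divr_gt0 ?normr_gt0.
move=> y; rewrite ltr_pdivlMr ?normr_gt0// => h.
have := coord_le_norm (x - y) i; rewrite !mxE => /(ler_wpM2r (normr_ge0 s)) h'.
have := le_lt_trans h' h; rewrite -normrM mulrC mulrBr => h''.
by have := le_lt_trans (ler_norm _) h''; rewrite gtrBl.
Qed.

Section ConvexBody.
Variables (k : nat) (x0 : 'rV[R]_k) (K : set 'rV[R]_k).
Hypothesis K_convex : forall x y t, K x -> K y -> 0 <= t <= 1 -> K ((1 - t) *: x + t *: y).
Hypothesis K_axes : forall (i : 'I_k) (s : R), `|s| = 1 ->
  exists2 c : R, 0 < c & K ((s * c) *: vertex R i).

(** This set has the homology of a sphere of dimension m - 1. It grows from the empty set to the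
    punctured body, and each step is a suspension. *)
Let slit m : set 'rV[R]_k := [set x | K x /\ exists2 i : 'I_k, (i < m)%N & x 0 i != 0].

Lemma Hdim_slit m n : (m <= k)%N -> Hdim R x0 (slit m) n (n == m).
Proof.
elim: m n => [|m IH] n mk.
  have -> : slit 0 = set0 by apply/seteqP; split=> x // -[_ []].
  exact: Hdim_set0.
pose j := Ordinal mk.
(* The two halves of the suspension, for s = 1 and s = -1. Each is star-shaped about a point on its
   half of axis [j]: before time 1 the earlier coordinates are only scaled, and at time 1 coordinate
   [j] has the sign [s]. *)
pose U (s : R) : set 'rV[R]_k :=
  [set x | K x /\ ((exists2 i : 'I_k, (i < m)%N & x 0 i != 0) \/ 0 < s * x 0 j)].
have Uopen s (C : set 'rV[R]_k) x : U s x -> \forall y \near x, ((U 1 `|` U (-1)) y -> U s y).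
  move=> [Kx [[i im xi]|xj]].
    apply: filterS (near_coord_neq0 xi) => y yi [[Ky _]|[Ky _]];
    by split=> //; left; exists i.
  apply: filterS (near_coord_gt0 xj) => y yj [[Ky _]|[Ky _]];
  by split=> //; right.
have Ustar s n' : `|s| = 1 -> Hdim R x0 (U s) n' 0.
  move=> s1; have [c c0 Kc] := K_axes j s1.
  have ss : s * s = 1 by rewrite -expr2 -real_normK ?num_real// s1 expr1n.
  have pj : (s * c) * vertex R j 0 j = s * c by rewrite mxE !eqxx mulr1.
  apply: (@Hdim_star R k x0 ((s * c) *: vertex R j)).
    by split=> //; right; rewrite mxE pj mulrA ss mul1r.
  move=> x t [Kx hx] /andP[t0 t1]; split; first by apply: K_convex; rewrite ?t0.
  have jE : ((1 - t) *: x + t *: ((s * c) *: vertex R j)) 0 j = (1 - t) * x 0 j + t * (s * c).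
    by rewrite !mxE !eqxx mulr1.
  have [->|tn1] := eqVneq t 1.
    by right; rewrite subrr scale0r add0r scale1r mxE pj mulrA ss mul1r.
  have t1' : 0 < 1 - t by rewrite subr_gt0 lt_neqAle tn1.
  case: hx => [[i im xi]|xj].
    left; exists i => //; rewrite !mxE eqxx /=.
    have -> : (i == j) = false by apply/negP => /eqP ij; move: im; rewrite ij ltnn.
    by rewrite !mulr0 addr0 mulf_neq0// gt_eqF.
  right; rewrite jE mulrDr mulrCA [s * (t * _)]mulrCA [s * (s * c)]mulrA ss mul1r.
  by apply: ltr_pwDl; [rewrite mulr_gt0 | rewrite mulr_ge0// ltW].
have dI n' : Hdim R x0 (U 1 `&` U (-1)) n' (n' == m).
  have -> : U 1 `&` U (-1) = slit m.
    apply/seteqP; split=> [x [[Kx h1] [_ h2]]|x [Kx h]]; last first.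
      by split; split=> //; left.
    split=> //; case: h1 h2 => // h1 [//|h2].
    by move: h1 h2; rewrite mul1r mulN1r oppr_gt0 => h1; rewrite ltNge (ltW h1).
  exact/IH/ltnW.
have eU : U 1 `|` U (-1) = slit m.+1.
  apply/seteqP; split=> x.
    case=> -[Kx [[i im xi]|xj]]; split=> //.
    - by exists i => //; exact: ltnW.
    - by exists j => //; apply: contraTneq xj => ->; rewrite mulr0 ltxx.
    - by exists i => //; exact: ltnW.
    - by exists j => //; apply: contraTneq xj => ->; rewrite mulr0 ltxx.
  move=> [Kx [i]]; rewrite ltnS leq_eqVlt => /orP[/eqP im xi|im xi]; last first.
    by left; split=> //; left; exists i.
  have ij : i = j by exact: val_inj.
  have [h|h] := ltP 0 (x 0 i); first by left; split=> //; right; rewrite mul1r -ij.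
  by right; split=> //; right; rewrite mulN1r oppr_gt0 -ij lt_neqAle xi.
have [h0 hS] := Hdim_suspension (Uopen 1 set0) (Uopen (-1) set0)
  (fun n' => Ustar 1 n' (normr1 _)) (fun n' => Ustar (-1) n' (normrN1 _)) dI.
by rewrite eU in h0 hS; case: n => [|n]; [exact: h0 | exact: hS].
Qed.

Lemma Hdim_punctured n : Hdim R x0 (K `\ 0) n (n == k).
Proof.
have <- : slit k = K `\ 0; last exact: Hdim_slit.
apply/seteqP; split=> x [Kx hx]; split=> //.
  by case: hx => i _ xi x00; move: xi; rewrite x00 mxE eqxx.
apply: contrapT => h; apply: hx; apply/rowP => i; rewrite mxE; apply/eqP/negPn/negP => xi.
by apply: h; exists i.
Qed.

End ConvexBody.

Lemma Euler_delta (X : topologicalType) (x0 : X) (A : set X) k :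
  (forall n, Hdim R x0 A n (n == k)) -> Euler R x0 A ((-1) ^+ k).
Proof.
move=> h; exists (fun n => nat_of_bool (n == k)), k.+1; split=> // [n kn|].
  by rewrite gtn_eqF.
rewrite big_ord_recr /= eqxx mulr1 big1 ?add0r// => i _.
by rewrite ltn_eqF ?mulr0.
Qed.

Definition sqn k (x : 'rV[R]_k) : R := \sum_i x 0 i ^+ 2.

Definition open_ball k : set 'rV[R]_k := [set x | sqn x < 1].

Lemma sqn_ge0 k (x : 'rV[R]_k) : 0 <= sqn x.
Proof. by apply: sumr_ge0 => i _; exact: sqr_ge0. Qed.

Lemma sqnZ k a (x : 'rV[R]_k) : sqn (a *: x) = a ^+ 2 * sqn x.
Proof. by rewrite /sqn mulr_sumr; apply: eq_bigr => i _; rewrite mxE exprMn. Qed.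

Lemma sqn0 k : sqn (0 : 'rV[R]_k) = 0.
Proof. by rewrite /sqn big1// => i _; rewrite mxE expr0n. Qed.

Lemma sqn_eq0 k (x : 'rV[R]_k) : sqn x = 0 -> x = 0.
Proof.
move=> /eqP; rewrite psumr_eq0 => [/allP h|i _]; last exact: sqr_ge0.
apply/rowP => i; rewrite mxE; apply/eqP; rewrite -sqrf_eq0.
by have := h i (mem_index_enum i).
Qed.

Lemma sqn_gt0 k (x : 'rV[R]_k) : x <> 0 -> 0 < sqn x.
Proof.
by move=> x0; rewrite lt_neqAle sqn_ge0 andbT eq_sym; apply/eqP => /sqn_eq0.
Qed.

Lemma sqn_convex k (x y : 'rV[R]_k) t : 0 <= t <= 1 ->
  sqn ((1 - t) *: x + t *: y) <= (1 - t) * sqn x + t * sqn y.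
Proof.
move=> /andP[t0 t1]; rewrite /sqn !mulr_sumr -big_split /=; apply: ler_sum => i _.
rewrite !mxE; set a := x 0 i; set b := y 0 i.
rewrite -subr_ge0.
have -> : (1 - t) * a ^+ 2 + t * b ^+ 2 - ((1 - t) * a + t * b) ^+ 2 =
  t * (1 - t) * (a - b) ^+ 2 by ring.
by apply: mulr_ge0; [apply: mulr_ge0; rewrite ?subr_ge0 | exact: sqr_ge0].
Qed.

Lemma convex_lt (a b r t : R) : a < r -> b < r -> 0 <= t <= 1 -> (1 - t) * a + t * b < r.
Proof.
move=> ar br /andP[t0 t1]; have [->|tn0] := eqVneq t 0; first by rewrite subr0 mul1r mul0r addr0.
rewrite -subr_gt0 (_ : r - _ = t * (r - b) + (1 - t) * (r - a)); last by ring.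
apply: ltr_pwDl; last by rewrite mulr_ge0 ?subr_ge0// ltW.
by rewrite mulr_gt0 ?subr_gt0// lt_neqAle eq_sym tn0.
Qed.

Lemma sqn_continuous k : continuous (@sqn k).
Proof.
move=> x; apply: (@cvg_big R^o _ +%R 0 xpredT _ _ (nbhs x)) => [|i _].
  exact: add_continuous.
rewrite expr2; under eq_fun do rewrite expr2.
by apply: cvgM; exact: coord_continuous.
Qed.

Lemma open_ball_convex k (x y : 'rV[R]_k) t : open_ball x -> open_ball y ->
  0 <= t <= 1 -> open_ball ((1 - t) *: x + t *: y).
Proof.
rewrite /open_ball /= => hx hy ht; apply: le_lt_trans (sqn_convex x y ht) _.
exact: convex_lt.
Qed.

Lemma sqn_vertex k (i : 'I_k) : sqn (vertex R i) = 1.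
Proof.
rewrite /sqn (bigD1 i)//= mxE !eqxx expr1n big1 ?addr0// => j /negPf ji.
by rewrite mxE ji andbF expr0n.
Qed.

Lemma Hdim_punctured_ball k x0 n (r : R) : 0 < r ->
  Hdim R x0 ([set x : 'rV[R]_k | sqn x < r] `\ 0) n (n == k).
Proof.
move=> r0; apply: (@Hdim_punctured k x0 [set x : 'rV[R]_k | sqn x < r]).
  rewrite /= => x y t hx hy ht; apply: le_lt_trans (sqn_convex x y ht) _.
  exact: convex_lt.
(* With q = min(1, r/2) the point of the axis has squared length q^2, and q^2 <= q <= r/2 < r. *)
move=> i s s1; exists (Num.min 1 (r / 2)); first by rewrite lt_min ltr01 divr_gt0.
rewrite /= sqnZ sqn_vertex mulr1 exprMn -[s ^+ 2]real_normK ?num_real// s1 expr1n mul1r.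
have h0 : 0 <= Num.min 1 (r / 2) by rewrite le_min ler01 divr_ge0 ?ltW.
have h1 : Num.min 1 (r / 2) <= 1 by rewrite ge_min lexx.
have h2 : Num.min 1 (r / 2) <= r / 2 by rewrite ge_min lexx orbT.
by nra.
Qed.

Lemma Hdim_punctured_space k x0 n : Hdim R x0 ([set~ 0 : 'rV[R]_k]) n (n == k).
Proof.
rewrite -[X in Hdim _ _ X](_ : setT `\ 0 = _); last by rewrite setTD.
by apply: Hdim_punctured => // i s _; exists 1.
Qed.

(** Linear interpolation from the identity to the projection onto the Euclidean unit sphere. Inside
    the ball the factor is at least 1, so points only move outwards along their ray. *)
Definition radial k (p : 'rV[R]_k * R) : 'rV[R]_k :=
  ((1 - p.2) + p.2 / Num.sqrt (sqn p.1)) *: p.1.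

Lemma con_radial k : con [set p : 'rV[R]_k * R | p.1 <> 0] (@radial k).
Proof.
apply: conZ; last by apply: con_continuous => p; exact: cvg_fst.
have snd_con : con [set p : 'rV[R]_k * R | p.1 <> 0] snd.
  by apply: con_continuous => p; exact: cvg_snd.
apply: (@conD _ _ _ R^o); first by apply: (@conB _ _ _ R^o) => //; exact: con_cst.
apply: conM => //; apply: conV => [|p p0]; last by rewrite sqrtr_eq0 -ltNge; exact: sqn_gt0.
apply: (con_comp (f := fun p => sqn p.1) (B := setT) (g := Num.sqrt)) => //; last first.
  by apply: con_continuous => y; exact: sqrt_continuous.
apply: (con_comp (f := fst) (B := setT) (g := @sqn k)) => //.
  by apply: con_continuous => p; exact: cvg_fst.
by apply: con_continuous => y; exact: sqn_continuous.
Qed.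

Section RadialProps.
Variables (k : nat) (b : 'rV[R]_k) (t : R).
Hypotheses (b0 : b <> 0) (b1 : sqn b <= 1) (ht : 0 <= t <= 1).

Let e := Num.sqrt (sqn b).
Let e_gt0 : 0 < e. Proof. by rewrite sqrtr_gt0 sqn_gt0. Qed.
Let e_le1 : e <= 1. Proof. by rewrite -sqrtr1 ler_sqrt. Qed.

Lemma radial_ge1 : 1 <= (1 - t) + t / e.
Proof.
have : 1 <= e^-1 by rewrite invr_ge1// unitfE gt_eqF.
by case/andP: ht => t0 t1; nra.
Qed.

Lemma sqn_radial : sqn (radial (b, t)) = ((1 - t) * e + t) ^+ 2.
Proof.
rewrite /radial /= sqnZ -/e -[sqn b]sqr_sqrtr ?sqn_ge0// -/e -exprMn mulrDl.
by rewrite mulfVK// gt_eqF.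
Qed.

Lemma radial_ball : sqn (radial (b, t)) <= 1.
Proof.
rewrite sqn_radial; case/andP: ht => t0 t1.
have : 0 <= (1 - t) * e + t by rewrite addr_ge0// mulr_ge0 ?subr_ge0// ltW.
have h : (1 - t) * e + t <= 1.
  rewrite -subr_ge0 (_ : 1 - _ = (1 - t) * (1 - e)); last by ring.
  by rewrite mulr_ge0 ?subr_ge0.
by move=> h0; rewrite expr_le1.
Qed.

End RadialProps.

Lemma radial0 k (b : 'rV[R]_k) : radial (b, 0) = b.
Proof. by rewrite /radial /= subr0 mul0r addr0 scale1r. Qed.

Lemma radial1 k (b : 'rV[R]_k) : b <> 0 -> sqn (radial (b, 1)) = 1.
Proof.
by move=> b0; rewrite sqn_radial// subrr mul0r add0r expr1n.
Qed.

Lemma radial_sphere k (b : 'rV[R]_k) t : sqn b = 1 -> radial (b, t) = b.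
Proof. by move=> b1; rewrite /radial /= b1 sqrtr1 divr1 subrK scale1r. Qed.

End Spheres.

(** * Attaching a cell *)

Lemma near_notin (T : topologicalType) (C : set T) x :
  closed C -> ~ C x -> \forall y \near x, ~ C y.
Proof. by move=> cC nCx; apply: open_nbhs_nbhs; split=> //; exact: closed_openC. Qed.

(** Pasting lemma for two closed pieces; closedness is expressed by neighbourhoods of the points
    outside. *)
Lemma con_paste (X Y : topologicalType) (D C1 C2 : set X) (h : X -> Y) :
  (forall x, D x -> C1 x \/ C2 x) ->
  (forall x, ~ C1 x -> \forall y \near x, ~ C1 y) ->
  (forall x, ~ C2 x -> \forall y \near x, ~ C2 y) ->
  con (D `&` C1) h -> con (D `&` C2) h -> con D h.
Proof.
move=> DC n1 n2 /conP c1 /conP c2; apply/conP => x Dx V hV.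
have near1 : \forall y \near x, D y -> C1 y -> V (h y).
  have [C1x|/n1] := pselect (C1 x); last by apply: filterS.
  by apply: filterS (c1 _ (conj Dx C1x) _ hV) => y hy Dy C1y; apply: hy.
have near2 : \forall y \near x, D y -> C2 y -> V (h y).
  have [C2x|/n2] := pselect (C2 x); last by apply: filterS.
  by apply: filterS (c2 _ (conj Dx C2x) _ hV) => y hy Dy C2y; apply: hy.
apply: filterS2 near1 near2 => y h1 h2 Dy.
by have [/h1|/h2] := DC _ Dy; apply.
Qed.

Lemma near_fst (X Y : topologicalType) (p : X * Y) (P : X -> Prop) :
  (\forall x \near p.1, P x) -> \forall q \near p, P q.1.
Proof. by move=> h; exact: (@cvg_fst _ _ (nbhs p.1) (nbhs p.2) _ P h). Qed.

Section Attach.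
Variables (R : realType) (M : topologicalType) (x0 : M) (k : nat).
Variables (X c Cl : set M) (F : M -> 'rV[R]_k) (G : 'rV[R]_k -> M).
Hypotheses (X_closed : closed X) (Cl_closed : closed Cl).
Hypotheses (F_con : con Cl F) (G_con : con (unit_ball R k) G).
Hypotheses (FB : forall y, Cl y -> sqn (F y) <= 1) (GC : forall b, sqn b <= 1 -> Cl (G b)).
Hypotheses (GF : forall y, Cl y -> G (F y) = y) (FG : forall b, sqn b <= 1 -> F (G b) = b).
Hypothesis cE : forall y, c y <-> Cl y /\ sqn (F y) < 1.
Hypothesis bX : forall y, Cl y -> sqn (F y) = 1 -> X y.
Hypothesis cX : forall y, c y -> ~ X y.
(** [Z] is removed from the space, and [T] is what must then be removed from the ball so that the
    rest can be pushed radially onto the part of [X] outside [Z]. It will be the centre alone, or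
    the radius ending at a boundary point that belongs to [Z]. *)
Variables (Z : set M) (T : set 'rV[R]_k).
Hypotheses (T0 : T 0) (T_star : forall b (s : R), T b -> 0 <= s <= 1 -> T (s *: b)).
Hypothesis T_closed : forall b, ~ T b -> \forall b' \near b, ~ T b'.
Hypothesis ZT : forall y, Cl y -> Z y -> T (F y).
Hypothesis TZ : forall y, Cl y -> sqn (F y) = 1 -> T (F y) -> Z y.

Local Notation unit01 := [set t : R | 0 <= t <= 1].

Definition slit_attach : set M :=
  [set y | [/\ X y \/ c y, ~ Z y & ~ (Cl y /\ T (F y))]].

Let sphere_or_cell y : Cl y -> sqn (F y) = 1 \/ c y.
Proof.
move=> Cy; have := FB Cy; rewrite le_eqVlt => /orP[/eqP ->|h]; first by left.
by right; apply/cE.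
Qed.

Let X_sphere y : X y -> Cl y -> sqn (F y) = 1.
Proof. by move=> Xy /sphere_or_cell [//|/cX]. Qed.

Let H (p : M * R) : M := if `[< Cl p.1 >] then G (radial (F p.1, p.2)) else p.1.

Let HCl p : Cl p.1 -> H p = G (radial (F p.1, p.2)).
Proof. by rewrite /H; case: asboolP. Qed.

Let HnCl p : ~ Cl p.1 -> H p = p.1.
Proof. by rewrite /H; case: asboolP. Qed.

Let F_neq0 y : slit_attach y -> Cl y -> F y <> 0.
Proof. by move=> [_ _ h] Cy Fy; apply: h; rewrite Fy. Qed.

Let radial_in y t : slit_attach y -> Cl y -> 0 <= t <= 1 -> slit_attach (G (radial (F y, t))).
Proof.
move=> Ay Cy ht; have b0 := F_neq0 Ay Cy; have b1 := FB Cy.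
have rb := radial_ball b0 b1 ht; have lam := radial_ge1 b0 b1 ht.
have nT : ~ T (radial (F y, t)).
  case: Ay => _ _ nTy Tr; apply: nTy; split=> //.
  have lam0 : 0 < 1 - t + t / Num.sqrt (sqn (F y)) by apply: lt_le_trans lam.
  (* A point pushed outwards cannot enter [T]: shrinking it back by the inverse factor would put the
     original point into [T]. *)
  have := T_star Tr (s := (1 - t + t / Num.sqrt (sqn (F y)))^-1).
  rewrite /radial /= scalerA mulVf ?gt_eqF// scale1r; apply.
  by rewrite invr_ge0 ltW//= invf_le1.
have CG := GC rb; split.
- by case: (sphere_or_cell CG) => [/(bX CG)|]; [left | right].
- by move=> /(ZT CG); rewrite FG.
- by rewrite FG// => -[_].
Qed.

(** The retraction pushes the closed cell radially in its chart and fixes everything else. It is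
    continuous by pasting: [X] meets the closed cell only in the sphere, where the radial map is the
    identity. *)
Lemma Hdim_slit_attach n m : Hdim R x0 (X `\` Z) n m -> Hdim R x0 slit_attach n m.
Proof.
apply: (@Hdim_retract R M x0 slit_attach (X `\` Z) H).
- move=> y [Xy nZ]; split=> //; first by left.
  by move=> [Cy /(TZ Cy (X_sphere Xy Cy))].
- apply: (con_paste (C1 := [set p | X p.1]) (C2 := [set p | Cl p.1])).
  + move=> p [[[Xp|/cE[Cp _]] _ _] _]; by [left | right].
  + by move=> p nX; apply: (@near_fst _ _ p (fun x => ~ X x)); exact: near_notin.
  + by move=> p nC; apply: (@near_fst _ _ p (fun x => ~ Cl x)); exact: near_notin.
  + apply: (con_eq (f := fst)); last by apply: con_continuous => p; exact: cvg_fst.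
    move=> p [_ Xp]; rewrite /H; case: asboolP => // Cp.
    by rewrite radial_sphere ?GF//; exact: X_sphere.
  + apply: (con_eq (f := G \o (fun p => radial (F p.1, p.2)))).
      by move=> p [_ Cp]; rewrite HCl.
    apply: (con_comp (B := unit_ball R k)) G_con; last first.
      by move=> [y t] [[/= Ay ht] Cy]; apply: radial_ball => //; [exact: F_neq0 | exact: FB].
    apply: (con_comp (f := fun p : M * R => (F p.1, p.2))
      (B := [set p : 'rV[R]_k * R | p.1 <> 0]) _ _ (@con_radial R k)).
      apply: con_pair; last by apply: con_continuous => p; exact: cvg_snd.
      apply: (con_comp (f := fst) (B := Cl) (g := F)) => //.
        by apply: con_continuous => p; exact: cvg_fst.
      by move=> p [].
    by move=> [y t] [[/= Ay ht] Cy]; exact: F_neq0.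
- move=> [y t] [/= Ay ht]; have [Cy|nCy] := pselect (Cl y).
    by rewrite HCl//; exact: radial_in.
  by rewrite HnCl.
- move=> y Ay; have [Cy|nCy] := pselect (Cl y); last by rewrite HnCl.
  by rewrite HCl//= radial0 GF.
- move=> y Ay; have [Cy|nCy] := pselect (Cl y).
    have h01 : 0 <= (1 : R) <= 1 by rewrite ler01 lexx.
    have rb := radial_ball (F_neq0 Ay Cy) (FB Cy) h01.
    have [_ nZ _] := radial_in Ay Cy h01.
    rewrite HCl//=; split=> //; apply: bX; first exact: GC.
    by rewrite FG// radial1//; exact: F_neq0.
  by rewrite HnCl//=; case: Ay => -[Xy|/cE[]//] nZ _; split.
- move=> y [Xy nZ]; have [Cy|nCy] := pselect (Cl y); last by rewrite HnCl.
  by rewrite HCl//= radial_sphere ?GF//; exact: X_sphere.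
Qed.

(** Mayer-Vietoris for the open cell, which is contractible and has value 0, and for [slit_attach],
    which retracts to the old space. Their intersection is the open ball without [T]. *)
Lemma Euler_attach e e1 : (forall y, c y -> ~ Z y) ->
  Euler R x0 (X `\` Z) e -> Euler R (0 : 'rV[R]_k) ([set b | sqn b < 1] `\` T) e1 ->
  Euler R x0 ((X `|` c) `\` Z) (e - e1).
Proof.
move=> cZ EX ET.
have h1 (b : 'rV[R]_k) : sqn b < 1 -> sqn b <= 1 by exact: ltW.
have Fc : con c F by apply: con_sub F_con => y /cE[].
have Gc : con [set b | sqn b < 1] G by apply: con_sub G_con => b /h1.
have Gc' b : sqn b < 1 -> c (G b) by move=> hb; apply/cE; rewrite FG ?h1//; split=> //; exact/GC/h1.
have Ec : Euler R x0 c 0.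
  apply: Euler_acyclic => n.
  apply: (@Hdim_homeo R _ _ (0 : 'rV[R]_k) x0 [set b | sqn b < 1] c G F) => //.
  - by move=> y /cE[].
  - by move=> b /h1 /FG.
  - by move=> y /cE[/GF].
  apply: (@Hdim_star R k 0 0) => [|x t hx ht]; first by rewrite /= sqn0.
  by apply: open_ball_convex; rewrite /open_ball /= ?sqn0.
have EI : Euler R x0 (c `&` slit_attach) e1.
  apply: Euler_Hdim ET => n m.
  apply: (@Hdim_homeo R _ _ (0 : 'rV[R]_k) x0 ([set b | sqn b < 1] `\` T) _ G F).
  - by apply: con_sub Gc => b [].
  - move=> b [/= hb nT]; have cb := Gc' _ hb; split=> //; split; [by right | exact: cZ|].
    by rewrite FG ?h1// => -[].
  - by apply: con_sub Fc => y [].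
  - by move=> y [/cE[Cy hy] [_ _ nT]]; split=> // Ty; exact: nT.
  - by move=> b [/h1 /FG].
  - by move=> y [/cE[/GF]].
have EA : Euler R x0 slit_attach e by apply: Euler_Hdim EX => n m; exact: Hdim_slit_attach.
have eW : (X `|` c) `\` Z = c `|` slit_attach.
  apply/seteqP; split=> y.
    move=> [[Xy|cy] nZ]; last by left.
    right; split=> //; first by left.
    by move=> [Cy /(TZ Cy (X_sphere Xy Cy))].
  by move=> [cy|[h nZ _]]; split=> //; [right | exact: cZ].
rewrite eW -[e]add0r; apply: Euler_union => // y.
  move=> cy; apply: filterS (near_notin X_closed (cX cy)) => z nXz [//|].
  by case=> -[].
move=> [h nZ nT].
have : \forall z \near y, ~ (Cl z /\ T (F z)).
  have [Cy|nCy] := pselect (Cl y); last by apply: filterS (near_notin Cl_closed nCy) => z nC [].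
  have nTy : ~ T (F y) by move=> Ty; exact: nT.
  by move/conP: F_con => /(_ y Cy _ (T_closed nTy)); apply: filterS => z hz [/hz].
apply: filterS => z nTz [cz|//]; split=> //; [by right | exact: cZ].
Qed.

End Attach.

Lemma near_neq0 (R : realType) k (b : 'rV[R]_k) : b <> 0 -> \forall b' \near b, b' <> 0.
Proof.
move=> b0; apply/near_row; exists `|b|; first by rewrite normr_gt0; exact/eqP.
by move=> y h y0; move: h; rewrite y0 subr0 ltxx.
Qed.

Section Ray.
Variables (R : realType) (k : nat) (b0 : 'rV[R]_k).
Hypothesis b0_sphere : sqn b0 = 1.

Definition ray : set 'rV[R]_k := [set b | exists2 s, 0 <= s <= 1 & b = s *: b0].

Lemma ray_closed b : ~ ray b -> \forall b' \near b, ~ ray b'.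
Proof.
apply: near_notin; apply: compact_closed; first exact: norm_hausdorff.
have -> : ray = (fun s => s *: b0) @` `[0, 1]%classic.
  by apply/seteqP; split=> x [s hs e]; exists s.
apply: continuous_compact; last exact: segment_compact.
by apply: continuous_subspaceT => s; exact: scalel_continuous.
Qed.

Lemma Hdim_ball_ray n : Hdim R (0 : 'rV[R]_k) ([set b : 'rV[R]_k | sqn b < 1] `\` ray) n 0.
Proof.
have b0n : b0 != 0 by apply: contra_eq_neq b0_sphere => ->; rewrite sqn0 eq_sym oner_neq0.
(* Any point on the opposite radius would serve as a centre; one half keeps it in the open ball. *)
apply: (@Hdim_star R k 0 (- 2^-1 *: b0)).
  split=> /=; first by rewrite sqnZ b0_sphere; lra.
  move=> [s /andP[s0 _] /eqP]; rewrite -subr_eq0 -scalerBl scaler_eq0 (negPf b0n) orbF.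
  by move=> /eqP; lra.
move=> x t [/= hx nx] /andP[t0 t1]; split.
  apply: open_ball_convex; rewrite ?t0// /open_ball /=.
  by rewrite sqnZ b0_sphere; lra.
(* If the segment from [x] met the ray at [s *: b0], then (1 - t) x = (s + t/2) b0. So [x] would be
   a nonnegative multiple of [b0], and the multiplier is at most 1 because [x] lies in the ball. *)
move=> [s /andP[s0 s1] e]; apply: nx.
have e' : (1 - t) *: x = (s + t / 2) *: b0.
  by rewrite [RHS]scalerDl -e -addrA scalerA -scalerDl mulrN addNr scale0r addr0.
have [t1'|tn1] := eqVneq t 1.
  move: e'; rewrite t1' subrr scale0r => /esym/eqP; rewrite scaler_eq0 (negPf b0n) orbF.
  by move=> /eqP; lra.
have tp : 0 < 1 - t by rewrite subr_gt0 lt_neqAle tn1.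
exists ((s + t / 2) / (1 - t)); last first.
  by rewrite mulrC -scalerA -e' scalerA mulVf ?gt_eqF// scale1r.
have r0 : 0 <= (s + t / 2) / (1 - t) by rewrite divr_ge0 ?(ltW tp)//; lra.
rewrite r0 /= leNgt; apply/negP => r1.
have xE : x = ((s + t / 2) / (1 - t)) *: b0.
  by rewrite mulrC -scalerA -e' scalerA mulVf ?gt_eqF// scale1r.
by move: hx; rewrite xE sqnZ b0_sphere mulr1 ltNge => /negP; apply; rewrite ltW// expr_gt1// ltW.
Qed.

End Ray.

Lemma con_of_set_type (T U : topologicalType) (A : set T) (f : set_type A -> U) (F : T -> U) :
  continuous f -> (forall x, F (set_val x) = f x) -> con A F.
Proof.
move=> cf e; apply/conP => x Ax V hV.
pose x' : set_type A := exist _ x (mem_set Ax).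
have : nbhs x' (f @^-1` V) by apply: cf; rewrite -e.
rewrite nbhsE => -[_ [[O oO <-] /= Ox] OV].
have : nbhs x O by apply: open_nbhs_nbhs.
apply: filterS => y Oy Ay; pose y' : set_type A := exist _ y (mem_set Ay).
by have := e y'; rewrite set_valE /= => ->; exact: (OV y').
Qed.

(** Passes from homeomorphisms of subspaces to total maps that are continuous on a subset, with
    default values elsewhere. *)
Lemma pairs_charts (T U : topologicalType) (t0 : T) (u0 : U) (A A' : set T) (B B' : set U) :
  homeomorphic_pairs A A' B B' -> exists (F : T -> U) (G : U -> T),
  [/\ con A F /\ con B G, (forall x, A x -> B (F x)) /\ (forall y, B y -> A (G y)),
      forall x, A x -> G (F x) = x, forall y, B y -> F (G y) = y &
      forall x, A x -> (A' x <-> B' (F x))].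
Proof.
move=> [f [g [cf cg fK gK fP]]].
have val_con (V W : topologicalType) (C : set V) (D : set W) (h : set_type C -> set_type D) :
    continuous h -> continuous (set_val \o h).
  by move=> ch x; apply: continuous_comp; [exact: ch | exact: initial_continuous].
pose ext (V W : topologicalType) (C : set V) (D : set W) (w0 : W) (h : set_type C -> set_type D) (x : V) : W :=
  match pselect (C x) with
  | left p => set_val (h (exist _ x (mem_set p))) | right _ => w0 end.
have extE (V W : topologicalType) (C : set V) (D : set W) w0 (h : set_type C -> set_type D) x :
    ext V W C D w0 h (set_val x) = set_val (h x).
  rewrite /ext; case: pselect => [p|]; last by case; exact: set_mem (svalP x).
  by congr (set_val (h _)); apply: val_inj.
have inE (V : topologicalType) (C : set V) x : C x -> exists x' : set_type C, set_val x' = x.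
  by move=> Cx; exists (exist _ x (mem_set Cx)).
exists (ext _ _ _ _ u0 f), (ext _ _ _ _ t0 g); split.
- by split; [apply: (con_of_set_type (val_con _ _ _ _ _ cf)) => x |
             apply: (con_of_set_type (val_con _ _ _ _ _ cg)) => x]; rewrite extE.
- by split=> x /inE [x' <-]; rewrite extE; [exact: set_mem (svalP (f x')) | exact: set_mem (svalP (g x'))].
- by move=> x /inE [x' <-]; rewrite !extE fK.
- by move=> x /inE [x' <-]; rewrite !extE gK.
- by move=> x /inE [x' <-]; rewrite !extE; exact: fP.
Qed.

(** * Euler characteristics of subcomplexes *)

Section Cells.
Variables (R : realType) (M : topologicalType) (Om : regular_cell_complex R M) (x0 : M).

Definition face_of (t s : Om) : bool := `[< cell t `<=` closure (cell s) >].

Definition realization (J : {set Om}) : set M := [set x | exists2 s, s \in J & cell s x].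

Definition downset (J : {set Om}) : Prop :=
  forall s t, s \in J -> face_of t s -> t \in J.

Lemma cell_inj (s t : Om) x : cell s x -> cell t x -> s = t.
Proof. by move=> sx tx; apply: (@cell_disjoint _ _ Om) => //; exists x. Qed.

Lemma closure_cell (s : Om) x : closure (cell s) x -> exists2 t, face_of t s & cell t x.
Proof.
move=> Cx; have [sx|nsx] := pselect (cell s x).
  by exists s => //; apply/asboolP; exact: subset_closure.
have [D [_ De]] := cell_boundary s.
have : (closure (cell s) `\` cell s) x by [].
rewrite De => -[t Dt tx]; exists t => //; apply/asboolP => y ty.
by have [] : (closure (cell s) `\` cell s) y by rewrite De; exists t.
Qed.

Lemma face_of_refl s : face_of s s.
Proof. by apply/asboolP; exact: subset_closure. Qed.

Lemma face_of_trans t s u : face_of t s -> face_of s u -> face_of t u.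
Proof.
move=> /asboolP ts /asboolP su; apply/asboolP; apply: (subset_trans ts) => x sx.
rewrite ((closure_id (closure (cell u))).1 (@closed_closure _ _)).
exact: closure_subset sx.
Qed.

Lemma face_of_dim t s : face_of t s -> t = s \/ (cell_dim t < cell_dim s)%N.
Proof. by move=> /asboolP; exact: cell_closure_dim. Qed.

Lemma face_of_point t s x : cell t x -> closure (cell s) x -> face_of t s.
Proof. by move=> tx /closure_cell [u us /(cell_inj tx) ->]. Qed.

Lemma realization_closed J : downset J -> closed (realization J).
Proof.
move=> dJ; have -> : realization J = \bigcup_(s in [set s | s \in J]) closure (cell s).
  apply/seteqP; split=> x [s sJ sx]; first by exists s => //; exact: subset_closure.
  by have [t ts tx] := closure_cell sx; exists t => //; exact: dJ ts.
by apply: closed_bigcup => [|s _]; [exact: finite_finset | exact: closed_closure].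
Qed.

Definition is_chart (s : Om) (p : (M -> 'rV[R]_(cell_dim s)) * ('rV[R]_(cell_dim s) -> M)) : Prop :=
  [/\ con (closure (cell s)) p.1 /\ con (unit_ball R (cell_dim s)) p.2,
      forall y, closure (cell s) y -> sqn (p.1 y) <= 1,
      forall b, sqn b <= 1 -> closure (cell s) (p.2 b),
      (forall y, closure (cell s) y -> p.2 (p.1 y) = y) /\ (forall b, sqn b <= 1 -> p.1 (p.2 b) = b) &
      forall y, cell s y <-> closure (cell s) y /\ sqn (p.1 y) < 1].

Lemma cell_chart (s : Om) : exists p, @is_chart s p.
Proof.
have [F [G [[cF cG] [FB GC] GF FG P]]] := pairs_charts x0 (0 : 'rV[R]_(cell_dim s)) (cell_ball s).
exists (F, G); split=> // y; split=> [sy|[Cy]].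
  have Cy : closure (cell s) y by exact: subset_closure.
  split=> //; rewrite lt_neqAle [_ <= _](FB _ Cy) andbT; apply/eqP => e.
  by have /P[_ /(_ e)[]] := Cy.
by move=> h; apply: contrapT => ns; have /P[/(_ (conj Cy ns)) /= e _] := Cy; move: h; rewrite /sqn e ltxx.
Qed.

Definition chart s := sval (cid (cell_chart s)).

Lemma chartP s : is_chart (chart s).
Proof. exact: svalP (cid (cell_chart s)). Qed.

Definition center (s : Om) : M := (chart s).2 0.

Lemma center_cell s : cell s (center s).
Proof.
have [_ _ GC [_ FG] cE] := chartP s.
have h0 : sqn (0 : 'rV[R]_(cell_dim s)) <= 1 by rewrite sqn0.
by apply/cE; split; [exact: GC | rewrite FG// sqn0].
Qed.

(** [None] removes no point and [Some t] removes the centre of [t]; [above] singles out the cells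
    whose contribution then disappears. One induction covers both cases. *)
Definition pt_set (o : option Om) : set M := if o is Some t then [set center t] else set0.
Definition above (o : option Om) (s : Om) : bool := if o is Some t then face_of t s else false.

Lemma Euler_set0 : Euler R x0 set0 1.
Proof. by rewrite -(expr0 (-1)); apply: Euler_delta; exact: Hdim_set0. Qed.

Lemma Euler_realization o J : downset J ->
  Euler R x0 (realization J `\` pt_set o)
    (1 - \sum_(s in J | ~~ above o s) (-1) ^+ cell_dim s).
Proof.
have [m] := ubnP #|J|; elim: m J => // m IH J; rewrite ltnS => Jm dJ.
have [->|[s1 s1J]] := set_0Vmem J.
  rewrite (_ : realization _ `\` _ = set0); last first.
    by apply/seteqP; split=> x // -[[s]]; rewrite inE.
  by rewrite big1 ?subr0; [exact: Euler_set0 | move=> s; rewrite inE].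
have [s sJ smax] := arg_maxnP (fun s : Om => cell_dim s) s1J.
have {}sJ : s \in J by exact: sJ.
(* As [s] has maximal dimension in [J], it is a proper face of no other member, so the rest is again
   closed under faces. *)
set J' := J :\ s.
have dJ' : downset J'.
  move=> u t; rewrite !inE => /andP[us uJ] tu; rewrite (dJ _ _ uJ tu) andbT.
  apply/eqP => ts; have [tu'|] := face_of_dim tu; first by move: us; rewrite -tu' ts eqxx.
  by rewrite ts => h; have := leq_ltn_trans (smax u uJ) h; rewrite ltnn.
have J'm : (#|J'| < m)%N by move: Jm; rewrite (cardsD1 s) sJ.
have {IH}E' := IH _ J'm dJ'.
have sumJ : \sum_(u in J | ~~ above o u) (-1) ^+ cell_dim u =
    (if above o s then 0 else (-1) ^+ cell_dim s) +
    \sum_(u in J' | ~~ above o u) (-1) ^+ cell_dim u :> int.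
  rewrite !big_mkcondr (big_setD1 s) //=; congr (_ + _).
  by case: (above o s).
have eJ : realization J = realization J' `|` cell s.
  apply/seteqP; split=> x.
    move=> [u uJ ux]; have [us|us] := eqVneq u s; first by right; rewrite -us.
    by left; exists u => //; rewrite !inE us.
  move=> [[u]|sx]; last by exists s.
  by rewrite !inE => /andP[_ uJ] ux; exists u.
have [[cF cG] FB GC [GF FG] cE] := chartP s.
have cX' y : cell s y -> ~ realization J' y.
  by move=> sy [u]; rewrite !inE => /andP[/eqP us _] uy; apply: us; exact: cell_inj uy sy.
have bX y : closure (cell s) y -> sqn ((chart s).1 y) = 1 -> realization J' y.
  move=> Cy e; have [t ts ty] := closure_cell Cy; exists t => //.
  rewrite !inE (dJ _ _ sJ ts) andbT; apply/eqP => ets.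
  by move: ty; rewrite ets => /cE[_]; rewrite e ltxx.
have cJ' := realization_closed dJ'; have cC := @closed_closure _ (cell s).
have z_star (b : 'rV[R]_(cell_dim s)) (r : R) : [set 0] b -> 0 <= r <= 1 -> [set 0] (r *: b).
  by move=> -> _; rewrite scaler0.
have z_cl := @near_neq0 R (cell_dim s).
have zZ y : closure (cell s) y -> sqn ((chart s).1 y) = 1 -> [set 0] ((chart s).1 y) -> pt_set o y.
  by move=> _ + e; rewrite e sqn0 => /eqP; rewrite eq_sym oner_eq0.
(* When the closed cell avoids the removed point, the relevant intersection is a punctured ball, and
   the cell contributes its sign. *)
have far : (forall y, closure (cell s) y -> ~ pt_set o y) -> above o s = false ->
    Euler R x0 (realization J `\` pt_set o)
      (1 - \sum_(u in J | ~~ above o u) (-1) ^+ cell_dim u).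
  move=> nZ nas; rewrite sumJ nas opprD addrCA addrC eJ.
  apply: (Euler_attach cJ' cC cF cG FB GC GF FG cE bX cX' (T := [set 0])) E' _ => //.
  - by move=> y Cy Zy; case: (nZ y Cy Zy).
  - by move=> y /cE[Cy _]; exact: nZ.
  - by apply: Euler_delta => n; exact: Hdim_punctured_ball.
case: o far E' sumJ zZ => [t|] far E' sumJ zZ; last by apply: far => // y _ [].
have [Ct|nCt] := pselect (closure (cell s) (center t)); last first.
  apply: far => [y Cy Zy|]; first by apply: nCt; rewrite -(Zy : y = center t).
  by apply/negP => /asboolP h; apply: nCt; apply: h; exact: center_cell.
have ts : face_of t s by exact: face_of_point (center_cell t) Ct.
(* If the removed point is the centre of the new cell itself, what is attached is a punctured cell,
   which retracts to the old complex. *)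
rewrite sumJ /= ts add0r; have [ets|nts] := eqVneq t s.
  have eF0 : (chart s).1 (center t) = 0 by rewrite ets FG ?sqn0.
  have -> : realization J `\` pt_set (Some t) =
      slit_attach (realization J') (cell s) (closure (cell s)) (chart s).1 (pt_set (Some t)) [set 0].
    rewrite eJ; apply/seteqP; split=> y [h1 h2]; split=> //.
    by move=> [Cy Fy]; apply: h2; rewrite /= -(GF _ Cy) Fy -eF0 GF.
  apply: Euler_Hdim E' => n k.
  apply: (Hdim_slit_attach cJ' cC cF cG FB GC GF FG cE bX cX') => //.
  by move=> y _ ->.
have e0 : sqn ((chart s).1 (center t)) = 1.
  apply/eqP; rewrite eq_le (FB _ Ct) leNgt; apply/negP => h.
  by move/eqP: nts; apply; apply: cell_inj (center_cell t) _; apply/cE.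
(* The removed point is on the boundary sphere. Deleting the whole radius ending there keeps the
   radial push away from it, and the remaining ball has value 0, so the count is unchanged. *)
rewrite eJ -[X in Euler _ _ _ X]subr0.
apply: (Euler_attach cJ' cC cF cG FB GC GF FG cE bX cX' (T := ray ((chart s).1 (center t)))) E' _.
- by exists 0; rewrite ?scale0r// lexx ler01.
- move=> b r [r' /andP[r'0 r'1] ->] /andP[r0 r1]; exists (r * r'); last by rewrite scalerA.
  by rewrite mulr_ge0//= mulr_ile1.
- exact: ray_closed.
- by move=> y Cy ->; exists 1; rewrite ?scale1r// lexx ler01.
- move=> y Cy ey [r /andP[r0 r1] er]; move: ey; rewrite er sqnZ e0 mulr1 => /eqP.
  rewrite sqrf_eq1 => /orP[/eqP r1'|/eqP rN1]; last by move: r0; rewrite rN1 lerNr oppr0 ler10.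
  by rewrite /= -(GF _ Cy) er r1' scale1r GF.
- move=> y sy /= ey; move/eqP: nts; apply; apply: cell_inj (center_cell t) _.
  by rewrite -ey.
- by apply: Euler_acyclic => n; exact: Hdim_ball_ray.
Qed.

Let Euler_eq A e e' : Euler R x0 A e -> Euler R x0 A e' -> e = e'.
Proof. exact: has_euler_inj (sing_sub R x0 A) _ _. Qed.

Definition faces (s : Om) : {set Om} := [set t | face_of t s].

Lemma faces_down s : downset (faces s).
Proof. by move=> t u; rewrite !inE => ts ut; exact: face_of_trans ut ts. Qed.

Lemma realization_faces s : realization (faces s) = closure (cell s).
Proof.
apply/seteqP; split=> x.
  by move=> [t]; rewrite inE => /asboolP ts /ts.
by move=> /closure_cell [t ts tx]; exists t => //; rewrite inE.
Qed.

Lemma Hdim_closed_cell (s : Om) (A : set M) n :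
  (forall y, A y -> closure (cell s) y) -> A (center s) ->
  (forall b t, A ((chart s).2 b) -> sqn b <= 1 -> 0 <= t <= 1 -> A ((chart s).2 ((1 - t) *: b))) ->
  Hdim R x0 A n 0.
Proof.
move=> AC Ac Astar; have [[cF cG] FB GC [GF FG] cE] := chartP s.
have h0 : sqn (0 : 'rV[R]_(cell_dim s)) <= 1 by rewrite sqn0.
apply: (@Hdim_homeo R _ _ (0 : 'rV[R]_(cell_dim s)) x0
  [set b | sqn b <= 1 /\ A ((chart s).2 b)] A (chart s).2 (chart s).1).
- by apply: con_sub cG => b [].
- by move=> b [].
- exact: con_sub cF.
- by move=> y Ay; have Cy := AC _ Ay; split; [exact: FB | rewrite GF].
- by move=> b [/FG].
- by move=> y /AC /GF.
apply: (@Hdim_star R _ 0 0) => // b t [hb Ab] ht; rewrite scaler0 addr0; split.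
  rewrite sqnZ; case/andP: ht => t0 t1.
  by rewrite mulr_ile1// ?sqn_ge0 ?sqr_ge0// expr_le1 ?subr_ge0// gerBl.
exact: Astar.
Qed.

(** The closed cell is star-shaped in its chart, so its value 0 is compared with the count of its
    faces. *)
Lemma sum_faces (s : Om) : \sum_(t | face_of t s) (-1) ^+ cell_dim t = 1 :> int.
Proof.
have := Euler_realization None (@faces_down s).
rewrite setD0 realization_faces => E.
have E0 : Euler R x0 (closure (cell s)) 0.
  have [_ _ GC [_ FG] _] := chartP s.
  apply: Euler_acyclic => n; apply: (Hdim_closed_cell (s := s)) => //.
    by apply: subset_closure; exact: center_cell.
  move=> b t _ hb /andP[t0 t1]; apply: GC; rewrite sqnZ.
  by rewrite mulr_ile1// ?sqn_ge0 ?sqr_ge0// expr_le1 ?subr_ge0// gerBl.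
have := Euler_eq E E0; move=> /eqP; rewrite subr_eq0 => /eqP.
by under eq_bigl do rewrite inE andbT.
Qed.

(** A closed cell without one boundary point is still star-shaped about its centre. Hence the faces
    not above [t] also have alternating sum 1, and subtracting from [sum_faces] leaves 0. *)
Lemma sum_between (t s : Om) : face_of t s -> t != s ->
  \sum_(u | face_of t u && face_of u s) (-1) ^+ cell_dim u = 0 :> int.
Proof.
move=> ts nts; have := Euler_realization (Some t) (@faces_down s).
rewrite realization_faces => E.
have Ct : closure (cell s) (center t) by move/asboolP: ts; apply; exact: center_cell.
have nst y : cell s y -> y <> center t.
  by move=> sy e; move/eqP: nts; apply; apply: cell_inj (center_cell t) _; rewrite -e.
have E0 : Euler R x0 (closure (cell s) `\ center t) 0.
  have [_ FB GC [GF FG] cE] := chartP s.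
  apply: Euler_acyclic => n; apply: (Hdim_closed_cell (s := s)) => //.
  - by move=> y [].
  - by split; [apply: subset_closure; exact: center_cell | exact/nst/center_cell].
  - move=> b r [_ nb] hb /andP[r0 r1].
    have hr : sqn ((1 - r) *: b) <= 1.
      by rewrite sqnZ mulr_ile1// ?sqn_ge0 ?sqr_ge0// expr_le1 ?subr_ge0// gerBl.
    split; first exact: GC.
    (* At time 0 nothing has moved; at any later time the point is strictly inside the ball, hence
       in the open cell, which does not contain the removed point. *)
    have [r0'|rn0] := eqVneq r 0; first by rewrite r0' subr0 scale1r.
    apply: nst; apply/cE; split; first exact: GC.
    rewrite FG// sqnZ; apply: (@le_lt_trans _ _ ((1 - r) ^+ 2)).
      by rewrite ler_piMr ?sqr_ge0.
    by rewrite expr_lt1 ?subr_ge0// gtrBl lt_neqAle eq_sym rn0.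
have := Euler_eq E E0; move=> /eqP; rewrite subr_eq0 => /eqP h.
have := sum_faces s; rewrite (bigID (fun u => face_of t u)) /=.
rewrite [X in _ + X](_ : _ = 1); last first.
  by rewrite [RHS]h; apply: eq_bigl => u; rewrite inE.
move=> e; apply: (addIr (1 : int)); rewrite add0r -[RHS]e; congr (_ + _).
by apply: eq_bigl => u; rewrite andbC.
Qed.

Lemma Euler_total o : Euler R x0 (~` pt_set o) (1 - \sum_(s | ~~ above o s) (-1) ^+ cell_dim s).
Proof.
have := Euler_realization o (J := [set: Om]).
rewrite (_ : realization _ = setT); last first.
  apply/seteqP; split=> x // _; have : [set: M] x by [].
  by rewrite -(cell_cover Om) => -[s _ sx]; exists s.
rewrite setTD; under eq_bigl do rewrite inE; by apply=> s t _ _; rewrite inE.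
Qed.

(** * The Euler relation above a cell of a manifold *)

Section Manifold.
Variables (n : nat) (M_hausdorff : hausdorff_space M).
Hypothesis locally_euclidean : forall x : M, exists U : set M,
  [/\ open U, U x & homeomorphic (set_type U) 'rV[R]_n].

Lemma manifold_chart (x : M) : exists (U : set M) (F : M -> 'rV[R]_n) (G : 'rV[R]_n -> M),
  [/\ open U /\ U x, con U F /\ con setT G, forall v, U (G v),
      (forall y, U y -> G (F y) = y) /\ (forall v, F (G v) = v) & F x = 0].
Proof.
have [U [oU Ux [f [g [cf cg fK gK]]]]] := locally_euclidean x.
pose F y := match pselect (U y) with left p => f (exist _ y (mem_set p)) | right _ => 0 end.
have FE y' : F (set_val y') = f y'.
  rewrite /F; case: pselect => [p|]; last by case; exact: set_mem (svalP y').
  by congr (f _); apply: val_inj.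
have cF : con U F by apply: con_of_set_type cf _.
have inU y : U y -> exists y' : set_type U, set_val y' = y.
  by move=> Uy; exists (exist _ y (mem_set Uy)).
exists U, (fun y => F y - F x), (fun v => set_val (g (v + F x))); split=> //.
- split; first by apply: conB => //; exact: con_cst.
  apply: (@con_comp 'rV[R]_n 'rV[R]_n M setT setT (fun v => v + F x) (fun v => set_val (g v))) => //.
    by apply: conD; [exact: con_id | exact: con_cst].
  apply: (@con_comp 'rV[R]_n (set_type U) M setT setT g set_val) => //; apply: con_continuous => //.
  exact: initial_continuous.
- by move=> v; exact: set_mem (svalP (g _)).
- by split=> [y /inU[y' <-]|v]; rewrite FE ?subrK ?fK// gK addrK.
- by rewrite subrr.
Qed.

(** M is the union of a chart around the centre of [t] and the complement of that centre, and they
    meet in a punctured Euclidean space. Mayer-Vietoris compares the cell count of M with the count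
    that omits the cells above [t]. *)
Lemma sum_above (t : Om) : \sum_(s | face_of t s) (-1) ^+ cell_dim s = (-1) ^+ n :> int.
Proof.
have [U [F [G [[oU Ux] [cF cG] GU [GF FG] Fx]]]] := manifold_chart (center t).
have cG' A : con A G by exact: con_sub cG.
have EU : Euler R x0 U 0.
  apply: Euler_acyclic => k; apply: (@Hdim_homeo R _ _ (0 : 'rV[R]_n) x0 setT U G F) => //.
  exact: (@Hdim_star R n 0 0).
have EI : Euler R x0 (U `&` ~` [set center t]) ((-1) ^+ n).
  apply: Euler_delta => k.
  apply: (@Hdim_homeo R _ _ (0 : 'rV[R]_n) x0 [set~ 0] _ G F); last exact: Hdim_punctured_space.
  - exact: cG'.
  - by move=> v v0; split=> // e; apply: v0; rewrite /= -(FG v) e Fx.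
  - by apply: con_sub cF => y [].
  - by move=> y [Uy yt] Fy; apply: yt; rewrite /= -(GF _ Uy) Fy -Fx GF.
  - by [].
  - by move=> y [Uy _]; exact: GF.
have Et := Euler_total (Some t); have E0 := Euler_total None.
rewrite setC0 /= in E0.
have cl : closed [set center t].
  by apply: accessible_closed_set1; exact: hausdorff_accessible.
have EW : Euler R x0 (U `|` ~` [set center t]) (0 + (1 - \sum_(s | ~~ face_of t s) (-1) ^+ cell_dim s) - (-1) ^+ n).
  apply: Euler_union EI EU Et => y.
    by move=> Uy; apply: filterS (open_nbhs_nbhs (conj oU Uy)) => z Uz _.
  by move=> ny; apply: filterS (near_notin cl ny) => z nz _.
have eW : U `|` ~` [set center t] = setT.
  by apply/seteqP; split=> y // _; have [->|ny] := pselect (y = center t); [left | right].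
rewrite eW in EW; have := Euler_eq E0 EW; rewrite (bigID (fun s => face_of t s)) /=.
by set a := \sum_(s | face_of t s) _; set b := \sum_(s | _) _; lia.
Qed.

End Manifold.
End Cells.

(** * The dimension of the complex *)

Section Dimension.
Variables (R : realType) (M : topologicalType) (Om : regular_cell_complex R M) (x0 : M).
Variables (n : nat).
Hypothesis locally_euclidean : forall x : M, exists U : set M,
  [/\ open U, U x & homeomorphic (set_type U) 'rV[R]_n].

Lemma top_cell_open (s : Om) : (forall t : Om, (cell_dim t <= cell_dim s)%N) -> open (cell s).
Proof.
move=> smax.
have dJ : downset ([set: Om] :\ s).
  move=> u t; rewrite !inE !andbT => us tu; apply/eqP => ts.
  have [tu'|] := face_of_dim tu; first by move: us; rewrite -tu' ts eqxx.
  by rewrite ts ltnNge smax.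
have <- : ~` realization ([set: Om] :\ s) = cell s; last exact/closed_openC/realization_closed.
apply/seteqP; split=> y; last first.
  by move=> sy [u]; rewrite !inE andbT => /eqP us uy; apply: us; exact: cell_inj uy sy.
move=> ny; have : [set: M] y by [].
rewrite -(cell_cover Om) => -[u _ uy]; suff <- : u = s by [].
by apply: contrapT => /eqP us; apply: ny; exists u => //; rewrite !inE us.
Qed.

(* Nested neighbourhoods: the punctured chart can be pushed into a punctured
   ball of the cell, so its top class survives there. *)
Lemma top_cell_dim (s : Om) : (forall t : Om, (cell_dim t <= cell_dim s)%N) -> cell_dim s = n.
Proof.
move=> smax; pose p := center x0 s; have sp : cell s p by exact: center_cell.
have [[cFs cGs] FBs GCs [GFs FGs] cEs] := chartP x0 s.
set Fs := (chart x0 s).1 in cFs FBs GFs FGs cEs *.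
set Gs := (chart x0 s).2 in cGs GCs GFs FGs *.
have Gs0 : Gs 0 = p by [].
have h0 : sqn (0 : 'rV[R]_(cell_dim s)) <= 1 by rewrite sqn0.
have Fsp : Fs p = 0 by rewrite -Gs0 FGs.
have [U [F [G [[oU Up] [cF cG] GU [GF FG] Fp]]]] := manifold_chart locally_euclidean p.
have G0 : G 0 = p by rewrite -Fp GF.
(* [e] bounds the squared Euclidean norm, whereas the neighbourhood is a sup-norm ball of radius
   [r]. Taking e = q^2 with q at most r/2 passes from one to the other, and q at most 1 stays within
   the chart of the cell. *)
have [e [e0 e1 eU]] : exists e : R, [/\ 0 < e, e <= 1 & forall b, sqn b < e -> U (Gs b)].
  have nU : nbhs (Gs 0) U by rewrite Gs0; apply: open_nbhs_nbhs.
  move/conP: cGs => /(_ 0 h0 _ nU) /near_row [r r0 hr].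
  pose q := Num.min 1 (r / 2).
  have q0 : 0 < q by rewrite lt_min ltr01 divr_gt0.
  have q1 : q <= 1 by rewrite ge_min lexx.
  have qr : q <= r / 2 by rewrite ge_min lexx orbT.
  exists (q ^+ 2); split=> [||b hb]; rewrite ?exprn_gt0 ?expr_le1 ?(ltW q0)//.
  have hb1 : sqn b < 1 by apply: lt_le_trans hb _; rewrite expr_le1 ?(ltW q0).
  apply: hr; last exact: ltW.
  rewrite sub0r normrN; apply: (@le_lt_trans _ _ q); last first.
    by apply: le_lt_trans qr _; rewrite ltr_pdivrMr// ltr_pMr// ltr1n.
  apply: norm_row_le => [|j]; first exact: ltW.
  rewrite -(@ler_pXn2r _ 2) ?nnegrE ?(ltW q0)// real_normK ?num_real//.
  apply: le_trans (ltW hb); rewrite /sqn (bigD1 j)//= lerDl.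
  by apply: sumr_ge0 => i _; exact: sqr_ge0.
pose S := [set y | closure (cell s) y /\ sqn (Fs y) < e].
have SU y : S y -> U y by move=> [Cy /eU]; rewrite GFs.
have nS : \forall y \near p, S y.
  have oS := @top_cell_open s smax.
  have Cp : closure (cell s) p by exact: subset_closure.
  have n1 : \forall y \near p, cell s y by apply: open_nbhs_nbhs.
  have n2 : \forall y \near p, closure (cell s) y -> sqn (Fs y) < e.
    have cs : con (closure (cell s)) (@sqn R _ \o Fs).
      apply: (con_comp (B := setT) cFs) => //; apply: con_continuous.
      exact: sqn_continuous.
    move/conP: cs => /(_ p Cp [set r | r < e]); apply.
    by rewrite /= Fsp sqn0; exact: lt_nbhsl.
  apply: filterS2 n1 n2 => y sy h.
  by have Cy : closure (cell s) y by [exact: subset_closure]; split=> //; exact: h.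
have [d d0 dS] : exists2 d : R, 0 < d & forall v, `|v| < d -> S (G v).
  move/conP: cG => /(_ 0 I S); rewrite G0 => /(_ nS) /near_row [d d0 hd].
  by exists d => // v hv; apply: hd => //; rewrite sub0r normrN.
have GSp v : v <> 0 -> G v <> p by move=> v0 e'; apply: v0; rewrite -(FG v) e' Fp.
have dimU : Hdim R x0 (U `\ p) n 1.
  have := @Hdim_punctured_space R n 0 n; rewrite eqxx.
  apply: (@Hdim_homeo R _ _ (0 : 'rV[R]_n) x0 [set~ 0] _ G F).
  - exact: con_sub cG.
  - by move=> v v0; split=> //; exact: GSp.
  - by apply: con_sub cF => y [].
  - by move=> y [Uy yt] Fy; apply: yt; rewrite /= -(GF _ Uy) Fy.
  - by [].
  - by move=> y [Uy _]; exact: GF.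
have dimS : Hdim R x0 (S `\ p) n (n == cell_dim s).
  have := @Hdim_punctured_ball R (cell_dim s) 0 n e e0.
  have he b : sqn b < e -> sqn b <= 1 by move=> /ltW h; exact: le_trans h e1.
  apply: (@Hdim_homeo R _ _ (0 : 'rV[R]_(cell_dim s)) x0 _ _ Gs Fs).
  - by apply: con_sub cGs => b [/he].
  - move=> b [hb b0]; split; first by split; [exact/GCs/he | rewrite FGs//; exact: he].
    by move=> e'; apply: b0; rewrite /= -(FGs b) ?e'//; exact: he.
  - by apply: con_sub cFs => y [[]].
  - move=> y [[Cy hy] yp]; split=> // Fy; apply: yp; by rewrite /= -(GFs _ Cy) Fy.
  - by move=> b [/he /FGs].
  - by move=> y [[/GFs]].
apply: contrapT => /eqP; rewrite eq_sym => nk.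
(* If the dimensions differed, [S] without [p] would have no class in index [n]; pushing every cycle
   of the punctured chart into it would then contradict [dimU]. *)
have := dimS; rewrite (negPf nk) => /(hdim0P (sing_sub R x0 _)) acyc.
suff dimU0 : Hdim R x0 (U `\ p) n 0 by have := hdim_inj (sing_sub R x0 (U `\ p)) dimU dimU0.
apply/(hdim0P (sing_sub R x0 _)) => c hc.
(* At time 1 a chart point v is scaled by d / (1 + |v|), so its norm falls below [d] and it lands in
   [S]. The factor stays positive, so the puncture is never hit. *)
pose H (q : M * R) := G ((1 - q.2 + q.2 * (d / (1 + `|F q.1|))) *: F q.1).
have n1 (v : 'rV[R]_n) : 0 < 1 + `|v| by rewrite ltr_pwDl.
have lam0 q : 0 <= q.2 <= 1 -> 0 < 1 - q.2 + q.2 * (d / (1 + `|F q.1|)).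
  case: q => y t /= /andP[t0 t1]; have [->|tn0] := eqVneq t 0; first by rewrite subr0 mul0r addr0.
  apply: ltr_wpDl; first by rewrite subr_ge0.
  by rewrite mulr_gt0 ?divr_gt0// lt_neqAle eq_sym tn0.
have cH : con ((U `\ p) `*` [set t : R | 0 <= t <= 1]) H.
  have cFq : con ((U `\ p) `*` [set t : R | 0 <= t <= 1]) (fun q => F q.1).
    apply: (con_comp (f := fst) (B := U) (g := F)) => //; first exact: con_fst.
    by move=> q [[]].
  have csnd := @con_snd M R (U `\ p) [set t : R | 0 <= t <= 1].
  apply: (con_comp (B := setT) (g := G)) => //; apply: conZ => //.
  apply: (@conD _ _ _ R^o); first by apply: (@conB _ _ _ R^o) => //; exact: con_cst.
  apply: conM => //; apply: conM; first exact: con_cst.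
  apply: conV => [|q _]; last by rewrite gt_eqF.
  apply: (@conD _ _ _ R^o); first exact: con_cst.
  apply: (con_comp (B := setT) (g := fun v : 'rV[R]_n => `|v|) cFq) => //.
  by apply: con_continuous; exact: norm_continuous.
have F0 y : (U `\ p) y -> F y <> 0.
  by move=> [Uy yp] Fy; apply: yp; rewrite /= -(GF _ Uy) Fy.
have HU q : ((U `\ p) `*` [set t : R | 0 <= t <= 1]) q -> (U `\ p) (H q).
  move=> [Uq tq]; split; first exact: GU.
  move=> Hq; apply: (GSp _ _ Hq) => /eqP.
  by rewrite scaler_eq0 gt_eqF ?lam0//= => /eqP; exact: F0.
have HS y : (U `\ p) y -> (S `\ p) (H (y, 1)).
  move=> Uy; have h01 : 0 <= (1 : R) <= 1 by rewrite ler01 lexx.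
  have [_ Hp] := HU (y, 1) (conj Uy h01); split=> //.
  apply: dS; rewrite /= subrr add0r mul1r normrZ ger0_norm ?divr_ge0 ?(ltW d0) ?(ltW (n1 _))//.
  by rewrite mulrAC ltr_pdivrMr// ltr_pM2l// ltrDr.
have cH1 : con (U `\ p) (fun y => H (y, 1)).
  apply: (con_comp (f := fun y => (y, 1)) (B := (U `\ p) `*` [set t : R | 0 <= t <= 1])) cH.
    by apply: con_pair; [exact: con_id | exact: con_cst].
  by move=> y Uy; split=> //=; rewrite ler01 lexx.
have H0 y : (U `\ p) y -> H (y, 0) = y.
  by move=> [Uy _]; rewrite /H /= subr0 mul0r addr0 scale1r GF.
have := homotopy_bnd x0 cH HU hc.
rewrite (chain_push_id (f := fun y => H (y, 0)) H0 hc.1) => hb.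
have hB := bnd_mod (sing_sub R x0 (U `\ p)) n.
rewrite -(subKr (chain_push x0 (fun y => H (y, 1)) c) c); apply: submodB hb => //.
have /acyc [b sb <-] := cyc_push x0 cH1 HS hc.
by exists b => //; apply: sing_mono sb => y [/SU].
Qed.

Lemma complex_dimE : complex_dim Om = n.
Proof.
have : [set: M] x0 by []; rewrite -(cell_cover Om) => -[s0 _ _].
have [s _ smax] := @arg_maxnP _ s0 xpredT (fun s : Om => cell_dim s) isT.
have {}smax (t : Om) : (cell_dim t <= cell_dim s)%N by have /= := smax t isT.
rewrite -(top_cell_dim smax); apply/eqP; rewrite eqn_leq; apply/andP; split.
  by apply/bigmax_leqP => t _.
exact: (leq_bigmax_cond (F := fun s : Om => cell_dim s)).
Qed.

End Dimension.

(** * Betti numbers *)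

Section Transfer.
Variables (R : realType) (M : topologicalType) (x0 : M).
Local Notation sC := (sing_chain R M).
Local Notation sing_all := (sing (R := R) x0 [set: M]).
Local Notation bdX := (@sing_bd R M).

Definition extend k (s : sing_simplex R M k) : 'rV[R]_k.+1 -> M := fun x =>
  match pselect (Simplex x) with
  | left p => s (exist _ x (mem_set p))
  | right _ => x0
  end.

Lemma extendE k (s : sing_simplex R M k) x : extend s (set_val x) = s x.
Proof.
rewrite /extend; case: pselect => [p|]; last by case; exact: set_mem (svalP x).
by congr (s _); apply: val_inj.
Qed.

Lemma extend_out k (s : sing_simplex R M k) x : ~ Simplex x -> extend s x = x0.
Proof. by rewrite /extend; case: pselect. Qed.

Lemma extend_inj k : injective (@extend k).
Proof.
move=> s t e; apply/continuousEP => x.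
by rewrite -!extendE e.
Qed.

Lemma extend_good k (s : sing_simplex R M k) : good x0 [set: M] (extend s).
Proof.
split=> //; last by move=> x; exact: extend_out.
by apply: con_of_set_type (@cts_fun _ _ s) _ => x; rewrite extendE.
Qed.

Lemma extend_surj k (t : 'rV[R]_k.+1 -> M) : good x0 [set: M] t ->
  exists s : sing_simplex R M k, extend s = t.
Proof.
move=> [/conP ct _ t0].
have ct' : continuous (fun x : set_type (@std_simplex R k) => t (set_val x)).
  move=> x V hV; have hx : Simplex (set_val x) by exact: set_mem (svalP x).
  have hn : \forall y \near x, Simplex (set_val y) -> V (t (set_val y)).
    exact: (@initial_continuous _ _ (set_val : set_type (@std_simplex R k) -> _) x _ (ct _ hx _ hV)).
  suff : \forall y \near x, V (t (set_val y)) by [].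
  by apply: filterS hn => y; apply; exact: set_mem (svalP y).
exists (mkcts ct'); apply/funext => x; rewrite /extend; case: pselect => // nx.
by rewrite t0.
Qed.

Lemma extend_face k (i : 'I_k.+2) (s : sing_simplex R M k.+1) :
  extend (sing_face i s) = simp_face i (extend s).
Proof.
apply/funext => x; rewrite /simp_face /=.
have [hx|nx] := pselect (Simplex x); last by rewrite !extend_out// => /Simplex_ins.
pose x' : set_type (@std_simplex R k) := exist _ x (mem_set hx).
by rewrite -[x]/(set_val x') extendE -[ins i _]/(set_val (face_map i x')) extendE.
Qed.

(** The given singular chains are indexed by dimension and the ones used here by the number of
    vertices; hence the shift by one. *)
Definition iota_chain k : sC k -> chain R M k.+1 := lin (fun s => gen (extend s)).
HB.instance Definition _ k := GRing.Linear.on (@iota_chain k).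

Lemma iota_coeff k (c : sC k) s : mcoeff (extend s) (iota_chain c) = mcoeff s c.
Proof.
apply: (supp_ind (P := fun=> True)
  (A := fun c : sC k => mcoeff (extend s) (iota_chain c) = mcoeff s c)) => //.
  split=> [|a u v hu hv]; first by rewrite linear0 !mcoeff0.
  by rewrite linearP !mcoeffD !mcoeffZ /= hu hv.
move=> t _; rewrite /iota_chain lin_gen !mcoeffU; congr (_ *+ nat_of_bool _).
by apply/eqP/eqP => [/extend_inj|->].
Qed.

Lemma iota_inj k (c c' : sC k) : iota_chain c = iota_chain c' -> c = c'.
Proof. by move=> e; apply/malgP => s; rewrite -!iota_coeff e. Qed.

Lemma iota_sing k (c : sC k) : sing_all (iota_chain c).
Proof.
apply: (supp_lin (P := fun=> True)) => // s _; apply: supp_gen; exact: extend_good.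
Qed.

Lemma iota_surj k (c : chain R M k.+1) : sing_all c -> exists c', iota_chain c' = c.
Proof.
apply: (supp_ind (A := fun c : chain R M k.+1 => exists c', iota_chain c' = c)).
  split=> [|a _ _ [u <-] [v <-]]; first by exists 0; rewrite linear0.
  by exists (a *: u + v); rewrite linearP.
by move=> t /extend_surj [s <-]; exists (gen s); rewrite /iota_chain lin_gen.
Qed.

Lemma iota_bd k (c : sC k.+1) : iota_chain (sing_boundary c) = simp_bd (iota_chain c).
Proof.
pose f : {linear sC k.+1 -> sC k} :=
  lin (fun s => \sum_(i < k.+2) ((-1) ^+ i : rat) *: (gen (sing_face i s) : sC k)).
have -> : sing_boundary c = f c by [].
apply: (lin_eq (f := @iota_chain k \o f) (g := @simp_bd R M k.+1 \o @iota_chain k.+1)) => s /=.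
rewrite /f /iota_chain !lin_gen /simp_bd bdry_gen linear_sum; apply: eq_bigr => i _.
by rewrite linearZ /= lin_gen extend_face.
Qed.

Lemma is_boundary_iota k (c : sC k) : is_boundary c <-> bnd bdX sing_all (iota_chain c).
Proof.
split=> [[b <-]|[b /iota_surj [b' <-]]].
  by exists (iota_chain b); [exact: iota_sing | rewrite iota_bd].
by rewrite /sing_bd /= -iota_bd => /iota_inj <-; exists b'.
Qed.

Lemma is_boundary_mod k : submod (@is_boundary R M k).
Proof.
have hB := bnd_mod (sing_sub R x0 [set: M]) k.+1.
split=> [|a u v]; first by apply/is_boundary_iota; rewrite linear0; exact: hB.1.
by move=> /is_boundary_iota hu /is_boundary_iota hv; apply/is_boundary_iota; rewrite linearP; exact: hB.2.
Qed.

Lemma is_cycle_mod k : submod (@is_cycle R M k).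
Proof.
case: k => [|k] //=; split=> [|a u v] /=.
  by apply: iota_inj; rewrite iota_bd !linear0.
move=> hu hv; apply: iota_inj; rewrite iota_bd !linearP /= -!iota_bd hu hv.
by rewrite !linear0 ?scaler0 ?addr0.
Qed.

(** [Z] is a parameter because without augmentation every chain of degree 0 is a cycle, while in
    higher degrees the two notions of cycle agree. *)
Lemma sqdim_iota k (Z : chain R M k.+1 -> Prop) m : submod Z ->
  (forall c, Z c -> sing_all c) -> (forall c, is_cycle c <-> Z (iota_chain c)) ->
  sqdim Z (bnd bdX sing_all (n := k.+1)) m -> sqdim (@is_cycle R M k) (@is_boundary R M k) m.
Proof.
move=> hZ Zs ZE.
apply: (sqdim_rel (L := fun (c : chain R M k.+1) (c' : sC k) => iota_chain c' = c) hZ (@is_cycle_mod k)).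
- by rewrite linear0.
- by move=> a u v u' v' <- <-; rewrite linearP.
- by move=> z hz; have [c' e] := iota_surj (Zs _ hz); exists c' => //; apply/ZE; rewrite e.
- by move=> c' /ZE hc; exists (iota_chain c').
- by move=> z c' _ _ <-; apply: iff_sym; exact: is_boundary_iota.
Qed.

Lemma bettiE k m : sqdim (@is_cycle R M k) (@is_boundary R M k) m -> betti R M k = m.
Proof.
move=> d; apply: (sqdim_inj (@is_boundary_mod k) _ d).
have ex : exists m, [set m | exists z : 'I_m -> sC k, is_homology_basis z] m.
  by have [z hz] := d; exists m, z.
exact: (xgetPex 0%N ex).
Qed.

Lemma betti_pos k m : Hdim R x0 [set: M] k.+2 m -> betti R M k.+1 = m.
Proof.
move=> d; apply: bettiE; apply: sqdim_iota d.
- exact: cyc_mod (sing_sub R x0 [set: M]) _.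
- by move=> c [].
move=> c; split=> [h|[_ h]]; last by apply: iota_inj; rewrite iota_bd (h : simp_bd _ = 0) linear0.
split; first exact: iota_sing.
by rewrite /= /sing_bd /= -iota_bd (h : sing_boundary c = 0) linear0.
Qed.

(** Dropping the augmentation adds one class, that of a constant simplex [e1]: its augmentation [e0]
    spans index 0. *)
Lemma betti_zero m : Hdim R x0 [set: M] 1 m -> betti R M 0 = (m + 1)%N.
Proof.
move=> d; apply: bettiE; apply: (sqdim_iota (Z := sing_all (n := 1))) => //.
- exact: supp_mod.
- by move=> c; split=> // _; exact: iota_sing.
have hs := sing_sub R x0 [set: M].
pose e0 := gen (@const_simplex R M x0 x0 0); pose e1 := gen (@const_simplex R M x0 x0 1).
have be : bdX 0 e1 = e0 by rewrite /sing_bd /= bd_const scale1r.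
have s1 : sing_all e1.
  by apply: supp_gen; have [? _ ?] := @good_const R M x0 x0 1; split.
apply: (sqdim_cat (Y := cyc bdX sing_all (n := 1))) d _.
- exact: bnd_mod hs _.
- exact: cyc_mod hs _.
- exact: supp_mod.
- by move=> c; exact: (bnd_cyc (@simp_bd_bd R M) hs).
- by move=> c [].
exists (fun=> e1); split=> // [a|c sc].
  rewrite big_ord1 => -[_ /=]; rewrite linearZ be => /(congr1 (mcoeff (@const_simplex R M x0 x0 0))).
  by rewrite mcoeffZ mcoeffU eqxx mulr1 mcoeff0 => h i; rewrite ord1.
have [l hl] : exists l : rat, bdX 0 c = l *: e0.
  have : sing_all (bdX 0 c) by exact: hs.2.
  apply: (supp_ind (A := fun c0 : chain R M 0 => exists l : rat, c0 = l *: e0)).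
    split=> [|a _ _ [l ->] [l' ->]]; first by exists 0; rewrite scale0r.
    by exists (a * l + l'); rewrite scalerDl scalerA.
  move=> t [_ _ t0]; exists 1; rewrite scale1r; congr gen; apply/funext => x.
  by rewrite t0 ?/const_simplex ?cut_out//; exact: Simplex0.
exists (fun=> l); rewrite big_ord1; split; first by apply: (submodB (supp_mod _)) => //; exact: (submodZ (supp_mod _)).
by rewrite /= linearB linearZ be hl subrr.
Qed.

Lemma Hdim_nonempty0 : Hdim R x0 [set: M] 0 0.
Proof.
have hs := sing_sub R x0 [set: M].
apply/(hdim0P hs) => c [sc _]; have hB := bnd_mod hs 0.
move: sc; apply: supp_ind => // t [_ _ t0].
exists (gen (@const_simplex R M x0 x0 1)).
  by apply: supp_gen; have [? _ ?] := @good_const R M x0 x0 1; split.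
rewrite /sing_bd /= bd_const scale1r; congr gen; apply/funext => x.
by rewrite t0 ?/const_simplex ?cut_out//; exact: Simplex0.
Qed.

(** The shift of index reverses all signs, and the additional class of degree 0 gives the summand 1.
    Index 0 itself contributes nothing, since [x0] makes the space nonempty. *)
Lemma euler_charE e : Euler R x0 [set: M] e -> euler_char R M = 1 - e.
Proof.
move=> [b [N [hb b0 <-]]].
have b00 : b 0%N = 0%N by exact: (hdim_inj (sing_sub R x0 _) (hb 0%N) Hdim_nonempty0).
have bk k : betti R M k = (b k.+1 + (k == 0%N))%N.
  by case: k => [|k]; [exact: betti_zero (hb 1%N) | rewrite addn0; exact: betti_pos (hb k.+2)].
rewrite /euler_char -(@fsbig_widen _ _ _ _ `I_N.+1 [set: nat]) //; last first.
  move=> k [_ /= kN]; rewrite bk b0; last by rewrite leqW//; lia.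
  by rewrite gtn_eqF ?mulr0//; lia.
rewrite -fsbig_ord -(euler_widen (N' := N.+2) _ b0); last by rewrite leqW.
rewrite [in RHS]big_ord_recl b00 mulr0 add0r.
under eq_bigr do rewrite bk PoszD mulrDr.
rewrite big_split /= addrC; congr (_ + _).
  by rewrite big_ord_recl /= mulr1 big1 ?addr0// => i _; rewrite mulr0.
rewrite -sumrN; apply: eq_bigr => i _.
by rewrite /bump add1n exprS mulN1r mulNr opprK.
Qed.


End Transfer.

(** * Generalized Dehn-Sommerville relations and the cd-index *)

Section Words.
Variables (T : nzRingType) (x y : T).

(* A word is a sequence of booleans; [true] marks the ranks in the set. *)
Definition letter (l : bool) : T := if l then y else x.

Fixpoint word_sum N (f : seq bool -> int) : T :=
  if N is N'.+1 then
    x * word_sum N' (fun w => f (false :: w)) + y * word_sum N' (fun w => f (true :: w))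
  else (f [::])%:~R.

Lemma eq_word_sum N f g : (forall w, size w = N -> f w = g w) -> word_sum N f = word_sum N g.
Proof.
elim: N f g => [|N IH] f g fg /=; first by rewrite fg.
by congr (_ * _ + _ * _); apply: IH => w sw; apply: fg; rewrite /= sw.
Qed.

Lemma word_sumD N f g : word_sum N (fun w => f w + g w) = word_sum N f + word_sum N g.
Proof.
elim: N f g => [|N IH] f g /=; first by rewrite rmorphD.
by rewrite !IH !mulrDr addrACA.
Qed.

Lemma word_sum2 N f : word_sum N (fun w => 2 * f w) = word_sum N f *+ 2.
Proof.
rewrite -(@eq_word_sum N (fun w => f w + f w)) ?word_sumD// => w _.
by rewrite mulr2n mulrDl !mul1r || ring.
Qed.

Lemma word_sum0 N : word_sum N (fun=> 0) = 0.
Proof. by elim: N => //= N ->; rewrite !mulr0 addr0. Qed.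

Lemma word_sum_pow N : word_sum N (fun w => 2 ^+ count id w) = (x + y *+ 2) ^+ N.
Proof.
elim: N => [|N IH] /=; first by rewrite expr0.
rewrite (@eq_word_sum N (fun w => 2 ^+ (false + count id w)) (fun w => 2 ^+ count id w)) //.
rewrite (@eq_word_sum N (fun w => 2 ^+ (true + count id w)) (fun w => 2 * 2 ^+ count id w));
  last by move=> w _; rewrite exprS.
by rewrite word_sum2 !IH exprS mulrDl mulrnAr mulrnAl.
Qed.

Lemma word_sum_empty N : word_sum N (fun w => (~~ has id w)%:R) = x ^+ N.
Proof.
elim: N => [|N IH] /=; first by rewrite expr0.
by rewrite IH word_sum0 mulr0 addr0 exprS.
Qed.

Lemma big_tuple_cons (S : finType) (V : nmodType) k (Q : pred (seq S)) (F : seq S -> V) :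
  \sum_(w : k.+1.-tuple S | Q w) F w =
  \sum_(z : S) \sum_(w : k.-tuple S | Q (z :: w)) F (z :: w).
Proof.
rewrite pair_big_dep /=.
rewrite (reindex (fun p : S * k.-tuple S => [tuple of p.1 :: p.2])) //=.
exists (fun w : k.+1.-tuple S => (thead w, [tuple of behead w])) => [[z w] _|w _] /=.
  by congr (_, _); apply: val_inj.
by rewrite [RHS]tuple_eta; apply: val_inj.
Qed.

Lemma word_sumE N f :
  word_sum N f = \sum_(w : N.-tuple bool) (\prod_(l <- w) letter l) *~ f w.
Proof.
elim: N f => [|N IH] f.
  rewrite (big_pred1 [tuple]) => [|w]; last by apply/esym/eqP; exact: tuple0.
  by rewrite /= big_nil.
rewrite (@big_tuple_cons _ _ N xpredT (fun w => (\prod_(l <- w) letter l) *~ f w)) /=.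
rewrite big_bool /= addrC !IH !mulr_sumr; congr (_ + _); apply: eq_bigr => w _;
by rewrite big_cons mulrzAr.
Qed.

End Words.

(** The middle block is a maximal gap of [m] unmarked ranks: [u] is empty or ends with a marked
    rank, and [v] is empty or starts with one. The left side inserts a single rank into the gap in
    all possible ways. *)
Definition gds N (f : seq bool -> int) : Prop :=
  forall u m v, (size u + m + size v)%N = N -> last true u -> head true v ->
  \sum_(p < m) (-1) ^+ p * f (u ++ nseq p false ++ true :: nseq (m - p.+1) false ++ v) =
  (1 - (-1) ^+ m) * f (u ++ nseq m false ++ v).

(** Both tails come from solving f = c f1 + d f2 by first letters. The part after x is f1 + y f2,
    and the part after y is twice that plus x f2. Hence the words starting with y x determine f2,
    and then those starting with x determine f1. *)
Definition cd_tail2 (f : seq bool -> int) (w : seq bool) : int :=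
  f [:: true, false & w] - 2 * f [:: false, false & w].

Definition cd_tail1 (f : seq bool -> int) (w : seq bool) : int :=
  f (false :: w) - (if w is true :: w' then cd_tail2 f w' else 0).

Lemma sign_cases m : (-1) ^+ m = 1 :> int \/ (-1) ^+ m = -1 :> int.
Proof. by rewrite -signr_odd; case: odd; [right | left]. Qed.

Lemma gds_step N f m v : gds N f -> m.+1 + size v = N -> head true v ->
  \sum_(p < m) (-1) ^+ p * f (false :: nseq p false ++ true :: nseq (m - p.+1) false ++ v) =
  f (true :: nseq m false ++ v) - (1 + (-1) ^+ m) * f (nseq m.+1 false ++ v).
Proof.
move=> hf sN hv; have := hf [::] m.+1 v sN isT hv.
rewrite big_ord_recl expr0 mul1r subn1 /= => h.
have {h} : f (true :: nseq m false ++ v) - \sum_(p < m) (-1) ^+ p *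
    f (false :: nseq p false ++ true :: nseq (m - p.+1) false ++ v) =
    (1 - (-1) ^+ m.+1) * f (false :: nseq m false ++ v).
  rewrite -[RHS]h; congr (_ + _); rewrite -sumrN; apply: eq_bigr => p _.
  by rewrite /bump add1n exprS mulN1r mulNr subSS.
by rewrite exprS; case: (sign_cases m) => -> /=; lia.
Qed.

(** With a nonempty prefix the relation is a difference of two relations for [f] with two more
    letters in front. With an empty prefix the added letters become part of the gap, and three
    relations for [f] have to be combined. *)
Lemma gds_tail2 N f : gds N.+2 f -> gds N (cd_tail2 f).
Proof.
move=> hf [|c u] m v sN hu hv; last first.
  have hl b : last true [:: b, false, c & u] by [].
  have h1 := hf [:: true, false, c & u] m v; have h2 := hf [:: false, false, c & u] m v.
  rewrite /= in h1 h2 sN hu.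
  rewrite /cd_tail2 /=; under eq_bigr do rewrite mulrBr mulrCA.
  by rewrite sumrB -mulr_sumr h1 ?h2// ?addSn ?sN//; lia.
(* [R1] has prefix y and a gap of m + 1, [R2] has the whole initial gap of m + 2, and [R3] is a gap
   of length 1 before a marked rank. [R3] eliminates the words starting with two marked ranks. *)
have s2 : (size v + m)%N = N by move: sN; rewrite /= add0n addnC.
have R1 := hf [:: true] m.+1 v; rewrite /= in R1.
have {R1} := R1 _ isT hv; rewrite big_ord_recl expr0 mul1r subn1 /= => R1.
have R2 := hf [::] m.+2 v; rewrite /= in R2.
have {R2} := R2 _ isT hv; rewrite !big_ord_recl !expr0 !mul1r /= => R2.
have R3 := hf [::] 1%N (true :: nseq m false ++ v); rewrite /= in R3.
have {R3} := R3 _ isT isT; rewrite big_ord1 expr0 mul1r expr1 /= => R3.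
rewrite /cd_tail2 /=; under eq_bigr do rewrite mulrBr mulrCA.
rewrite sumrB -mulr_sumr.
set A := \sum_(p < m) _; set B := \sum_(p < m) _.
have {}R1 : f [:: true, true & nseq m false ++ v] - A =
    (1 + (-1) ^+ m) * f [:: true, false & nseq m false ++ v].
  have := R1 _; rewrite exprS mulN1r opprK => <-; last by rewrite add1n; lia.
  congr (_ + _); rewrite -sumrN; apply: eq_bigr => p _.
  by rewrite /bump add1n exprS mulN1r mulNr subSS.
have {}R2 : f [:: true, false & nseq m false ++ v] - f [:: false, true & nseq m false ++ v] + B =
    (1 - (-1) ^+ m) * f [:: false, false & nseq m false ++ v].
  have := R2 _; rewrite !exprS !mulN1r opprK => <-; last by lia.
  rewrite -addrA; congr (_ + (_ + _)).
    by rewrite /bump /= subSS subn1.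
  apply: eq_bigr => p _; rewrite /bump /= !add1n !exprS !mulN1r opprK !subSS.
  by [].
have {}R3 : f [:: true, true & nseq m false ++ v] = 2 * f [:: false, true & nseq m false ++ v].
  by rewrite R3 //= size_cat size_nseq; lia.
by case: (sign_cases m) R1 R2 => -> R1 R2; lia.
Qed.

Lemma gds_tail1 N f : gds N.+1 f -> gds N (cd_tail1 f).
Proof.
move=> hf [|[] u] m v sN hu hv.
- case: m sN => [|m] sN; first by rewrite big_ord0 expr0 subrr mul0r.
  pose S := \sum_(p < m.+1) (-1) ^+ p *
    f (false :: nseq p false ++ true :: nseq (m.+1 - p.+1) false ++ v).
  have R : S = _ := @gds_step N.+1 f m.+1 v hf _ hv.
  (* Only the insertion at p = 0 makes the word start with a marked rank, so the correction by
     [cd_tail2] enters exactly once. *)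
  have -> : \sum_(p < m.+1) (-1) ^+ p *
      cd_tail1 f ([::] ++ nseq p false ++ true :: nseq (m.+1 - p.+1) false ++ v) =
      S - cd_tail2 f (nseq m false ++ v).
    rewrite /S !big_ord_recl !expr0 !mul1r [RHS]addrAC; congr (_ + _).
      have -> : (m.+1 - (@ord0 m).+1 = m)%N by rewrite /= subn1.
      by [].
    by apply: eq_bigr => p _; rewrite /cd_tail1 /= subr0.
  rewrite R; last by move: sN => /=; lia.
  rewrite /cd_tail1 /cd_tail2 /= exprS.
  by case: (sign_cases m) => ->; lia.
- case: N hf sN => [|N] hf //= sN.
  have h1 := hf [:: false, true & u] m v; have h2 := gds_tail2 hf (u := u) (m := m) (v := v).
  rewrite /= in h1 hu; rewrite /cd_tail1 /=; under eq_bigr do rewrite mulrBr.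
  by rewrite sumrB h1 ?h2//; lia.
- have h1 := hf [:: false, false & u] m v; rewrite /= in h1 hu sN.
  rewrite /cd_tail1 /= subr0; under eq_bigr do rewrite subr0.
  by rewrite h1//; lia.
Qed.

Lemma cd_ring_identity (T : nzRingType) (x y g1 g2 : T) :
  (x + y *+ 2) * g1 + (x * y + y * x + (y * y) *+ 2) * g2 =
  x * (g1 + y * g2) + y * ((g1 + y * g2) *+ 2 + x * g2).
Proof.
rewrite [(x + _) * g1]mulrDl [(_ + _ *+ 2) * g2]mulrDl [(x * y + y * x) * g2]mulrDl.
rewrite [x * (g1 + _)]mulrDr [y * (_ + x * g2)]mulrDr mulrnAr [y * (g1 + _)]mulrDr.
rewrite mulrnDl !mulrnAl !mulrA; set p := x * g1; set q := _ *+ 2; set t := _ *+ 2.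
set r := x * y * g2; set s := y * x * g2.
by rewrite [RHS]addrACA [r + s + t]addrC [LHS]addrA [p + (q + t)]addrA.
Qed.

Lemma nc_dE (A : nzRingType) : nc_d A =
  (nc_a A - nc_b A) * nc_b A + nc_b A * (nc_a A - nc_b A) + (nc_b A * nc_b A) *+ 2.
Proof.
rewrite mulrBl mulrBr mulr2n.
have -> (u v w : ncpoly A) : u - w + (v - w) = u + v - (w + w) by rewrite addrACA -opprD.
by rewrite subrK.
Qed.


Fixpoint cd_list N (f : seq bool -> int) : seq (int * seq bool) :=
  match N with
  | 0 => [:: (f [::], [::])]
  | N1.+1 => [seq (p.1, false :: p.2) | p <- cd_list N1 (cd_tail1 f)] ++
      (if N1 is N2.+1 then [seq (p.1, true :: p.2) | p <- cd_list N2 (cd_tail2 f)] else [::])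
  end.

Lemma cd_list_degree N f p : p \in cd_list N f -> \sum_(l <- p.2) (if l then 2 else 1)%N = N.
Proof.
have [k] := ubnP N; elim: k N f p => // k IH [|N] f p; rewrite ltnS => Nk.
  by rewrite /= inE => /eqP ->; rewrite big_nil.
rewrite [cd_list _ _]/= mem_cat => /orP[/mapP[q hq ->]|]; first by rewrite big_cons (IH _ _ _ _ hq).
case: N Nk => // N Nk /mapP[q hq ->]; rewrite big_cons (IH _ _ _ _ hq) //.
exact: ltnW.
Qed.

(** Only the branch dividing by c at every step reaches this word, and [cd_tail1] keeps the value at
    the word without marked ranks. *)
Lemma cd_list_c N f :
  \sum_(p <- cd_list N f) p.1 *+ (p.2 == nseq N false) = f (nseq N false).
Proof.
elim: N f => [|N IH] f; first by rewrite big_seq1.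
rewrite [cd_list _ _]/= big_cat /= big_map [X in _ + X](_ : _ = 0) ?addr0; last first.
  by case: N {IH} => [|N]; rewrite ?big_nil// big_map big1.
rewrite -[RHS](_ : cd_tail1 f (nseq N false) = _) ?IH //.
by case: N {IH} => [|N]; rewrite /cd_tail1 /= subr0.
Qed.

Definition cd_poly N f : ncpoly int :=
  \sum_(p <- cd_list N f) mkmalgU (FMonom p.2) p.1.

Lemma cd_poly_coeff N f (w : fmonom bool) :
  mcoeff w (cd_poly N f) = \sum_(p <- cd_list N f) p.1 *+ (FMonom p.2 == w).
Proof. by rewrite /cd_poly raddf_sum; apply: eq_bigr => p _; rewrite /= mcoeffU. Qed.

Lemma cd_poly_homogeneous N f : cd_homogeneous N (cd_poly N f).
Proof.
move=> w; rewrite cd_poly_coeff => h.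
have [p hp pw] : exists2 p, p \in cd_list N f & FMonom p.2 == w.
  apply/hasP; apply: contraNT h => /hasPn nh; rewrite big_seq big1// => p /nh.
  by move=> /negPf ->.
by rewrite -(eqP pw) /cd_degree; exact: cd_list_degree hp.
Qed.

Lemma cd_poly_c N f : mcoeff (c_power N) (cd_poly N f) = f (nseq N false).
Proof.
by rewrite cd_poly_coeff -cd_list_c; apply: eq_bigr => p _; congr (_ *+ nat_of_bool _).
Qed.

Section CdListSum.
Variables (T : nzRingType) (x y : T).
Local Notation ws := (word_sum x y).

Definition cd_letter (l : bool) : T :=
  if l then x * y + y * x + (y * y) *+ 2 else x + y *+ 2.

Definition cd_list_sum (L : seq (int * seq bool)) : T :=
  \sum_(p <- L) (\prod_(l <- p.2) cd_letter l) *~ p.1.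

Lemma cd_list_sum_cons l L :
  cd_list_sum [seq (p.1, l :: p.2) | p <- L] = cd_letter l * cd_list_sum L.
Proof.
rewrite /cd_list_sum big_map mulr_sumr; apply: eq_bigr => p _ /=.
by rewrite big_cons mulrzAr.
Qed.

Lemma cd_listE N f : gds N f -> cd_list_sum (cd_list N f) = ws N f.
Proof.
have [k] := ubnP N; elim: k N f => // k IH [|N] f; rewrite ltnS => Nk hf.
  by rewrite /cd_list_sum /= big_seq1 /= big_nil.
have h1 := gds_tail1 hf.
rewrite [cd_list _ _]/= {1}/cd_list_sum big_cat /= -!/(cd_list_sum _) cd_list_sum_cons IH //.
case: N Nk hf h1 => [|N] Nk hf h1.
  have := hf [::] 1%N [::] erefl isT isT; rewrite big_ord1 /= => e.
  rewrite /cd_list_sum big_nil addr0 /=.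
  have -> : f [:: true] = 2 * f [:: false] by lia.
  rewrite /cd_tail1 subr0 /cd_letter [LHS]mulrDl intrM; congr (_ + _).
  by rewrite mulrnAl -mulrnAr -[_ *+ 2]mulr_natl.
have h2 := gds_tail2 hf.
rewrite cd_list_sum_cons IH //; last exact: ltnW.
set G1 := ws N.+1 _; set G2 := ws N _.
have ex : ws N.+1 (fun w => f (false :: w)) = G1 + y * G2.
  have -> : y * G2 = ws N.+1 (fun w => if w is true :: w' then cd_tail2 f w' else 0).
    by rewrite /= word_sum0 mulr0 add0r.
  by rewrite -word_sumD; apply: eq_word_sum => w _; rewrite /cd_tail1 subrK.
have ey : ws N.+1 (fun w => f (true :: w)) = (G1 + y * G2) *+ 2 + x * G2.
  rewrite -ex -word_sum2.
  have -> : x * G2 = ws N.+1 (fun w => if w is false :: w' then cd_tail2 f w' else 0).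
    by rewrite /= word_sum0 mulr0 addr0.
  rewrite -word_sumD; apply: eq_word_sum => -[//|[] w] [sw]; last by rewrite /cd_tail2; lia.
  (* For words starting with y y the relation of a gap of length 1 says that the value is twice that
     at x y, which is what the absence of y in x f2 demands. *)
  have := hf [::] 1%N (true :: w); rewrite big_ord1 expr0 mul1r expr1 /= sw => /(_ erefl isT isT) ->.
  by rewrite opprK addr0.
transitivity (x * ws N.+1 (fun w => f (false :: w)) + y * ws N.+1 (fun w => f (true :: w)));
  last by [].
by rewrite ex ey /cd_letter cd_ring_identity.
Qed.

End CdListSum.

Lemma cd_eval_poly (A : nzRingType) N f : gds N f ->
  cd_eval A (cd_poly N f) = word_sum (nc_a A - nc_b A) (nc_b A) N f.
Proof.
move=> hf; rewrite -cd_listE //.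
have lE l : (if l then nc_d A else nc_c A) = cd_letter (nc_a A - nc_b A) (nc_b A) l.
  by case: l; [exact: nc_dE | rewrite /nc_c /cd_letter mulr2n addrA subrK].
pose g : {additive int -> ncpoly A} := intmul 1.
pose h (w : fmonom bool) := \prod_(l <- w) cd_letter (nc_a A - nc_b A) (nc_b A) l.
have -> : cd_eval A (cd_poly N f) = mmap g h (cd_poly N f).
  by rewrite /cd_eval; congr (mmap _ _ _); apply/funext => w; apply: eq_bigr => l _; exact: lE.
rewrite /cd_poly raddf_sum; apply: eq_bigr => p _.
rewrite [LHS]mmapU; exact: mulrzl.
Qed.

(** * Flag vectors *)

Section Expansion.
Variables (T : nzRingType) (a b : T) (N : nat).

Lemma prod_mulrz (I : Type) (r : seq I) (u : I -> T) (s : I -> int) :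
  \prod_(i <- r) (u i *~ s i) = (\prod_(i <- r) u i) *~ (\prod_(i <- r) s i).
Proof.
elim/big_rec3: _ => // i p q t _ ->.
by rewrite mulrzAl mulrzAr -mulrzA mulrC.
Qed.

Lemma prod_subset_expand (U : {set 'I_N}) :
  \prod_(i < N) (if i \in U then b else a - b) =
  \sum_(S : {set 'I_N} | U \subset S)
    (\prod_(i < N) (if i \in S then b else a)) *~ (-1) ^+ #|S :\: U|.
Proof.
(* The weight of letter [c] at place [i]: inside [U] only b occurs, outside both letters occur, b
   with sign -1. *)
pose s (i : 'I_N) (c : bool) : int := if i \in U then c%:R else (-1) ^+ c.
have -> : \prod_(i < N) (if i \in U then b else a - b) =
    \prod_(i < N) \sum_(c : bool) (if c then b else a) *~ s i c.
  apply: eq_bigr => i _; rewrite big_bool /s /=; case: (i \in U).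
    by rewrite mulr1z mulr0z addr0.
  by rewrite expr1 expr0 mulrN1z mulr1z addrC.
rewrite bigA_distr_bigA /= (reindex (fun S : {set 'I_N} => [ffun i => i \in S])) /=; last first.
  exists (fun f : {ffun 'I_N -> bool} => [set i | f i]%SET) => [S _|f _].
    by apply/setP => i; rewrite inE ffunE.
  by apply/ffunP => i; rewrite ffunE inE.
rewrite [RHS]big_mkcond /=; apply: eq_bigr => S _.
under eq_bigr do rewrite ffunE; rewrite prod_mulrz.
have [US|/fintype.subsetPn[i iU iS]] := boolP (U \subset S); last first.
  rewrite [X in _ *~ X](bigD1 i) //= /s iU (negPf iS) mul0r mulr0z //.
congr (_ *~ _); rewrite (bigID (fun i => i \in S :\: U)) /= [X in _ * X]big1 ?mulr1.
  rewrite -prodr_const; apply: eq_bigr => i; rewrite inE => /andP[iU iS].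
  by rewrite /s (negPf iU) iS expr1.
move=> i; rewrite inE negb_and negbK /s; case: ifP => [iU _|_ /= /negPf ->]; last by rewrite expr0.
by rewrite (fintype.subsetP US _ iU).
Qed.

Lemma flag_expand (g : {set 'I_N} -> int) (f : seq bool -> int) :
  (forall U, g U = f [seq i \in U | i <- enum 'I_N]) ->
  \sum_(S : {set 'I_N}) (\prod_(i < N) (if i \in S then b else a)) *~
    (\sum_(U : {set 'I_N} | U \subset S) (-1) ^+ #|S :\: U| * g U) =
  word_sum (a - b) b N f.
Proof.
move=> gE; rewrite word_sumE.
rewrite (reindex (fun S : {set 'I_N} => [tuple (i \in S) | i < N])); last first.
  exists (fun w : N.-tuple bool => [set i | tnth w i]%SET) => [S _|w _].
    by apply/setP => i; rewrite inE tnth_mktuple.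
  by apply: eq_from_tnth => i; rewrite tnth_mktuple inE.
under [LHS]eq_bigr => S _ do rewrite mulrz_sumr.
rewrite (exchange_big_dep predT) //; apply: eq_bigr => U _.
under [LHS]eq_bigr => S _ do rewrite mulrzA.
rewrite -mulrz_suml gE; congr (_ *~ _).
rewrite -[LHS]prod_subset_expand [RHS]big_tuple.
by apply: eq_bigr => i _; rewrite tnth_mktuple.
Qed.

End Expansion.

Section Flags.
Variables (disp : Order.disp_t) (P : finTBPOrderType disp) (rho : P -> nat).
Hypothesis rho_lt : forall x y : P, (x < y)%O -> (rho x < rho y)%N.
Hypothesis rho_bot : rho \bot%O = 0%N.
Local Notation N := (poset_N rho).
Hypothesis rho_top : rho \top%O = N.+1.

(** The first letter of the word stands for rank [r], and the chain continues above [x]. The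
    recursion exposes the chosen element below each gap, where the Euler relation will be
    applied. *)
Fixpoint flag_count (w : seq bool) (x : P) (r : nat) : int :=
  match w with
  | [::] => 1
  | false :: w' => flag_count w' x r.+1
  | true :: w' => \sum_(z | (x < z)%O && (rho z == r)) flag_count w' z r.+1
  end.

Definition flag_word (w : seq bool) : int := flag_count w \bot%O 1.

Fixpoint chain_count (rs : seq nat) (x : P) : nat :=
  if rs is r :: rs' then (\sum_(z | (x < z)%O && (rho z == r)) chain_count rs' z)%N else 1%N.

Lemma chain_countE k rs x : size rs = k ->
  #|[pred t : k.-tuple P | path <%O x t && (map rho t == rs)]| = chain_count rs x.
Proof.
rewrite -sum1_card; elim: k rs x => [|k IH] [|r rs] x // sk.
  rewrite (big_pred1 [tuple]) // => t; rewrite inE (tuple0 t) /=.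
  by rewrite eqxx.
rewrite (@big_tuple_cons _ _ k (fun t => path <%O x t && (map rho t == r :: rs)) (fun=> 1%N)) /=.
rewrite [RHS]big_mkcond /=; apply: eq_bigr => z _.
case: ifP => [/andP[xz rz]|h]; last first.
  rewrite big_pred0 // => t; rewrite eqseq_cons; apply: contraFF h.
  by move=> /andP[/andP[-> _] /andP[-> _]].
rewrite -(IH rs z) /=; last by case: sk.
apply: eq_bigl => t.
by rewrite inE xz eqseq_cons rz.
Qed.

Fixpoint ranks (r : nat) (w : seq bool) : seq nat :=
  if w is l :: w' then (if l then r :: ranks r.+1 w' else ranks r.+1 w') else [::].

Lemma flag_count_ranks w x r : flag_count w x r = (chain_count (ranks r w) x)%:Z.
Proof.
elim: w x r => [|[] w IH] x r //=.
rewrite (big_morph Posz PoszD (erefl _)); apply: eq_bigr => z _; exact: IH.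
Qed.

Lemma ranks_filter (S : {set 'I_N}) (l : seq 'I_N) r : map val l = iota r (size l) ->
  ranks r.+1 [seq i \in S | i <- l] = [seq (val i).+1 | i <- l & i \in S].
Proof.
elim: l r => [|i l IH] r //= [ir hl].
by case: ifP => _ /=; rewrite (IH r.+1 hl) ?ir.
Qed.

Lemma flag_fE (S : {set 'I_N}) :
  (flag_f S)%:Z = flag_word [seq i \in S | i <- enum 'I_N].
Proof.
rewrite /flag_word flag_count_ranks; congr Posz.
have -> : ranks 1 [seq i \in S | i <- enum 'I_N] = rank_seq S.
  rewrite (@ranks_filter S _ 0); last by rewrite val_enum_ord size_enum_ord.
  by rewrite /rank_seq; congr map; rewrite {2}/enum_mem -enumT.
rewrite -(@chain_countE #|S|); last by rewrite size_map -cardE.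
apply: eq_card => t; rewrite !inE /= rcons_path.
case: eqP => [ht|]; last by rewrite !andbF.
(* A chain with the prescribed ranks lies below the maximum automatically, because those ranks are
   at most N. *)
rewrite !andbT; apply: andb_idr => _.
rewrite lt_neqAle lex1 andbT; apply/eqP => e.
have : rho (last \bot%O t) = N.+1 by rewrite e.
have : last \bot%O t \in \bot%O :: t by rewrite mem_last.
rewrite inE => /orP[/eqP ->|lt]; first by rewrite rho_bot.
have : rho (last \bot%O t) \in rank_seq S by rewrite -ht map_f.
by move=> /mapP[i _ ->] [] iN; have := ltn_ord i; rewrite /= iN ltnn.
Qed.

Lemma ab_indexE (A : nzRingType) :
  ab_index rho A = word_sum (nc_a A - nc_b A) (nc_b A) N flag_word.
Proof.
rewrite -(flag_expand (nc_a A) (nc_b A) flag_fE).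
by apply: eq_bigr => S _; exact: scaler_int.
Qed.

(** The alternating sum over the closed interval vanishes. The two ends are written separately
    because an open interval of the face poset consists of cells only. *)
Definition euler_rel (x y : P) : Prop :=
  \sum_(z | (x < z < y)%O) (-1) ^+ rho z = - (-1) ^+ rho x - (-1) ^+ rho y :> int.

Lemma flag_count_nseq p w x r : flag_count (nseq p false ++ w) x r = flag_count w x (r + p).
Proof. by elim: p r => [|p IH] r /=; rewrite ?addn0// IH addSnnS. Qed.

(** Inserting a rank into the gap and then choosing an element of that rank amounts to choosing any
    element of the gap. *)
Lemma flag_gap_sum x m v : 
  \sum_(p < m) (-1) ^+ p *
    flag_count (nseq p false ++ true :: nseq (m - p.+1) false ++ v) x (rho x).+1 =
  \sum_(z | (x < z)%O && (rho z < (rho x).+1 + m)%N)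
    (-1) ^+ (rho z + (rho x).+1) * flag_count v z ((rho x).+1 + m).
Proof.
set r := (rho x).+1.
have E (p : 'I_m) : flag_count (nseq p false ++ true :: nseq (m - p.+1) false ++ v) x r =
    \sum_(z | (x < z)%O && (rho z == r + p)%N) flag_count v z (r + m).
  rewrite flag_count_nseq /=; apply: eq_bigr => z _; rewrite flag_count_nseq.
  by congr (flag_count _ _ _); have := ltn_ord p; lia.
under eq_bigr do rewrite E mulr_sumr.
rewrite (exchange_big_dep (fun z => (x < z)%O && (rho z < r + m)%N)) /=; last first.
  by move=> p z _ /andP[-> /eqP ->]; have := ltn_ord p; lia.
apply: eq_bigr => z /andP[xz zm]; have := rho_lt xz => rz.
have hp : (rho z - r < m)%N by rewrite /r; lia.
rewrite (big_pred1 (Ordinal hp)) => [|p] /=.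
  congr (_ * _); rewrite -signr_odd -[RHS]signr_odd; congr (_ ^+ nat_of_bool _).
  by rewrite oddB ?oddD// /r; lia.
rewrite xz /= -val_eqE /=; apply/eqP/eqP; rewrite /r; lia.
Qed.

Hypothesis eulerian : forall x y : P, (x < y)%O ->
  x != \bot%O \/ y != \top%O -> euler_rel x y.

(** The Euler relation is applied between [x] and the element that closes the gap, the maximum if
    [v] is empty. The whole poset occurs only when [x] is the minimum and [v] is empty. *)
Lemma flag_gap x m v : head true v -> ((rho x).+1 + m + size v = N.+1)%N ->
  (x != \bot%O \/ v <> [::] \/ euler_rel \bot%O \top%O) ->
  \sum_(p < m) (-1) ^+ p *
    flag_count (nseq p false ++ true :: nseq (m - p.+1) false ++ v) x (rho x).+1 =
  (1 - (-1) ^+ m) * flag_count (nseq m false ++ v) x (rho x).+1.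
Proof.
move=> hv sN hx; rewrite flag_gap_sum flag_count_nseq.
have sgn k : (-1) ^+ (k + (rho x).+1) = - (-1) ^+ (rho x) * (-1) ^+ k :> int.
  by rewrite exprD exprS mulN1r mulrN mulNr mulrC.
have sq k : (-1) ^+ k * (-1) ^+ k = 1 :> int by rewrite -expr2 sqrr_sign.
have between y : (x < y)%O -> rho y = ((rho x).+1 + m)%N -> euler_rel x y ->
    \sum_(z | (x < z < y)%O) (-1) ^+ (rho z + (rho x).+1) = 1 - (-1) ^+ m :> int.
  move=> xy ry e; under eq_bigr do rewrite sgn.
  rewrite -mulr_sumr e ry addSn exprS exprD mulN1r opprK mulrDr mulrNN sq mulNr.
  by rewrite mulrA sq mul1r.
case: v hv sN hx => [|[] v] // _ sN hx /=.
  rewrite mulr1; have rT : rho \top%O = ((rho x).+1 + m)%N by move: sN => /=; rewrite rho_top; lia.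
  have xT : (x < \top)%O.
    by rewrite lt_neqAle lex1 andbT; apply/eqP => e; move: rT; rewrite -e; lia.
  rewrite -(between _ xT rT); last first.
    have [/eqP x0|x0] := boolP (x == \bot%O); last by apply: eulerian => //; left.
    by case: hx => [|[//|]]; rewrite x0 ?eqxx.
  apply: eq_big => [z|z _]; last by rewrite mulr1.
  congr (_ && _); rewrite -rT; apply/idP/idP => [|/rho_lt//] h.
  by rewrite lt_neqAle lex1 andbT; apply/eqP => e; move: h; rewrite e ltnn.
(* The element [t] closing the gap is fixed first; the inner sum then runs over the open interval
   from [x] to [t]. *)
rewrite mulr_sumr; under eq_bigr do rewrite mulr_sumr.
rewrite (exchange_big_dep (fun t => (x < t)%O && (rho t == (rho x).+1 + m)%N)) /=; last first.
  by move=> z t /andP[xz _] /andP[zt ->]; rewrite (lt_trans xz zt).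
apply: eq_bigr => t /andP[xt /eqP rt]; rewrite -mulr_suml; congr (_ * _).
have tT : t != \top%O.
  by apply/eqP => e; move: rt sN => /=; rewrite e rho_top; lia.
rewrite -(between t xt rt); last by apply: eulerian => //; right.
apply: eq_bigl => z; rewrite rt eqxx andbT; case: (boolP (x < z)%O) => //= xz.
by case: (boolP (z < t)%O) => [zt|]; rewrite ?andbF// -rt rho_lt.
Qed.

Lemma flag_gap_prefix u x r m v : last true u -> head true v ->
  (r + size u + m + size v = N.+1)%N ->
  (u = [::] -> r = (rho x).+1 /\ (x != \bot%O \/ v <> [::] \/ euler_rel \bot%O \top%O)) ->
  \sum_(p < m) (-1) ^+ p *
    flag_count (u ++ nseq p false ++ true :: nseq (m - p.+1) false ++ v) x r =
  (1 - (-1) ^+ m) * flag_count (u ++ nseq m false ++ v) x r.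
Proof.
elim: u x r => [|[] u IH] x r hu hv sN hx.
- by have [-> hx'] := hx erefl; apply: flag_gap => //; move: sN; rewrite (hx erefl).1 /=; lia.
- rewrite /=; under eq_bigr do rewrite mulr_sumr.
  rewrite exchange_big /= mulr_sumr; apply: eq_bigr => z /andP[xz /eqP rz].
  apply: IH => //; first by move: sN => /=; lia.
  move=> _; rewrite rz; split=> //; left.
  by apply/eqP => z0; move: xz; rewrite z0 ltx0.
- rewrite /=; apply: IH => //; first by case: u hu {hx sN}.
    by move: sN => /=; lia.
  by move=> u0; move: hu; rewrite u0.
Qed.

Lemma flag_gds_semi u m v : (size u + m + size v)%N = N -> last true u -> head true v ->
  u <> [::] \/ v <> [::] \/ euler_rel \bot%O \top%O ->
  \sum_(p < m) (-1) ^+ p * flag_word (u ++ nseq p false ++ true :: nseq (m - p.+1) false ++ v) =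
  (1 - (-1) ^+ m) * flag_word (u ++ nseq m false ++ v).
Proof.
move=> sN hu hv h; apply: flag_gap_prefix => //; first by lia.
by move=> u0; rewrite rho_bot; split=> //; case: h => [//|h]; right.
Qed.

Lemma flag_gds : euler_rel \bot%O \top%O -> gds N flag_word.
Proof. by move=> e u m v sN hu hv; apply: flag_gds_semi => //; right; right. Qed.

Lemma flag_word_empty k : flag_word (nseq k false) = 1.
Proof. by rewrite -[nseq _ _]cats0 /flag_word flag_count_nseq. Qed.

Section SemiEulerian.
Variable chi : int.
Hypothesis chiE : \sum_(z | (\bot < z < \top)%O) (-1) ^+ (rho z).+1 = chi :> int.
Hypothesis N_odd : odd N.

(** The flag vector minus that of (1 - chi/2) x^N + (chi/2) c^N. On a set of k > 0 ranks the latter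
    is half of chi 2^k; on the empty set both are 1, hence the default 0. *)
Definition reduced_flag (w : seq bool) : int :=
  if has id w then flag_word w - chi * 2 ^+ (count id w).-1 else 0.

Lemma alt_sum m : \sum_(p < m) (-1) ^+ p = (odd m)%:R :> int.
Proof.
elim: m => [|m IH]; first by rewrite big_ord0.
by rewrite big_ord_recr /= IH -signr_odd; case: (odd m).
Qed.

Lemma reduced_gds : gds N reduced_flag.
Proof.
move=> u m v sN hu hv.
have ht w w' : has id (w ++ true :: w') by rewrite has_cat /= orbT.
have cnt0 k : count id (nseq k false) = 0%N by elim: k.
have has0 k : has id (nseq k false) = false by elim: k.
have E (p : 'I_m) : (-1) ^+ p * reduced_flag (u ++ nseq p false ++ true :: nseq (m - p.+1) false ++ v) =
    (-1) ^+ p * flag_word (u ++ nseq p false ++ true :: nseq (m - p.+1) false ++ v) -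
    (-1) ^+ p * (chi * 2 ^+ (count id u + count id v)).
  rewrite /reduced_flag catA ht -catA !count_cat /= count_cat !cnt0 add0n add0n.
  by rewrite addnCA /= mulrBr.
under eq_bigr do rewrite E; rewrite sumrB -mulr_suml alt_sum.
have sgn : (-1) ^+ m = 1 - (odd m)%:R - (odd m)%:R :> int by rewrite -signr_odd; case: (odd m).
(* The gap containing all ranks is the only relation that [flag_word] may violate. There the
   alternating sum is [chi], and as N is odd the subtracted terms also add up to chi 2^0. *)
have [[u0 v0]|uv] : (u = [::] /\ v = [::]) \/ (u <> [::] \/ v <> [::]).
  by case: (u) (v) => [|? ?] [|? ?]; [left | right; right | right; left | right; left].
  rewrite u0 v0 /= in sN *; have mN : m = N by move: sN; rewrite addn0.
  rewrite /reduced_flag cats0 has0 mulr0 mulr1 mN N_odd mul1r /flag_word.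
  apply/eqP; rewrite subr_eq0; apply/eqP.
  have := flag_gap_sum \bot%O N [::]; rewrite rho_bot => ->.
  rewrite -[RHS]chiE; apply: eq_big => [z|z _]; last by rewrite addn1 mulr1.
  congr (_ && _); rewrite add1n -rho_top; apply/idP/idP => [|/rho_lt//] h.
  by rewrite lt_neqAle lex1 andbT; apply/eqP => e; move: h; rewrite e ltnn.
have hc : has id (u ++ nseq m false ++ v) && (0 < count id u + count id v)%N.
  rewrite !has_cat has0 /= !has_count -addn_gt0 andbb.
  case: uv => [|vn].
    case/lastP: (u) hu => // u' l; rewrite last_rcons => l1 _.
    by rewrite -cats1 count_cat /= l1; lia.
  by case: (v) hv vn => // -[] v' // _ _; rewrite /=; lia.
have [h1 h2] := andP hc.
rewrite flag_gds_semi //; last by case: uv; [left | right; left].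
rewrite /reduced_flag h1 !count_cat cnt0 add0n mulrBr; congr (_ - _).
rewrite sgn -[in LHS](prednK h2) exprS; case: (odd m); ring.
Qed.

Lemma reduced_flagE w : (flag_word w = reduced_flag w + (if has id w then chi * 2 ^+ (count id w).-1 else flag_word w))%R.
Proof. by rewrite /reduced_flag; case: ifP => _; rewrite ?subrK ?add0r. Qed.

End SemiEulerian.
End Flags.

(** The expected sign satisfies the recursion of the Möbius function: up to the factor (-1)^(rho x),
    that recursion is the Euler relation. *)
Lemma eulerian_mobius (disp : Order.disp_t) (P : finTBPOrderType disp) (rho : P -> nat) :
  (forall x y : P, (x < y)%O -> (rho x < rho y)%N) ->
  (forall x y : P, (x < y)%O -> euler_rel rho x y) -> is_eulerian rho.
Proof.
move=> rho_lt rel x y; have [k] := ubnP (rho y); elim: k y => // k IH y; rewrite ltnS => yk.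
rewrite le_eqVlt => /orP[/eqP <-|xy]; first by rewrite mobius_xx subnn.
have sgn z : (x <= z)%O -> (-1) ^+ (rho z - rho x) = (-1) ^+ rho x * (-1) ^+ rho z :> int.
  rewrite le_eqVlt => /orP[/eqP <-|/rho_lt xz]; first by rewrite subnn -expr2 sqrr_sign.
  rewrite -exprD -signr_odd -[RHS]signr_odd oddD oddB ?(ltnW xz)//.
  by rewrite addbC.
rewrite mobius_lt // (bigD1 x) /=; last by rewrite lexx xy.
rewrite mobius_xx (eq_bigr (fun z => (-1) ^+ rho x * (-1) ^+ rho z)); last first.
  move=> z /andP[/andP[xz zy] _]; rewrite -sgn // IH //.
  exact: leq_trans (rho_lt _ _ zy) yk.
rewrite (eq_bigl (fun z => x < z < y)%O); last first.
  move=> z; rewrite [(x < z)%O]lt_neqAle [x == z]eq_sym.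
  by case: (z == x); case: (x <= z)%O; case: (z < y)%O.
rewrite -mulr_sumr (rel _ _ xy) (sgn _ (ltW xy)) mulrBr mulrN -expr2 sqrr_sign.
by rewrite addrA subrr sub0r opprK.
Qed.

(** * Euler relations of the face poset *)

Section FacePosetEuler.
Variables (R : realType) (M : topologicalType) (Om : regular_cell_complex R M) (n : nat).
Hypothesis M_manifold : is_manifold R n M.

Local Notation P := (face_poset Om).
Local Notation rho := (@face_rank R M Om).
Local Notation chi := (euler_char R M).

Let locally_euclidean := let: And4 _ _ _ h := M_manifold in h.
Let M_hausdorff := let: And4 _ h _ _ := M_manifold in h.

Lemma manifold_dim : complex_dim Om = n.
Proof. by case: M_manifold => -[x0 _] _ _ loc; exact: complex_dimE x0 _ loc. Qed.

Lemma cell_dim_le (s : Om) : (cell_dim s <= n)%N.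
Proof. by rewrite -manifold_dim; exact: (leq_bigmax_cond (F := fun s : Om => cell_dim s)). Qed.

Lemma poset_NE : poset_N rho = n.+1.
Proof. by rewrite /poset_N /= manifold_dim. Qed.

Lemma lt_cells (t s : Om) : (inr t < inr s :> P)%O = face_of t s && (t != s).
Proof. by rewrite lt_neqAle andbC; congr (_ && ~~ _); apply/eqP/eqP => [[]|->]. Qed.

Lemma lt_bot_cell (s : Om) : (\bot < inr s :> P)%O.
Proof. by rewrite lt_neqAle le0x andbT. Qed.

Lemma lt_cell_top (s : Om) : (inr s < \top :> P)%O.
Proof. by rewrite lt_neqAle lex1 andbT. Qed.

Lemma top_ltF (y : P) : (inl true < y :> P)%O = false.
Proof.
apply/negP => /lt_geF h; have h' : (y <= inl true :> P)%O by exact: lex1.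
by rewrite h' in h.
Qed.

Lemma lt_botF (x : P) : (x < inl false :> P)%O = false.
Proof.
apply/negP => /lt_geF h; have h' : (inl false <= x :> P)%O by exact: le0x.
by rewrite h' in h.
Qed.

Lemma face_rank_lt (x y : P) : (x < y)%O -> (rho x < rho y)%N.
Proof.
case: x y => [[]|t] [[]|s]; rewrite ?top_ltF ?lt_botF //.
  by rewrite /= manifold_dim !ltnS cell_dim_le.
by rewrite lt_cells => /andP[ts nts]; have [ets|] := face_of_dim ts; rewrite ?ets ?eqxx // in nts *.
Qed.

Lemma open_interval_sum (x y : P) (F : P -> int) :
  \sum_(z | (x < z < y)%O) F z = \sum_(s : Om | (x < (inr s : P) < y)%O) F (inr s).
Proof.
rewrite big_sumType /= [X in X + _]big_pred0 ?add0r // => -[].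
  by rewrite top_ltF andbF.
by rewrite lt_botF.
Qed.

Lemma euler_charE_cells : chi = \sum_(s : Om) (-1) ^+ cell_dim s.
Proof.
case: M_manifold => -[x0 _] _ _ _.
have := Euler_total x0 (None : option Om); rewrite /= setC0 => /euler_charE ->.
by rewrite opprB addrC subrK.
Qed.

(** Three kinds of interval remain: below a cell ([sum_faces]), above a cell ([sum_above]) and
    between two cells ([sum_between]). *)
Lemma semi_eulerian (x y : P) : (x < y)%O -> x != \bot%O \/ y != \top%O -> euler_rel rho x y.
Proof.
case: M_manifold => -[x0 _] _ _ _.
rewrite /euler_rel open_interval_sum /=; under eq_bigr do rewrite exprS mulN1r.
rewrite sumrN; case: x y => [[]|t] [[]|s] xy h; move: xy;
  rewrite ?top_ltF ?lt_botF // => xy.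
- by case: h => /eqP.
- have := sum_faces x0 s; rewrite (bigD1 s) /=; last exact: face_of_refl.
  rewrite (eq_bigl (fun u : Om => (\bot < (inr u : P) < (inr s : P))%O)); last first.
    by move=> u; rewrite lt_bot_cell lt_cells.
  rewrite expr0 exprS mulN1r; set a := (-1) ^+ _; set b := \sum_(_ | _) _.
  by move: a b => a b; lia.
- have := sum_above x0 M_hausdorff locally_euclidean t; rewrite (bigD1 t) /=; last exact: face_of_refl.
  rewrite (eq_bigl (fun u : Om => ((inr t : P) < (inr u : P) < \top)%O)); last first.
    by move=> u; rewrite lt_cell_top andbT lt_cells eq_sym.
  rewrite manifold_dim !exprS !mulN1r opprK; set a := (-1) ^+ _; set b := \sum_(_ | _) _.
  by set c := (-1) ^+ n; move: a b c => a b c; lia.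
move: xy; rewrite lt_cells => /andP[ts nts].
have := sum_between x0 ts nts; rewrite (bigD1 t) /=; last by rewrite face_of_refl.
rewrite (bigD1 s) /=; last by rewrite ts face_of_refl eq_sym.
rewrite (eq_bigl (fun u : Om => ((inr t : P) < (inr u : P) < (inr s : P))%O)); last first.
  move=> u; rewrite !lt_cells [t == u]eq_sym.
  by case: (face_of t u); case: (face_of u s); case: (u == t); case: (u == s).
rewrite !exprS !mulN1r; set a := (-1) ^+ cell_dim t; set b := (-1) ^+ cell_dim s.
by set c := \sum_(_ | _) _; move: a b c => a b c; lia.
Qed.

(** Incident pairs of cells, with the product of their signs, are summed in two ways. Grouping by
    the lower cell gives (-1)^n times the Euler characteristic, grouping by the upper cell gives the
    Euler characteristic. *)
Lemma odd_chi : odd n -> chi = 0.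
Proof.
case: M_manifold => -[x0 _] _ _ _ on.
have e1 : \sum_(t : Om) \sum_(s | face_of t s) (-1) ^+ cell_dim t * (-1) ^+ cell_dim s = - chi :> int.
  rewrite euler_charE_cells -sumrN; apply: eq_bigr => t _; rewrite -mulr_sumr.
  rewrite (sum_above x0 M_hausdorff locally_euclidean) -[X in _ * X]signr_odd on.
  by rewrite mulrN1.
have e2 : \sum_(t : Om) \sum_(s | face_of t s) (-1) ^+ cell_dim t * (-1) ^+ cell_dim s = chi :> int.
  rewrite euler_charE_cells (exchange_big_dep predT) //=; apply: eq_bigr => s _.
  by rewrite -mulr_suml (sum_faces x0) mul1r.
by have := e1; rewrite e2; lia.
Qed.

Lemma euler_rel_total : odd n -> euler_rel rho \bot%O \top%O.
Proof.
move=> on; rewrite /euler_rel open_interval_sum (eq_bigl predT); last first.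
  by move=> s; rewrite lt_bot_cell lt_cell_top.
rewrite /=; under eq_bigr do rewrite exprS mulN1r.
rewrite sumrN -euler_charE_cells (odd_chi on) manifold_dim expr0 -signr_odd /= negbK on.
by [].
Qed.

End FacePosetEuler.

(** * Assembling the two parities *)

Lemma nc_cE (A : nzRingType) : nc_c A = (nc_a A - nc_b A) + nc_b A *+ 2.
Proof. by rewrite /nc_c mulr2n addrA subrK. Qed.

(** The halves are taken coefficient by coefficient in [rat], since the Euler characteristic may be
    odd. *)
Lemma word_sum_combination (V : lmodType rat) (I : finType) (p : I -> V) (u v w : I -> int)
    (f : I -> int) (a b : rat) :
  (forall i, (f i)%:~R = a * (u i)%:~R + b * (v i)%:~R + (w i)%:~R :> rat) ->
  \sum_i p i *~ f i = a *: (\sum_i p i *~ u i) + b *: (\sum_i p i *~ v i) + \sum_i p i *~ w i.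
Proof.
move=> h; rewrite !scaler_sumr -!big_split /=; apply: eq_bigr => i _.
by rewrite -!scaler_int h !scalerDl !scalerA.
Qed.

Theorem theorem2p10 (R : realType) (n : nat) (M : topologicalType)
    (Om : regular_cell_complex R M)
    (M_compact : compact [set: M])
    (M_manifold : is_manifold R n M) :
  (odd n ->
     is_eulerian (@face_rank R M Om) /\
     exists F : ncpoly int, ab_index (@face_rank R M Om) int = cd_eval int F) /\
  (~~ odd n ->
     exists Phi : ncpoly int,
       [/\ cd_homogeneous n.+1 Phi,
           mcoeff (c_power n.+1) Phi = 0 &
           ab_index (@face_rank R M Om) rat =
             (1 - (euler_char R M)%:~R / 2) *: (nc_a rat - nc_b rat) ^+ n.+1
             + ((euler_char R M)%:~R / 2) *: nc_c rat ^+ n.+1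
             + cd_eval rat Phi]).
Proof.
have rho_lt := face_rank_lt (Om := Om) M_manifold.
have NE := poset_NE Om M_manifold.
have rho_top : face_rank (\top%O : face_poset Om) = (poset_N (@face_rank R M Om)).+1 by [].
have semi := semi_eulerian (Om := Om) M_manifold.
split=> [on|en].
  have tot := euler_rel_total Om M_manifold on; split.
    apply: eulerian_mobius => // x y xy.
    have [x0|x0] := eqVneq x \bot%O; last by apply: semi => //; left.
    have [y1|y1] := eqVneq y \top%O; last by apply: semi => //; right.
    by rewrite x0 y1.
  exists (cd_poly (poset_N (@face_rank R M Om)) (flag_word (@face_rank R M Om))).
  rewrite cd_eval_poly; first exact: ab_indexE.
  exact: flag_gds.
pose chi := euler_char R M.
have chiE : \sum_(z : face_poset Om | (\bot < z < \top)%O) (-1) ^+ (face_rank z).+1 = chi.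
  rewrite open_interval_sum /chi (euler_charE_cells Om M_manifold).
  by apply: eq_big => [s|s _]; rewrite ?lt_bot_cell ?lt_cell_top //= !exprS mulN1r mulN1r opprK.
have oN : odd (poset_N (@face_rank R M Om)) by rewrite NE /= en.
have gdsr := reduced_gds rho_lt (erefl _) rho_top semi chiE oN.
exists (cd_poly n.+1 (reduced_flag (@face_rank R M Om) chi)); rewrite -NE; split.
- exact: cd_poly_homogeneous.
- rewrite cd_poly_c /reduced_flag (_ : has id _ = false) //.
  by elim: (poset_N _).
rewrite cd_eval_poly // ab_indexE // nc_cE -word_sum_pow -(word_sum_empty _ (nc_b rat)) !word_sumE.
apply: word_sum_combination => w; rewrite /reduced_flag.
(* On a nonempty set of ranks chi/2 times 2^k is the integer chi 2^(k-1). On the empty set the flag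
   number 1 is (1 - chi/2) + chi/2. *)
have [hw|hw] := boolP (has id w).
  rewrite mulr0 add0r intrB intrM rmorphXn /= -/chi.
  have c0 : (0 < count id w)%N by rewrite -has_count.
  rewrite -[in X in _ * X](prednK c0) rmorphXn /= exprS.
  by field.
have -> : (w : seq bool) = nseq (size w) false.
  by apply/all_pred1P; rewrite -[all _ _]negbK -has_predC; apply: contra hw => /hasP[l lw /negPf]; case: l lw => // lw _; apply/hasP; exists true.
rewrite flag_word_empty (_ : count id _ = 0%N); last by elim: (size w).
by rewrite expr0 mulr1 mulr1 addr0 subrK.
Qed.
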